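(* Let $\mathbb{D}=\{z\in\mathbb{C}:|z|<1\}$ and let $f$ be analytic on $\mathbb{D}$. Fix an integer $n\ge 2$. Define, for $0<r<1$, \[ \phi_{\operatorname{n-Diam}}(r)=\frac{d_n(f(r\mathbb{D}))}{d_n(\mathbb{D})\,r},\qquad \phi_{\operatorname{Cap}}(r)=\frac{\operatorname{Cap}(f(r\mathbb{D}))}{\operatorname{Cap}(r\mathbb{D})}=\frac{d_\infty(f(r\mathbb{D}))}{d_\infty(r\mathbb{D})}. \] Then $\phi_{\operatorname{Cap}}$ and $\phi_{\operatorname{n-Diam}}$ are increasing and log-convex on $(0,1)$ (i.e. convex functions of $\log r$). Moreover, they are strictly increasing on $0<r<1$ except in the special case that $f$ is linear.
   Context: For $r>0$, $r\mathbb{D}=\{z:|z|<r\}$ and $f(r\mathbb{D})=\{f(z): z\in r\mathbb{D}\}$ (image set, no multiplicity). A function is called linear if it is of the form $f(z)=az+b$ with $a,b\in\mathbb{C}$ (constants allowed). For a set $E\subset\mathbb{C}$ and $n=2,3,\dots$, the $n$-diameter is $d_n(E)=\sup\big(\prod_{1\le j<k\le n}|\zeta_j-\zeta_k|\big)^{2/(n(n-1))}$, the supremum over all $n$-tuples $\zeta_1,\dots,\zeta_n\in E$; $d_n(E)$ is weakly decreasing in $n$ and the transfinite diameter is $d_\infty(E)=\lim_{n\to\infty}d_n(E)$, which equals the logarithmic capacity $\operatorname{Cap}(E)$. One has $d_n(\mathbb{D})=n^{1/(n-1)}$ and $\operatorname{Cap}(r\mathbb{D})=r$. *)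

(* Defs.v *)
From Stdlib Require Import Reals.
From Coquelicot Require Import Coquelicot.
Open Scope R_scope.

Definition analytic_on_disc (f : C -> C) : Prop :=
  forall z : C, Cmod z < 1 -> @ex_derive C_AbsRing C_NormedModule f z.

Definition disc (r : R) : C -> Prop := fun z => Cmod z < r.

Definition image_disc (f : C -> C) (r : R) : C -> Prop :=
  fun w => exists z : C, Cmod z < r /\ w = f z.

Fixpoint prod_upto (m : nat) (g : nat -> R) : R :=
  match m with
  | O => 1
  | S m' => prod_upto m' g * g m'
  end.

Definition pair_prod (n : nat) (z : nat -> C) : R :=
  prod_upto n (fun k => prod_upto k (fun j => Cmod (Cminus (z j) (z k)))).

Definition nnpow (x e : R) : R := if Rle_dec x 0 then 0 else Rpower x e.

Definition ndiam_vals (n : nat) (E : C -> Prop) (x : R) : Prop :=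
  exists z : nat -> C, (forall i, (i < n)%nat -> E (z i)) /\
    x = nnpow (pair_prod n z) (2 / (INR n * INR (n - 1))).

(* n-diameter d_n(E) = sup of the above (finite for bounded nonempty E) *)
Definition ndiam (n : nat) (E : C -> Prop) : R := real (Lub_Rbar (ndiam_vals n E)).

Definition tdiam (E : C -> Prop) : R := real (Lim_seq (fun m => ndiam (m + 2) E)).

Definition phi_ndiam (f : C -> C) (n : nat) (r : R) : R :=
  ndiam n (image_disc f r) / (ndiam n (disc 1) * r).

Definition phi_cap (f : C -> C) (r : R) : R :=
  tdiam (image_disc f r) / tdiam (disc r).

Definition is_linear_on_disc (f : C -> C) : Prop :=
  exists a b : C, forall z : C, Cmod z < 1 -> f z = Cplus (Cmult a z) b.

Definition increasing_01 (phi : R -> R) : Prop :=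
  forall r1 r2, 0 < r1 -> r1 <= r2 -> r2 < 1 -> phi r1 <= phi r2.

Definition strictly_increasing_01 (phi : R -> R) : Prop :=
  forall r1 r2, 0 < r1 -> r1 < r2 -> r2 < 1 -> phi r1 < phi r2.

Definition log_convex_01 (phi : R -> R) : Prop :=
  forall t1 t2 l, t1 < 0 -> t2 < 0 -> 0 <= l <= 1 ->
    phi (exp (l * t1 + (1 - l) * t2)) <= l * phi (exp t1) + (1 - l) * phi (exp t2).

(* Main.v *)
(** Fix [w_1, ..., w_n] in the unit disc. The function [prod_(j<k) (f(w_j z) - f(w_k z))] vanishes to
    order [N = n(n-1)/2] at [0], so Hadamard's three circles theorem and the maximum principle apply to
    its quotient by [z^N]; taking the supremum over the [w_j] makes [d_n(f(rD))/r] increasing and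
    log-convex, and letting [n] tend to infinity gives the capacity.

    If such a ratio is not strictly increasing, convexity makes it constant near [0], with value
    at most that of [z |-> f'(0) z]. This is impossible if [f'(0) = 0], as [f] is not constant near [0].
    Otherwise [f = f(0) + a_1 z + a z^(m+1) + ...] with [a_1], [a] nonzero.
    - For [d_n]: the coefficient form of the Schwarz-Pick lemma bounds
      [|V(w)| |sum_(j<k) h_m(w_j, w_k)|], [V] the Vandermonde product and [h_m] the complete
      homogeneous polynomial, by a multiple of [max |V|^2 - |V(w)|^2] for all unimodular [w].
      Hadamard's inequality makes the [n]-th roots of unity a maximum of [|V|]. Rotating one of them by
      [eta] changes [|V|] by [O(eta^2)] but the sum by a nonzero multiple of [eta].
    - For the capacity: some [x] has [|f(x) - f(0)| > |a_1 x|], hence [|f(x) - f(0)| > |a_1| r]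
      for some [r > |x|]. Put [p k] points on the circle of radius [r] and [k] points near [x]. By the
      maximum principle in the radius, the mutual distances between the two groups contribute at least
      [|f(x) - f(0)|] each, which raises the capacity of [f(rD)] above [|a_1| r] once [p] is large.

    Everything rests on the maximum principle, deduced from Goursat's theorem on rectangles. *)

Require Import Defs.
From Stdlib Require Import Reals Lra Lia Classical ClassicalChoice.
From Coquelicot Require Import Coquelicot.
From mathcomp Require all_boot all_order all_algebra Rstruct complex.
Open Scope R_scope.

(** * Complex differentiability *)

(** Strict inequalities between the [d_n] can be lost in the limit, so the capacity needs a rigidity
    argument of its own, with a gain that does not fade as the number of points grows. For the same
    reason, estimates meant for the capacity carry constants independent of [n]. Differentiability
    is only known pointwise and no power series is at hand: the coefficient that follows [a_1] comes
    from removable singularities, and a function that vanishes to every order at [0] is shown to be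
    zero by the maximum principle. Suprema over open discs need not be attained and diameters may be
    zero; hence the many bounds with a slack that is sent to zero at the end. Convexity is obtained
    for the logarithm: [log d_n(f(rD))] is convex in [log r], subtracting [log r] preserves this,
    and the exponential of a convex function is convex. *)

Lemma Cmod_minus_sym (a b : C) : Cmod (a - b) = Cmod (b - a).
Proof. rewrite <- Cmod_opp. f_equal. ring. Qed.

Lemma Cmod_triangle_minus (a b : C) : Cmod (a - b) <= Cmod a + Cmod b.
Proof. unfold Cminus. rewrite <- (Cmod_opp b). apply Cmod_triangle. Qed.

Lemma Cmod_triangle_rev (a b : C) : Cmod a - Cmod b <= Cmod (a - b).
Proof.
  assert (H := Cmod_triangle (a - b) b).
  replace (a - b + b)%C with a in H by ring. lra.
Qed.

Lemma im_le_Cmod (z : C) : Rabs (Im z) <= Cmod z.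
Proof. eapply Rle_trans; [apply Rmax_r | apply Rmax_Cmod]. Qed.

Lemma Cmod_le_abs (x y : R) : Cmod (x, y) <= Rabs x + Rabs y.
Proof.
  replace (x, y) with (RtoC x + Ci * RtoC y)%C
    by (unfold Cplus, Cmult, Ci, RtoC; simpl; f_equal; ring).
  eapply Rle_trans; [apply Cmod_triangle |].
  rewrite Cmod_mult, Cmod_Ci, !Cmod_R. lra.
Qed.

Lemma exp_le_compat (x y : R) : x <= y -> exp x <= exp y.
Proof. intros [H | ->]; [left; now apply exp_increasing | right; reflexivity]. Qed.

Definition cderiv (f : C -> C) (z l : C) : Prop :=
  forall eps, 0 < eps -> exists d, 0 < d /\ forall w, Cmod (w - z) < d ->
    Cmod (f w - f z - l * (w - z)) <= eps * Cmod (w - z).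

Definition cdiff (f : C -> C) (z : C) : Prop := exists l, cderiv f z l.

Definition ccont (f : C -> C) (z : C) : Prop :=
  forall eps, 0 < eps -> exists d, 0 < d /\ forall w, Cmod (w - z) < d ->
    Cmod (f w - f z) < eps.

Definition rcont (u : C -> R) (z : C) : Prop :=
  forall eps, 0 < eps -> exists d, 0 < d /\ forall w, Cmod (w - z) < d ->
    Rabs (u w - u z) < eps.

Lemma ex_derive_cdiff (f : C -> C) (z : C) :
  @ex_derive C_AbsRing C_NormedModule f z -> cdiff f z.
Proof.
  intros [l [_ Hl]]. exists l. intros eps He.
  specialize (Hl z (fun P H => H) (mkposreal eps He)).
  destruct Hl as [d Hd]. exists d. split; [apply cond_pos |].
  intros w Hw. specialize (Hd w). simpl in Hd.
  assert (B : @ball (AbsRing_UniformSpace C_AbsRing) z d w).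
  { unfold ball; simpl. unfold AbsRing_ball, abs, minus, plus, opp; simpl. exact Hw. }
  specialize (Hd B).
  unfold norm, minus, plus, opp, scal, mult in Hd; simpl in Hd.
  replace (l * (w - z))%C with ((w - z) * l)%C by ring.
  exact Hd.
Qed.

Lemma cderiv_ext_loc (f g : C -> C) (z l : C) (r : R) :
  0 < r -> (forall w, Cmod (w - z) < r -> f w = g w) -> cderiv f z l -> cderiv g z l.
Proof.
  intros Hr Hfg H eps He. destruct (H eps He) as [d [Hd H1]].
  exists (Rmin d r). split; [apply Rmin_glb_lt; assumption |].
  intros w Hw. rewrite <- !Hfg.
  - apply H1. eapply Rlt_le_trans; [exact Hw | apply Rmin_l].
  - replace (z - z)%C with (RtoC 0) by ring. now rewrite Cmod_0.
  - eapply Rlt_le_trans; [exact Hw | apply Rmin_r].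
Qed.

Lemma cdiff_ext_loc (f g : C -> C) (z : C) (r : R) :
  0 < r -> (forall w, Cmod (w - z) < r -> f w = g w) -> cdiff f z -> cdiff g z.
Proof. intros Hr Hfg [l Hl]. exists l. now apply (cderiv_ext_loc f g z l r). Qed.

Lemma cdiff_lipschitz_at (f : C -> C) (z : C) : cdiff f z ->
  exists K d, 0 < K /\ 0 < d /\
    forall w, Cmod (w - z) < d -> Cmod (f w - f z) <= K * Cmod (w - z).
Proof.
  intros [l Hl]. destruct (Hl 1 Rlt_0_1) as [d [Hd H]].
  exists (Cmod l + 1), d. assert (L := Cmod_ge_0 l). repeat split; try lra.
  intros w Hw. specialize (H w Hw).
  replace (f w - f z)%C with ((f w - f z - l * (w - z)) + l * (w - z))%C by ring.
  eapply Rle_trans; [apply Cmod_triangle |]. rewrite Cmod_mult. lra.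
Qed.

Lemma cdiff_ccont (f : C -> C) (z : C) : cdiff f z -> ccont f z.
Proof.
  intros H. destruct (cdiff_lipschitz_at f z H) as [K [d [HK [Hd H1]]]].
  intros eps He. exists (Rmin d (eps / K)). split.
  - apply Rmin_glb_lt; [assumption | apply Rdiv_lt_0_compat; assumption].
  - intros w Hw. eapply Rle_lt_trans.
    + apply H1. eapply Rlt_le_trans; [exact Hw | apply Rmin_l].
    + assert (H2 : Cmod (w - z) < eps / K)
        by (eapply Rlt_le_trans; [exact Hw | apply Rmin_r]).
      apply (Rmult_lt_compat_l K) in H2; [| assumption].
      replace (K * (eps / K)) with eps in H2 by (field; lra). exact H2.
Qed.

Lemma ccont_rcont (f : C -> C) (z : C) : ccont f z -> rcont (fun w => Cmod (f w)) z.
Proof.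
  intros H eps He. destruct (H eps He) as [d [Hd H1]]. exists d. split; [assumption |].
  intros w Hw. specialize (H1 w Hw). apply Rabs_def1.
  - assert (A := Cmod_triangle_rev (f w) (f z)). lra.
  - assert (A := Cmod_triangle_rev (f z) (f w)). rewrite Cmod_minus_sym in A. lra.
Qed.

Lemma cdiff_const (c z : C) : cdiff (fun _ => c) z.
Proof.
  exists (RtoC 0). intros eps He. exists 1. split; [lra |]. intros w _.
  replace (c - c - 0 * (w - z))%C with (RtoC 0) by ring. rewrite Cmod_0.
  apply Rmult_le_pos; [lra | apply Cmod_ge_0].
Qed.

Lemma cdiff_id (z : C) : cdiff (fun w => w) z.
Proof.
  exists (RtoC 1). intros eps He. exists 1. split; [lra |]. intros w _.
  replace (w - z - 1 * (w - z))%C with (RtoC 0) by ring. rewrite Cmod_0.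
  apply Rmult_le_pos; [lra | apply Cmod_ge_0].
Qed.

Lemma cdiff_plus (f g : C -> C) (z : C) :
  cdiff f z -> cdiff g z -> cdiff (fun w => f w + g w)%C z.
Proof.
  intros [l Hl] [m Hm]. exists (l + m)%C. intros eps He.
  destruct (Hl (eps / 2) ltac:(lra)) as [d1 [P1 H1]].
  destruct (Hm (eps / 2) ltac:(lra)) as [d2 [P2 H2]].
  exists (Rmin d1 d2). split; [now apply Rmin_glb_lt |]. intros w Hw.
  specialize (H1 w (Rlt_le_trans _ _ _ Hw (Rmin_l _ _))).
  specialize (H2 w (Rlt_le_trans _ _ _ Hw (Rmin_r _ _))).
  replace (f w + g w - (f z + g z) - (l + m) * (w - z))%C
    with ((f w - f z - l * (w - z)) + (g w - g z - m * (w - z)))%C by ring.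
  eapply Rle_trans; [apply Cmod_triangle |]. lra.
Qed.

Lemma cdiff_mult (f g : C -> C) (z : C) :
  cdiff f z -> cdiff g z -> cdiff (fun w => f w * g w)%C z.
Proof.
  intros Hf Hg. destruct (cdiff_lipschitz_at f z Hf) as [K [d0 [HK [Hd0 Hlip]]]].
  assert (Cg := cdiff_ccont g z Hg).
  destruct Hf as [l Hl]. destruct Hg as [m Hm].
  exists (l * g z + f z * m)%C. intros eps He.
  assert (Gz := Cmod_ge_0 (g z)). assert (Fz := Cmod_ge_0 (f z)).
  set (e1 := eps / (3 * (Cmod (g z) + 1))).
  set (e2 := eps / (3 * (Cmod (f z) + 1))).
  set (e3 := eps / (3 * K)).
  assert (P1 : 0 < e1) by (apply Rdiv_lt_0_compat; lra).
  assert (P2 : 0 < e2) by (apply Rdiv_lt_0_compat; lra).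
  assert (P3 : 0 < e3) by (apply Rdiv_lt_0_compat; lra).
  destruct (Hl e1 P1) as [d1 [Q1 H1]]. destruct (Hm e2 P2) as [d2 [Q2 H2]].
  destruct (Cg e3 P3) as [d3 [Q3 H3]].
  exists (Rmin (Rmin d0 d1) (Rmin d2 d3)). split.
  { repeat apply Rmin_glb_lt; assumption. }
  intros w Hw. apply Rmin_Rgt_l in Hw. destruct Hw as [A B].
  apply Rmin_Rgt_l in A. apply Rmin_Rgt_l in B. destruct A as [A0 A1]. destruct B as [A2 A3].
  specialize (Hlip w A0). specialize (H1 w A1). specialize (H2 w A2). specialize (H3 w A3).
  replace (f w * g w - f z * g z - (l * g z + f z * m) * (w - z))%C
    with ((f w - f z - l * (w - z)) * g z + f z * (g w - g z - m * (w - z))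
          + (f w - f z) * (g w - g z))%C by ring.
  eapply Rle_trans; [apply Cmod_triangle |].
  eapply Rle_trans; [apply Rplus_le_compat_r, Cmod_triangle |]. rewrite !Cmod_mult.
  set (t := Cmod (w - z)) in *. assert (T : 0 <= t) by apply Cmod_ge_0.
  assert (I1 : Cmod (f w - f z - l * (w - z)) * Cmod (g z) <= eps / 3 * t).
  { apply Rle_trans with (e1 * t * (Cmod (g z) + 1)).
    - apply Rmult_le_compat; try apply Cmod_ge_0; lra.
    - right. unfold e1. field. lra. }
  assert (I2 : Cmod (f z) * Cmod (g w - g z - m * (w - z)) <= eps / 3 * t).
  { apply Rle_trans with ((Cmod (f z) + 1) * (e2 * t)).
    - apply Rmult_le_compat; try apply Cmod_ge_0; lra.
    - right. unfold e2. field. lra. }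
  assert (I3 : Cmod (f w - f z) * Cmod (g w - g z) <= eps / 3 * t).
  { apply Rle_trans with (K * t * e3).
    - apply Rmult_le_compat; try apply Cmod_ge_0; lra.
    - right. unfold e3. field. lra. }
  lra.
Qed.

Lemma cdiff_comp (f g : C -> C) (z : C) :
  cdiff g z -> cdiff f (g z) -> cdiff (fun w => f (g w)) z.
Proof.
  intros Hg [l Hl]. destruct (cdiff_lipschitz_at g z Hg) as [K [d0 [HK [Hd0 Hlip]]]].
  destruct Hg as [m Hm]. exists (l * m)%C. intros eps He.
  assert (L := Cmod_ge_0 l).
  assert (Pa : 0 < eps / (2 * K)) by (apply Rdiv_lt_0_compat; lra).
  assert (Pb : 0 < eps / (2 * (Cmod l + 1))) by (apply Rdiv_lt_0_compat; lra).
  destruct (Hl _ Pa) as [d1 [Q1 H1]]. destruct (Hm _ Pb) as [d2 [Q2 H2]].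
  exists (Rmin d0 (Rmin (d1 / K) d2)). split.
  { repeat apply Rmin_glb_lt; try assumption. now apply Rdiv_lt_0_compat. }
  intros w Hw. apply Rmin_Rgt_l in Hw. destruct Hw as [A0 B].
  apply Rmin_Rgt_l in B. destruct B as [A1 A2].
  specialize (Hlip w A0). specialize (H2 w A2).
  assert (Hg : Cmod (g w - g z) < d1).
  { eapply Rle_lt_trans; [exact Hlip |]. apply (Rmult_lt_compat_l K) in A1; [| assumption].
    replace (K * (d1 / K)) with d1 in A1 by (field; lra). exact A1. }
  specialize (H1 _ Hg).
  replace (f (g w) - f (g z) - l * m * (w - z))%C
    with ((f (g w) - f (g z) - l * (g w - g z)) + l * (g w - g z - m * (w - z)))%C by ring.
  eapply Rle_trans; [apply Cmod_triangle |]. rewrite Cmod_mult.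
  set (t := Cmod (w - z)) in *. assert (T : 0 <= t) by apply Cmod_ge_0.
  assert (I1 : Cmod (f (g w) - f (g z) - l * (g w - g z)) <= eps / 2 * t).
  { eapply Rle_trans; [exact H1 |]. apply Rle_trans with (eps / (2 * K) * (K * t)).
    - apply Rmult_le_compat_l; [lra | exact Hlip].
    - right. field. lra. }
  assert (I2 : Cmod l * Cmod (g w - g z - m * (w - z)) <= eps / 2 * t).
  { apply Rle_trans with ((Cmod l + 1) * (eps / (2 * (Cmod l + 1)) * t)).
    - apply Rmult_le_compat; try apply Cmod_ge_0; lra.
    - right. field. lra. }
  lra.
Qed.

Lemma cdiff_inv (z : C) : z <> 0 -> cdiff Cinv z.
Proof.
  intros Hz. assert (M := proj1 (Cmod_gt_0 z) Hz). set (m := Cmod z) in *.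
  exists (- / (z * z))%C. intros eps He.
  exists (Rmin (m / 2) (eps * m * m * m / 2)). split.
  { apply Rmin_glb_lt; [lra |]. assert (0 < m * m * m) by (repeat apply Rmult_lt_0_compat; lra).
    assert (0 < eps * (m * m * m)) by (apply Rmult_lt_0_compat; lra). lra. }
  intros w Hw. apply Rmin_Rgt_l in Hw. destruct Hw as [A B].
  assert (W : m / 2 < Cmod w).
  { assert (T := Cmod_triangle_rev z w). rewrite Cmod_minus_sym in T. fold m in T. lra. }
  assert (Hw0 : w <> 0) by (apply Cmod_gt_0; lra).
  replace (/ w - / z - - / (z * z) * (w - z))%C with ((w - z) * (w - z) / (w * (z * z)))%C
    by (field; split; assumption).
  rewrite Cmod_div by (repeat apply Cmult_neq_0; assumption).
  rewrite !Cmod_mult. fold m. set (t := Cmod (w - z)) in *.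
  assert (T : 0 <= t) by apply Cmod_ge_0.
  apply Rle_div_l; [repeat apply Rmult_lt_0_compat; lra |].
  replace (eps * t * (Cmod w * (m * m))) with (t * (eps * (Cmod w * (m * m)))) by ring.
  apply Rmult_le_compat_l; [assumption |].
  assert (0 < eps * (m * m)) by (repeat apply Rmult_lt_0_compat; lra).
  apply Rle_trans with (eps * m * m * m / 2); [lra |].
  replace (eps * m * m * m / 2) with (eps * (m * m) * (m / 2)) by field.
  replace (eps * (Cmod w * (m * m))) with (eps * (m * m) * Cmod w) by ring.
  apply Rmult_le_compat_l; lra.
Qed.

Lemma cdiff_div (f g : C -> C) (z : C) :
  cdiff f z -> cdiff g z -> g z <> 0 -> cdiff (fun w => f w / g w)%C z.
Proof.
  intros Hf Hg H0. apply cdiff_mult; [assumption |].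
  apply (cdiff_comp Cinv g); [assumption | now apply cdiff_inv].
Qed.

Lemma cdiff_minus (f g : C -> C) (z : C) :
  cdiff f z -> cdiff g z -> cdiff (fun w => f w - g w)%C z.
Proof.
  intros Hf Hg. apply cdiff_plus; [assumption |].
  apply (cdiff_ext_loc (fun w => - (1) * g w)%C _ z 1); [lra | intros; ring |].
  apply cdiff_mult; [apply cdiff_const | assumption].
Qed.

Lemma cdiff_scal (c : C) (f : C -> C) (z : C) : cdiff f z -> cdiff (fun w => c * f w)%C z.
Proof. intros H. apply cdiff_mult; [apply cdiff_const | assumption]. Qed.

Lemma cdiff_pow (f : C -> C) (k : nat) (z : C) : cdiff f z -> cdiff (fun w => f w ^ k)%C z.
Proof.
  intros H. induction k as [| k IH]; simpl; [apply cdiff_const |].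
  now apply cdiff_mult.
Qed.

(** * The complex exponential *)

Definition cexp (s : C) : C := (exp (Re s) * cos (Im s), exp (Re s) * sin (Im s)).

Lemma cexp_plus (s t : C) : cexp (s + t) = (cexp s * cexp t)%C.
Proof.
  unfold cexp, Cmult. simpl. destruct s as [a b], t as [c d]; simpl.
  rewrite exp_plus, cos_plus, sin_plus. f_equal; ring.
Qed.

Lemma cexp_0 : cexp 0 = 1.
Proof. unfold cexp; simpl. rewrite exp_0, cos_0, sin_0. unfold RtoC. f_equal; ring. Qed.

Lemma Cmod_cexp (s : C) : Cmod (cexp s) = exp (Re s).
Proof.
  unfold cexp, Cmod; simpl fst; simpl snd.
  replace ((exp (Re s) * cos (Im s)) ^ 2 + (exp (Re s) * sin (Im s)) ^ 2)
    with (exp (Re s) ^ 2 * ((sin (Im s))² + (cos (Im s))²)) by (unfold Rsqr; ring).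
  rewrite sin2_cos2, Rmult_1_r. apply sqrt_pow2. left. apply exp_pos.
Qed.

Lemma cderiv_cexp_0 : cderiv cexp 0 1.
Proof.
  intros eps He.
  (* The two coordinates of the error below cost [9 e t] in total, with [t] the modulus of the
     increment; [eps / 12] leaves room. *)
  set (e := Rmin (eps / 12) 1).
  assert (Pe : 0 < e) by (apply Rmin_glb_lt; lra).
  assert (Le : e <= eps / 12) by apply Rmin_l.
  destruct (derivable_pt_lim_exp_0 e Pe) as [d1 H1].
  destruct (derivable_pt_lim_sin_0 e Pe) as [d2 H2].
  destruct (derivable_pt_lim_cos 0 e Pe) as [d3 H3].
  rewrite sin_0, cos_0 in H3.
  exists (Rmin (Rmin d1 d2) (Rmin d3 e)). split.
  { repeat apply Rmin_glb_lt; try apply cond_pos; lra. }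
  intros w Hw. replace (w - 0)%C with w in * by ring.
  apply Rmin_Rgt_l in Hw. destruct Hw as [A B].
  apply Rmin_Rgt_l in A. apply Rmin_Rgt_l in B. destruct A as [A1 A2]. destruct B as [A3 A4].
  rewrite cexp_0. destruct w as [x y].
  assert (X := re_le_Cmod (x, y)). assert (Y := im_le_Cmod (x, y)). simpl in X, Y.
  set (t := Cmod (x, y)) in *.
  assert (T : 0 <= t) by apply Cmod_ge_0.
  assert (Ex : Rabs (exp x - 1 - x) <= e * Rabs x).
  { destruct (Req_dec x 0) as [-> | Hx].
    - rewrite exp_0. replace (1 - 1 - 0) with 0 by ring. rewrite Rabs_R0. lra.
    - assert (Q : Rabs x < d1) by lra. specialize (H1 x Hx Q).
      rewrite Rplus_0_l, exp_0 in H1.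
      replace (exp x - 1 - x) with (((exp x - 1) / x - 1) * x) by (field; assumption).
      rewrite Rabs_mult. apply Rmult_le_compat_r; [apply Rabs_pos | lra]. }
  assert (Es : Rabs (sin y - y) <= e * Rabs y).
  { destruct (Req_dec y 0) as [-> | Hy].
    - rewrite sin_0. replace (0 - 0) with 0 by ring. rewrite Rabs_R0. lra.
    - assert (Q : Rabs y < d2) by lra. specialize (H2 y Hy Q).
      rewrite Rplus_0_l, sin_0 in H2.
      replace (sin y - y) with (((sin y - 0) / y - 1) * y) by (field; assumption).
      rewrite Rabs_mult. apply Rmult_le_compat_r; [apply Rabs_pos | lra]. }
  assert (Ec : Rabs (cos y - 1) <= e * Rabs y).
  { destruct (Req_dec y 0) as [-> | Hy].
    - rewrite cos_0. replace (1 - 1) with 0 by ring. rewrite Rabs_R0. lra.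
    - assert (Q : Rabs y < d3) by lra. specialize (H3 y Hy Q).
      rewrite Rplus_0_l in H3.
      replace (cos y - 1) with (((cos y - 1) / y - - 0) * y) by (field; assumption).
      rewrite Rabs_mult. apply Rmult_le_compat_r; [apply Rabs_pos | lra]. }
  assert (E1 : e <= 1) by apply Rmin_r.
  assert (Gx : Rabs (exp x - 1) <= 2 * Rabs x).
  { replace (exp x - 1) with ((exp x - 1 - x) + x) by ring.
    eapply Rle_trans; [apply Rabs_triang |].
    assert (0 <= Rabs x) by apply Rabs_pos.
    assert (e * Rabs x <= 1 * Rabs x) by (apply Rmult_le_compat_r; lra). lra. }
  (* Both coordinates are expanded in the small quantities [exp x - 1 - x], [exp x - 1], [cos y - 1]
     and [sin y - y]. *)
  replace (cexp (x, y) - 1 - 1 * (x, y))%C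
    with ((exp x - 1 - x) + (exp x - 1) * (cos y - 1) + (cos y - 1),
          (exp x - 1) * (sin y - y) + (exp x - 1) * y + (sin y - y)).
  2: { unfold cexp, Cminus, Cplus, Copp, Cmult, RtoC; simpl. f_equal; ring. }
  eapply Rle_trans; [apply Cmod_le_abs |].
  assert (0 <= Rabs x) by apply Rabs_pos. assert (0 <= Rabs y) by apply Rabs_pos.
  assert (Ex' : Rabs (exp x - 1 - x) <= e * t) by nra.
  assert (Es' : Rabs (sin y - y) <= e * t) by nra.
  assert (Ec' : Rabs (cos y - 1) <= e * t) by nra.
  assert (Gx' : Rabs (exp x - 1) <= 2 * e) by nra.
  assert (et : 0 <= e * t) by nra.
  assert (M1 : Rabs ((exp x - 1) * (cos y - 1)) <= 2 * (e * t)).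
  { rewrite Rabs_mult. apply Rmult_le_compat; try apply Rabs_pos; lra. }
  assert (M2 : Rabs ((exp x - 1) * (sin y - y)) <= 2 * (e * t)).
  { rewrite Rabs_mult. apply Rmult_le_compat; try apply Rabs_pos; lra. }
  assert (M3 : Rabs ((exp x - 1) * y) <= 2 * (e * t)).
  { rewrite Rabs_mult, <- Rmult_assoc.
    apply Rmult_le_compat; try apply Rabs_pos; lra. }
  assert (S1 := Rabs_triang (exp x - 1 - x + (exp x - 1) * (cos y - 1)) (cos y - 1)).
  assert (S2 := Rabs_triang (exp x - 1 - x) ((exp x - 1) * (cos y - 1))).
  assert (S3 := Rabs_triang ((exp x - 1) * (sin y - y) + (exp x - 1) * y) (sin y - y)).
  assert (S4 := Rabs_triang ((exp x - 1) * (sin y - y)) ((exp x - 1) * y)).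
  assert (e * t <= eps / 12 * t) by (apply Rmult_le_compat_r; lra).
  lra.
Qed.

Lemma cdiff_cexp (s : C) : cdiff cexp s.
Proof.
  apply (cdiff_ext_loc (fun w => cexp s * cexp (w - s))%C _ s 1); [lra | |].
  - intros w _. rewrite <- cexp_plus. f_equal. ring.
  - apply cdiff_scal. apply (cdiff_comp cexp (fun w => w - s)%C).
    + apply cdiff_minus; [apply cdiff_id | apply cdiff_const].
    + replace (s - s)%C with (RtoC 0) by ring. eexists; apply cderiv_cexp_0.
Qed.

(** * Goursat's theorem and the mean value inequality *)

(** Compactness of a rectangle as an induction principle. [P k a c] speaks of the rectangle with
    lower left corner [(a, c)] and sides [L / 2^k], [H / 2^k]. If [P] failed at the top, it would
    fail on one quarter, then on a quarter of that, and so on; the nested rectangles share a point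
    [(x, y)], where the local hypothesis contradicts the failure. It serves both for compactness and
    for Goursat's theorem. *)
Lemma bisection (P : nat -> R -> R -> Prop) (L H a0 c0 : R) :
  0 <= L -> 0 <= H ->
  (forall k a c, P (S k) a c -> P (S k) (a + L / 2 ^ S k) c ->
     P (S k) a (c + H / 2 ^ S k) -> P (S k) (a + L / 2 ^ S k) (c + H / 2 ^ S k) -> P k a c) ->
  (forall x y, exists K, forall k a c, (K <= k)%nat ->
     a <= x <= a + L / 2 ^ k -> c <= y <= c + H / 2 ^ k -> P k a c) ->
  P O a0 c0.
Proof.
  intros HL HH Hsplit Hloc. apply NNPP. intros Hn.
  assert (Hstep : forall s : nat * (R * R), exists s' : nat * (R * R),
    ~ P (fst s) (fst (snd s)) (snd (snd s)) ->
    fst s' = S (fst s) /\ ~ P (fst s') (fst (snd s')) (snd (snd s')) /\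
    (fst (snd s') = fst (snd s) \/ fst (snd s') = fst (snd s) + L / 2 ^ S (fst s)) /\
    (snd (snd s') = snd (snd s) \/ snd (snd s') = snd (snd s) + H / 2 ^ S (fst s))).
  { intros [k [a c]]. simpl fst; simpl snd.
    (* [choice] wants a total successor, so a state where [P] holds is simply kept. *)
    destruct (classic (P k a c)) as [Y | N]; [exists (k, (a, c)); tauto |].
    destruct (classic (P (S k) a c)) as [Y1 | N1];
      [| exists (S k, (a, c)); cbn [fst snd]; tauto].
    destruct (classic (P (S k) (a + L / 2 ^ S k) c)) as [Y2 | N2];
      [| exists (S k, (a + L / 2 ^ S k, c)); cbn [fst snd]; tauto].
    destruct (classic (P (S k) a (c + H / 2 ^ S k))) as [Y3 | N3];
      [| exists (S k, (a, c + H / 2 ^ S k)); cbn [fst snd]; tauto].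
    destruct (classic (P (S k) (a + L / 2 ^ S k) (c + H / 2 ^ S k))) as [Y4 | N4];
      [| exists (S k, (a + L / 2 ^ S k, c + H / 2 ^ S k)); cbn [fst snd]; tauto].
    exfalso. apply N. now apply Hsplit. }
  destruct (choice _ Hstep) as [next Hnext].
  set (sq := fix sq n := match n with O => (O, (a0, c0)) | S m => next (sq m) end).
  assert (Hsq : forall n, fst (sq n) = n /\ ~ P n (fst (snd (sq n))) (snd (snd (sq n)))).
  { induction n as [| n [IH1 IH2]]; [simpl; auto |].
    destruct (Hnext (sq n)) as [E1 [E2 _]]; [now rewrite IH1 |].
    change (sq (S n)) with (next (sq n)).
    assert (E3 : fst (next (sq n)) = S n) by (rewrite E1, IH1; reflexivity).
    split; [exact E3 |]. rewrite <- E3 at 1. exact E2. }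
  set (a := fun n => fst (snd (sq n))). set (c := fun n => snd (snd (sq n))).
  assert (Hpow : forall n, 0 < / 2 ^ n) by (intros; apply Rinv_0_lt_compat, pow_lt; lra).
  assert (Hhalf : forall n, / 2 ^ n = / 2 ^ S n + / 2 ^ S n)
    by (intros n; simpl; field; apply pow_nonzero; lra).
  assert (Hst : forall n,
    (a n <= a (S n) /\ a (S n) + L / 2 ^ S n <= a n + L / 2 ^ n) /\
    (c n <= c (S n) /\ c (S n) + H / 2 ^ S n <= c n + H / 2 ^ n)).
  { intros n. destruct (Hsq n) as [E1 E2].
    destruct (Hnext (sq n)) as [_ [_ [E3 E4]]]; [now rewrite E1 |].
    fold (a n) (c n) in E3, E4. change (next (sq n)) with (sq (S n)) in E3, E4.
    fold (a (S n)) in E3. fold (c (S n)) in E4. rewrite E1 in E3, E4.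
    unfold Rdiv in *. rewrite (Hhalf n), !Rmult_plus_distr_l.
    assert (Q1 : 0 <= L * / 2 ^ S n) by (apply Rmult_le_pos; [lra | left; apply Hpow]).
    assert (Q2 : 0 <= H * / 2 ^ S n) by (apply Rmult_le_pos; [lra | left; apply Hpow]).
    split; [destruct E3 as [-> | ->] | destruct E4 as [-> | ->]]; lra. }
  assert (Hnest : forall (u : nat -> R) (D : R), 0 <= D ->
    (forall n, u n <= u (S n) /\ u (S n) + D / 2 ^ S n <= u n + D / 2 ^ n) ->
    exists x, forall n, u n <= x <= u n + D / 2 ^ n).
  { intros u D HD Hu.
    assert (D0 : forall n, 0 <= D / 2 ^ n)
      by (intros n; apply Rmult_le_pos; [assumption | left; apply Hpow]).
    assert (M1 : forall n m, u n <= u (n + m)%nat /\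
        u (n + m)%nat + D / 2 ^ (n + m) <= u n + D / 2 ^ n).
    { intros n m. induction m as [| m IH]; [rewrite Nat.add_0_r; lra |].
      rewrite Nat.add_succ_r. specialize (Hu (n + m)%nat). lra. }
    assert (M2 : forall n m, u m <= u n + D / 2 ^ n).
    { intros n m. destruct (Nat.le_ge_cases n m) as [Q | Q].
      - destruct (M1 n (m - n)%nat) as [_ M]. replace (n + (m - n))%nat with m in M by lia.
        specialize (D0 m). lra.
      - destruct (M1 m (n - m)%nat) as [M _]. replace (m + (n - m))%nat with n in M by lia.
        specialize (D0 n). lra. }
    destruct (completeness (fun r => exists n, r = u n)) as [x [X1 X2]].
    - exists (u O + D / 2 ^ O). intros r [n ->]. apply M2.
    - exists (u O), O. reflexivity.
    - exists x. intros n. split; [apply X1; now exists n |].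
      apply X2. intros r [m ->]. apply M2. }
  destruct (Hnest a L HL (fun n => proj1 (Hst n))) as [x Hx].
  destruct (Hnest c H HH (fun n => proj2 (Hst n))) as [y Hy].
  destruct (Hloc x y) as [K HK].
  apply (proj2 (Hsq K)). apply (HK K); [lia | apply Hx | apply Hy].
Qed.

Lemma dyadic_small (L d : R) : 0 < d -> exists K, forall k, (K <= k)%nat -> L / 2 ^ k < d.
Proof.
  intros Hd. destruct (Pow_x_infinity 2 ltac:(rewrite Rabs_right; lra) (Rabs L / d + 1)) as [K HK].
  exists K. intros k Hk. specialize (HK k Hk).
  assert (P : 0 < 2 ^ k) by (apply pow_lt; lra). rewrite Rabs_right in HK by lra.
  apply Rlt_div_l; [assumption |]. apply Rle_lt_trans with (Rabs L); [apply Rle_abs |].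
  assert (Q : Rabs L / d < 2 ^ k) by lra. apply Rlt_div_l in Q; lra.
Qed.

(** * Compact subsets of the plane *)

Definition closed_bounded (A : C -> Prop) : Prop :=
  (exists M, forall z, A z -> Cmod z <= M) /\
  (forall z, ~ A z -> exists d, 0 < d /\ forall w, Cmod (w - z) < d -> ~ A w).

(** Heine-Borel for a property that weakens as [e] decreases: the constants of four quarters combine
    by taking their minimum. Points outside [A] need no constant, because [A] is empty near them. *)
Lemma closed_bounded_local_to_global (A : C -> Prop) (Phi : R -> C -> Prop) :
  closed_bounded A ->
  (forall e e' z, e' <= e -> Phi e z -> Phi e' z) ->
  (forall z, A z -> exists e d, 0 < e /\ 0 < d /\
     forall w, A w -> Cmod (w - z) < d -> Phi e w) ->
  exists e, 0 < e /\ forall z, A z -> Phi e z.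
Proof.
  intros [[M HM] Hcl] Hmon Hloc.
  set (N := Rmax M 0).
  assert (N0 : 0 <= N) by apply Rmax_r.
  assert (NM : M <= N) by apply Rmax_l.
  set (P := fun k a c => exists e, 0 < e /\ forall z, A z ->
    a <= Re z <= a + 2 * N / 2 ^ k -> c <= Im z <= c + 2 * N / 2 ^ k -> Phi e z).
  assert (HP : P O (- N) (- N)).
  { apply (bisection P (2 * N) (2 * N)); [lra | lra | |].
    - intros k a c [e1 [P1 H1]] [e2 [P2 H2]] [e3 [P3 H3]] [e4 [P4 H4]].
      exists (Rmin (Rmin e1 e2) (Rmin e3 e4)). split; [repeat apply Rmin_glb_lt; assumption |].
      assert (E : 2 * N / 2 ^ k = 2 * N / 2 ^ S k + 2 * N / 2 ^ S k)
        by (simpl; field; apply pow_nonzero; lra).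
      intros z Az Hx Hy. rewrite E in Hx, Hy.
      assert (m1 := Rmin_l (Rmin e1 e2) (Rmin e3 e4)).
      assert (m2 := Rmin_r (Rmin e1 e2) (Rmin e3 e4)).
      assert (m3 := Rmin_l e1 e2). assert (m4 := Rmin_r e1 e2).
      assert (m5 := Rmin_l e3 e4). assert (m6 := Rmin_r e3 e4).
      destruct (Rle_dec (Re z) (a + 2 * N / 2 ^ S k)) as [X | X];
        destruct (Rle_dec (Im z) (c + 2 * N / 2 ^ S k)) as [Y | Y].
      + apply (Hmon e1); [lra |]. apply H1; [assumption | lra | lra].
      + apply (Hmon e3); [lra |]. apply H3; [assumption | lra | lra].
      + apply (Hmon e2); [lra |]. apply H2; [assumption | lra | lra].
      + apply (Hmon e4); [lra |]. apply H4; [assumption | lra | lra].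
    - intros x y.
      assert (L : exists e d, 0 < e /\ 0 < d /\
         forall w, A w -> Cmod (w - (x, y)) < d -> Phi e w).
      { destruct (classic (A (x, y))) as [Q | Q]; [now apply Hloc |].
        destruct (Hcl _ Q) as [d [Hd H1]]. exists 1, d.
        split; [lra |]. split; [assumption |]. intros w Aw Hw. now destruct (H1 w Hw). }
      destruct L as [e [d [He [Hd H1]]]].
      destruct (dyadic_small (2 * N) (d / 2) ltac:(lra)) as [K HK].
      exists K. intros k a c Hk Hx Hy. specialize (HK k Hk).
      exists e. split; [assumption |]. intros z Az Zx Zy. apply H1; [assumption |].
      destruct z as [zx zy]. simpl in Zx, Zy.
      replace ((zx, zy) - (x, y))%C with ((zx - x, zy - y) : C) by reflexivity.
      eapply Rle_lt_trans; [apply Cmod_le_abs |].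
      assert (Rabs (zx - x) < d / 2) by (apply Rabs_def1; lra).
      assert (Rabs (zy - y) < d / 2) by (apply Rabs_def1; lra). lra. }
  destruct HP as [e [He H1]]. exists e. split; [assumption |]. intros z Az.
  specialize (HM z Az).
  assert (X := re_le_Cmod z). assert (Y := im_le_Cmod z).
  assert (X1 := Rabs_def2 (Re z) (N + 1)). assert (Y1 := Rabs_def2 (Im z) (N + 1)).
  assert (X2 : - N <= Re z <= N) by (apply Rabs_le_between; lra).
  assert (Y2 : - N <= Im z <= N) by (apply Rabs_le_between; lra).
  apply H1; [assumption | simpl; lra | simpl; lra].
Qed.

(** The local-to-global principle is used twice: once to bound [v], and once to push [v] uniformly
    below its supremum [m] if the value [m] is never taken. *)
Lemma extreme_value (A : C -> Prop) (v : C -> R) :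
  closed_bounded A -> (exists z, A z) -> (forall z, A z -> rcont v z) ->
  exists p, A p /\ forall z, A z -> v z <= v p.
Proof.
  intros HA [z0 Az0] Hv.
  (* Inverting [e] turns a bound that may grow into a parameter that may shrink; the disjunct
     [e <= 0] keeps the property monotone for all real [e]. *)
  destruct (closed_bounded_local_to_global A (fun e z => v z <= / e \/ e <= 0) HA)
    as [b [Hb Hbd]].
  { intros e e' z Hle [Q | Q]; [| lra]. destruct (Rle_dec e' 0) as [S | S]; [now right |].
    left. eapply Rle_trans; [exact Q |]. apply Rinv_le_contravar; lra. }
  { intros z Az. destruct (Hv z Az 1 Rlt_0_1) as [d [Hd H1]].
    exists (/ (Rabs (v z) + 1)), d.
    assert (Q := Rabs_pos (v z)).
    split; [apply Rinv_0_lt_compat; lra |]. split; [assumption |].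
    intros w Aw Hw. left. rewrite Rinv_inv.
    specialize (H1 w Hw). apply Rabs_def2 in H1. assert (R := Rle_abs (v z)). lra. }
  destruct (completeness (fun r => exists z, A z /\ r = v z)) as [m [m1 m2]].
  { exists (/ b). intros r [z [Az ->]]. destruct (Hbd z Az); lra. }
  { exists (v z0), z0. auto. }
  apply NNPP. intros Hno.
  destruct (closed_bounded_local_to_global A (fun e z => v z <= m - e) HA) as [e [He H1]].
  { intros; lra. }
  { intros z Az. assert (Q : v z < m).
    { apply Rnot_le_lt. intros Q. apply Hno. exists z. split; [assumption |].
      intros w Aw. apply Rle_trans with m; [apply m1; now exists w | assumption]. }
    destruct (Hv z Az ((m - v z) / 2) ltac:(lra)) as [d [Hd H1]].
    exists ((m - v z) / 2), d. split; [lra |]. split; [assumption |]. intros w Aw Hw.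
    specialize (H1 w Hw). apply Rabs_def2 in H1. lra. }
  assert (m <= m - e); [| lra].
  apply m2. intros r [z [Az ->]]. now apply H1.
Qed.

(** The imaginary part of the contour integral of [F dz] along the boundary. One real component is
    enough, since only the real part of a circular mean is needed later. *)
Definition rect_integral (F : C -> C) (a b c d : R) : R :=
  RInt (fun x => Im (F (x, c))) a b - RInt (fun x => Im (F (x, d))) a b
  + (RInt (fun y => Re (F (b, y))) c d - RInt (fun y => Re (F (a, y))) c d).

Lemma continuous_eps (g : R -> R) (x : R) :
  (forall eps, 0 < eps -> exists d, 0 < d /\ forall y, Rabs (y - x) < d -> Rabs (g y - g x) < eps) ->
  continuous g x.
Proof.
  intros H. apply filterlim_locally. intros eps.
  destruct (H eps (cond_pos eps)) as [d [Hd H1]].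
  exists (mkposreal d Hd). intros y Hy. apply H1. exact Hy.
Qed.

Lemma continuous_horizontal (F : C -> C) (x y : R) :
  ccont F (x, y) -> continuous (fun t => Im (F (t, y))) x.
Proof.
  intros H. apply continuous_eps. intros eps He. destruct (H eps He) as [d [Hd H1]].
  exists d. split; [assumption |]. intros t Ht.
  assert (Q : Cmod ((t, y) - (x, y)) < d).
  { replace ((t, y) - (x, y))%C with (RtoC (t - x))
      by (unfold Cminus, Cplus, Copp, RtoC; simpl; f_equal; ring).
    now rewrite Cmod_R. }
  specialize (H1 _ Q). eapply Rle_lt_trans; [| exact H1].
  exact (im_le_Cmod (F (t, y) - F (x, y))).
Qed.

Lemma continuous_vertical (F : C -> C) (x y : R) :
  ccont F (x, y) -> continuous (fun t => Re (F (x, t))) y.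
Proof.
  intros H. apply continuous_eps. intros eps He. destruct (H eps He) as [d [Hd H1]].
  exists d. split; [assumption |]. intros t Ht.
  assert (Q : Cmod ((x, t) - (x, y)) < d).
  { replace ((x, t) - (x, y))%C with (Ci * RtoC (t - y))%C
      by (unfold Cminus, Cplus, Copp, Cmult, Ci, RtoC; simpl; f_equal; ring).
    now rewrite Cmod_mult, Cmod_Ci, Cmod_R, Rmult_1_l. }
  specialize (H1 _ Q). eapply Rle_lt_trans; [| exact H1].
  exact (re_le_Cmod (F (x, t) - F (x, y))).
Qed.

Section Rectangle.
Variables (F : C -> C) (a0 b0 c0 d0 : R).
Hypothesis Hcont : forall x y, a0 <= x <= b0 -> c0 <= y <= d0 -> ccont F (x, y).

Lemma ex_RInt_horizontal (y a b : R) : c0 <= y <= d0 -> a0 <= a -> a <= b -> b <= b0 ->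
  ex_RInt (fun x => Im (F (x, y))) a b.
Proof.
  intros Hy H1 H2 H3. apply (@ex_RInt_continuous R_CompleteNormedModule).
  intros x Hx. rewrite Rmin_left, Rmax_right in Hx by assumption.
  apply continuous_horizontal, Hcont; lra.
Qed.

Lemma ex_RInt_vertical (x c d : R) : a0 <= x <= b0 -> c0 <= c -> c <= d -> d <= d0 ->
  ex_RInt (fun y => Re (F (x, y))) c d.
Proof.
  intros Hx H1 H2 H3. apply (@ex_RInt_continuous R_CompleteNormedModule).
  intros y Hy. rewrite Rmin_left, Rmax_right in Hy by assumption.
  apply continuous_vertical, Hcont; lra.
Qed.

Lemma rect_integral_split (a m b c n d : R) :
  a0 <= a -> a <= m -> m <= b -> b <= b0 -> c0 <= c -> c <= n -> n <= d -> d <= d0 ->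
  rect_integral F a b c d =
    rect_integral F a m c n + rect_integral F m b c n
    + rect_integral F a m n d + rect_integral F m b n d.
Proof.
  intros. unfold rect_integral.
  assert (Hh : forall y, c0 <= y <= d0 -> RInt (fun x => Im (F (x, y))) a b =
     RInt (fun x => Im (F (x, y))) a m + RInt (fun x => Im (F (x, y))) m b).
  { intros y Hy. symmetry. apply (@RInt_Chasles R_CompleteNormedModule);
      apply ex_RInt_horizontal; lra. }
  assert (Hv : forall x, a0 <= x <= b0 -> RInt (fun y => Re (F (x, y))) c d =
     RInt (fun y => Re (F (x, y))) c n + RInt (fun y => Re (F (x, y))) n d).
  { intros x Hx. symmetry. apply (@RInt_Chasles R_CompleteNormedModule);
      apply ex_RInt_vertical; lra. }
  rewrite (Hh c), (Hh d), (Hv a), (Hv b) by lra. ring.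
Qed.

Lemma RInt_near_const (g : R -> R) (a b k M : R) : a <= b -> ex_RInt g a b ->
  (forall x, a < x < b -> Rabs (g x - k) <= M) -> Rabs (RInt g a b - k * (b - a)) <= M * (b - a).
Proof.
  intros Hab Hex H.
  assert (Hc : forall q : R, RInt (fun _ => q) a b = q * (b - a))
    by (intros q; rewrite RInt_const; unfold scal; simpl; unfold mult; simpl; ring).
  assert (H1 : RInt g a b <= (k + M) * (b - a)).
  { rewrite <- Hc. apply RInt_le; [assumption | assumption | apply ex_RInt_const |].
    intros x Hx. specialize (H x Hx). apply Rabs_le_between in H. lra. }
  assert (H2 : (k - M) * (b - a) <= RInt g a b).
  { rewrite <- Hc. apply RInt_le; [assumption | apply ex_RInt_const | assumption |].
    intros x Hx. specialize (H x Hx). apply Rabs_le_between in H. lra. }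
  apply Rabs_le_between. lra.
Qed.

(* The linear part of [F] at [z] contributes nothing, which leaves the error term. *)
Lemma rect_integral_local (z l : C) (eps a b c d : R) : 0 <= eps ->
  a0 <= a -> a <= Re z <= b -> b <= b0 -> c0 <= c -> c <= Im z <= d -> d <= d0 ->
  (forall w, a <= Re w <= b -> c <= Im w <= d ->
     Cmod (F w - F z - l * (w - z)) <= eps * Cmod (w - z)) ->
  Rabs (rect_integral F a b c d) <= 2 * eps * (b - a + (d - c)) * (b - a + (d - c)).
Proof.
  intros He H1 H2 H3 H4 H5 H6 Hd. set (D := b - a + (d - c)).
  assert (Hd' : forall w, a <= Re w <= b -> c <= Im w <= d ->
     Cmod (F w - F z - l * (w - z)) <= eps * D).
  { intros w W1 W2. eapply Rle_trans; [now apply Hd |]. apply Rmult_le_compat_l; [assumption |].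
    destruct w as [wx wy], z as [zx zy]. simpl in *.
    replace ((wx, wy) - (zx, zy))%C with ((wx - zx, wy - zy) : C) by reflexivity.
    eapply Rle_trans; [apply Cmod_le_abs |].
    assert (Rabs (wx - zx) <= b - a) by (apply Rabs_le_between; lra).
    assert (Rabs (wy - zy) <= d - c) by (apply Rabs_le_between; lra). unfold D. lra. }
  assert (I1 : Rabs (RInt (fun x => Im (F (x, c)) - Im (F (x, d))) a b - Re l * (c - d) * (b - a))
     <= 2 * (eps * D) * (b - a)).
  { apply RInt_near_const; [lra | |].
    - apply (@ex_RInt_minus R_NormedModule); apply ex_RInt_horizontal; lra.
    - intros x Hx. assert (Q1 := Hd' (x, c)). assert (Q2 := Hd' (x, d)). simpl in Q1, Q2.
      specialize (Q1 ltac:(lra) ltac:(lra)). specialize (Q2 ltac:(lra) ltac:(lra)).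
      assert (T := Cmod_triangle_minus (F (x, c) - F z - l * ((x, c) - z))
                                       (F (x, d) - F z - l * ((x, d) - z))).
      assert (T2 := im_le_Cmod ((F (x, c) - F z - l * ((x, c) - z))
                                 - (F (x, d) - F z - l * ((x, d) - z)))).
      replace (Im (F (x, c)) - Im (F (x, d)) - Re l * (c - d))
        with (Im ((F (x, c) - F z - l * ((x, c) - z)) - (F (x, d) - F z - l * ((x, d) - z)))).
      2: { unfold Cminus, Cplus, Copp, Cmult, Im, Re; simpl. ring. }
      lra. }
  assert (I2 : Rabs (RInt (fun y => Re (F (b, y)) - Re (F (a, y))) c d - Re l * (b - a) * (d - c))
     <= 2 * (eps * D) * (d - c)).
  { apply RInt_near_const; [lra | |].
    - apply (@ex_RInt_minus R_NormedModule); apply ex_RInt_vertical; lra.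
    - intros y Hy. assert (Q1 := Hd' (b, y)). assert (Q2 := Hd' (a, y)). simpl in Q1, Q2.
      specialize (Q1 ltac:(lra) ltac:(lra)). specialize (Q2 ltac:(lra) ltac:(lra)).
      assert (T := Cmod_triangle_minus (F (b, y) - F z - l * ((b, y) - z))
                                       (F (a, y) - F z - l * ((a, y) - z))).
      assert (T2 := re_le_Cmod ((F (b, y) - F z - l * ((b, y) - z))
                                 - (F (a, y) - F z - l * ((a, y) - z)))).
      replace (Re (F (b, y)) - Re (F (a, y)) - Re l * (b - a))
        with (Re ((F (b, y) - F z - l * ((b, y) - z)) - (F (a, y) - F z - l * ((a, y) - z)))).
      2: { unfold Cminus, Cplus, Copp, Cmult, Im, Re; simpl. ring. }
      lra. }
  assert (E1 := RInt_minus (fun x => Im (F (x, c))) (fun x => Im (F (x, d))) a b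
     (ex_RInt_horizontal c a b ltac:(lra) ltac:(lra) ltac:(lra) ltac:(lra))
     (ex_RInt_horizontal d a b ltac:(lra) ltac:(lra) ltac:(lra) ltac:(lra))).
  assert (E2 := RInt_minus (fun y => Re (F (b, y))) (fun y => Re (F (a, y))) c d
     (ex_RInt_vertical b c d ltac:(lra) ltac:(lra) ltac:(lra) ltac:(lra))
     (ex_RInt_vertical a c d ltac:(lra) ltac:(lra) ltac:(lra) ltac:(lra))).
  unfold minus, plus, opp in E1, E2; simpl in E1, E2. unfold Rminus in I1, I2.
  rewrite E1 in I1. rewrite E2 in I2. unfold rect_integral.
  match type of I1 with Rabs ?u <= _ => match type of I2 with Rabs ?v <= _ =>
    assert (T := Rabs_triang u v) end end.
  match goal with |- Rabs ?u <= _ => match type of T with Rabs ?v <= _ =>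
    replace u with v by ring end end.
  apply Rle_trans with (2 * (eps * D) * (b - a) + 2 * (eps * D) * (d - c)); [lra |].
  unfold D. right. ring.
Qed.
End Rectangle.

(** The bound [eta / 4^k] at depth [k] adds up correctly over four quarters. On small rectangles it
    holds because the error of the linear approximation is at most a multiple of the squared size of
    the rectangle, which also scales like [4^(-k)]. As [eta] is arbitrary, the integral vanishes. *)
Lemma goursat (F : C -> C) (a b c d : R) : a <= b -> c <= d ->
  (forall x y, a <= x <= b -> c <= y <= d -> cdiff F (x, y)) ->
  rect_integral F a b c d = 0.
Proof.
  intros Hab Hcd HF.
  assert (Hc : forall x y, a <= x <= b -> c <= y <= d -> ccont F (x, y))
    by (intros; now apply cdiff_ccont, HF).
  set (L := b - a). set (H := d - c).
  assert (Hle : forall eta, 0 < eta -> Rabs (rect_integral F a b c d) <= eta).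
  { intros eta Heta.
    (* The inclusion hypotheses make [P] vacuous on rectangles that leave the domain, in particular
       around points outside it. *)
    set (P := fun k x y => a <= x -> x + L / 2 ^ k <= b -> c <= y -> y + H / 2 ^ k <= d ->
      Rabs (rect_integral F x (x + L / 2 ^ k) y (y + H / 2 ^ k)) <= eta / 4 ^ k).
    assert (HP : P O a c).
    { apply (bisection P L H); [unfold L; lra | unfold H; lra | |].
      - intros k x y H1 H2 H3 H4 A1 A2 A3 A4. unfold P in H1, H2, H3, H4.
        assert (E : L / 2 ^ k = L / 2 ^ S k + L / 2 ^ S k)
          by (simpl; field; apply pow_nonzero; lra).
        assert (E' : H / 2 ^ k = H / 2 ^ S k + H / 2 ^ S k)
          by (simpl; field; apply pow_nonzero; lra).
        assert (E4 : eta / 4 ^ k = 4 * (eta / 4 ^ S k))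
          by (simpl; field; apply pow_nonzero; lra).
        assert (P1 : 0 <= L / 2 ^ S k)
          by (apply Rdiv_le_0_compat; [unfold L; lra | apply pow_lt; lra]).
        assert (P2 : 0 <= H / 2 ^ S k)
          by (apply Rdiv_le_0_compat; [unfold H; lra | apply pow_lt; lra]).
        rewrite E4. rewrite E in *. rewrite E' in *.
        set (p := L / 2 ^ S k) in *. set (q := H / 2 ^ S k) in *.
        rewrite (rect_integral_split F a b c d Hc x (x + p) (x + (p + p)) y (y + q) (y + (q + q)))
          by lra.
        replace (x + (p + p)) with (x + p + p) in * by ring.
        replace (y + (q + q)) with (y + q + q) in * by ring.
        specialize (H1 ltac:(lra) ltac:(lra) ltac:(lra) ltac:(lra)).
        specialize (H2 ltac:(lra) ltac:(lra) ltac:(lra) ltac:(lra)).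
        specialize (H3 ltac:(lra) ltac:(lra) ltac:(lra) ltac:(lra)).
        specialize (H4 ltac:(lra) ltac:(lra) ltac:(lra) ltac:(lra)).
        apply Rabs_le_between in H1, H2, H3, H4. apply Rabs_le_between. lra.
      - intros x y.
        destruct (classic (a <= x <= b /\ c <= y <= d)) as [[Ix Iy] | Hout].
        2: { exists O. intros k u v _ Hu Hv U1 U2 V1 V2. exfalso. apply Hout. lra. }
        destruct (HF x y Ix Iy) as [l Hl].
        (* Adding [1] avoids a division by zero for a rectangle reduced to a point. *)
        set (eps := eta / (2 * (L + H + 1) * (L + H + 1))).
        assert (LH : 0 <= L + H) by (unfold L, H; lra).
        assert (Peps : 0 < eps) by (apply Rdiv_lt_0_compat; [assumption | nra]).
        destruct (Hl eps Peps) as [r [Hr H1]].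
        destruct (dyadic_small (L + H) r Hr) as [K HK].
        exists K. intros k u v Hk Hu Hv U1 U2 V1 V2. specialize (HK k Hk).
        assert (Pk : 0 < 2 ^ k) by (apply pow_lt; lra).
        assert (Es : L / 2 ^ k + H / 2 ^ k = (L + H) / 2 ^ k) by (unfold Rdiv; ring).
        eapply Rle_trans.
        + apply (rect_integral_local F a b c d Hc (x, y) l eps); simpl; try lra.
          intros [wx wy] W1 W2. simpl in W1, W2. apply H1.
          replace ((wx, wy) - (x, y))%C with ((wx - x, wy - y) : C) by reflexivity.
          eapply Rle_lt_trans; [apply Cmod_le_abs |].
          assert (Rabs (wx - x) <= L / 2 ^ k) by (apply Rabs_le_between; lra).
          assert (Rabs (wy - y) <= H / 2 ^ k) by (apply Rabs_le_between; lra). lra.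
        + replace (u + L / 2 ^ k - u + (v + H / 2 ^ k - v)) with ((L + H) / 2 ^ k) by lra.
          replace (4 ^ k) with (2 ^ k * 2 ^ k) by (rewrite <- Rpow_mult_distr; f_equal; lra).
          apply Rle_trans with (2 * eps * ((L + H + 1) * (L + H + 1)) / (2 ^ k * 2 ^ k)).
          * unfold Rdiv. rewrite Rinv_mult.
            replace (2 * eps * ((L + H) * / 2 ^ k) * ((L + H) * / 2 ^ k))
              with (2 * eps * ((L + H) * (L + H)) * (/ 2 ^ k * / 2 ^ k)) by ring.
            apply Rmult_le_compat_r.
            { apply Rmult_le_pos; left; now apply Rinv_0_lt_compat. }
            apply Rmult_le_compat_l; [lra | nra].
          * right. unfold eps. field. split; [lra |].
            apply Rgt_not_eq. unfold Rgt. lra. }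
    specialize (HP ltac:(lra)). simpl in HP. unfold L, H in HP.
    replace (a + (b - a) / 1) with b in HP by field.
    replace (c + (d - c) / 1) with d in HP by field.
    specialize (HP ltac:(lra) ltac:(lra) ltac:(lra)). lra. }
  apply NNPP. intros Hn. apply Rabs_pos_lt in Hn.
  specialize (Hle (Rabs (rect_integral F a b c d) / 2) ltac:(lra)). lra.
Qed.

(* Goursat's theorem for [s |-> g (p + exp s)] on a rectangle of height [2 PI]: the horizontal
   sides cancel, so circular means about [p] do not depend on the radius. *)
Lemma cmod_le_circle (h : C -> C) (p : C) (rho K : R) : 0 < rho ->
  (forall w, Cmod (w - p) <= rho -> cdiff h w) ->
  (forall w, Cmod (w - p) = rho -> Cmod (h w) <= K) -> Cmod (h p) <= K.
Proof.
  intros Hrho Hh HK.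
  destruct (Req_dec (Cmod (h p)) 0) as [E0 | N0].
  { rewrite E0. eapply Rle_trans; [apply (Cmod_ge_0 (h (p + rho)%C)) |]. apply HK.
    replace (p + rho - p)%C with (RtoC rho) by ring. rewrite Cmod_R, Rabs_right; lra. }
  set (m := Cmod (h p)) in *. assert (Hm : 0 < m) by (assert (Q := Cmod_ge_0 (h p)); fold m in Q; lra).
  (* Rotating by [u] makes the value at [p] equal to [|h p|], so that comparing real parts
     suffices. *)
  set (u := (Cconj (h p) / m)%C).
  assert (Mnz : RtoC m <> 0) by (intros Q; apply RtoC_inj in Q; lra).
  assert (Hu : Cmod u = 1).
  { unfold u. rewrite Cmod_div by assumption.
    rewrite Cmod_conj, Cmod_R, Rabs_right by lra. fold m. field. lra. }
  assert (Hup : (u * h p)%C = m).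
  { unfold u. replace (Cconj (h p) / m * h p)%C with (h p * Cconj (h p) / m)%C by (field; assumption).
    rewrite <- Cmod2_conj. fold m. rewrite RtoC_pow. field. assumption. }
  set (F := fun s => (u * h (p + cexp s))%C).
  assert (HF : forall s, Re s <= ln rho -> cdiff F s).
  { intros s Hs. unfold F. apply cdiff_scal.
    apply (cdiff_comp h (fun w => p + cexp w)%C).
    - apply cdiff_plus; [apply cdiff_const | apply cdiff_cexp].
    - apply Hh. replace (p + cexp s - p)%C with (cexp s) by ring.
      rewrite Cmod_cexp, <- (exp_ln rho) by assumption.
      now apply exp_le_compat. }
  assert (PI0 := PI_RGT_0).
  apply le_epsilon. intros eps Heps.
  assert (Hcp : ccont (fun w => u * h w)%C p).
  { apply cdiff_ccont, cdiff_scal, Hh. replace (p - p)%C with (RtoC 0) by ring.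
    rewrite Cmod_0. lra. }
  destruct (Hcp eps Heps) as [d [Hd H1]].
  set (t := ln (Rmin (d / 2) rho)).
  assert (Mn : 0 < Rmin (d / 2) rho) by (apply Rmin_glb_lt; lra).
  assert (Ht : t <= ln rho).
  { destruct (Rle_lt_or_eq_dec _ _ (Rmin_r (d / 2) rho)) as [Q | Q].
    - left. now apply ln_increasing.
    - right. unfold t. now rewrite Q. }
  assert (G := goursat F t (ln rho) 0 (2 * PI) Ht ltac:(lra)
    (fun x y Hx _ => HF (x, y) (proj2 Hx))).
  unfold rect_integral in G.
  assert (Eper : RInt (fun x => Im (F (x, 2 * PI))) t (ln rho)
               = RInt (fun x => Im (F (x, 0))) t (ln rho)).
  { apply RInt_ext. intros x _. unfold F. do 4 f_equal. unfold cexp; simpl.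
    rewrite sin_2PI, cos_2PI, sin_0, cos_0. reflexivity. }
  rewrite Eper in G.
  assert (Hc : forall q : R, RInt (fun _ => q) 0 (2 * PI) = q * (2 * PI))
    by (intros q; rewrite RInt_const; unfold scal; simpl; unfold mult; simpl; ring).
  assert (Hex : forall x, x <= ln rho -> ex_RInt (fun y => Re (F (x, y))) 0 (2 * PI)).
  { intros x Hx. apply (@ex_RInt_continuous R_CompleteNormedModule). intros y _.
    apply continuous_vertical, cdiff_ccont, HF. exact Hx. }
  assert (U : RInt (fun y => Re (F (ln rho, y))) 0 (2 * PI) <= K * (2 * PI)).
  { rewrite <- Hc. apply RInt_le; [lra | apply Hex; lra | apply ex_RInt_const |].
    intros y _. eapply Rle_trans; [apply Rle_abs |]. eapply Rle_trans; [apply re_le_Cmod |].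
    unfold F. rewrite Cmod_mult, Hu, Rmult_1_l. apply HK.
    replace (p + cexp (ln rho, y) - p)%C with (cexp (ln rho, y)) by ring.
    rewrite Cmod_cexp. simpl. now apply exp_ln. }
  assert (Lw : (m - eps) * (2 * PI) <= RInt (fun y => Re (F (t, y))) 0 (2 * PI)).
  { rewrite <- Hc. apply RInt_le; [lra | apply ex_RInt_const | apply Hex; lra |].
    intros y _.
    assert (Q : Cmod (p + cexp (t, y) - p) < d).
    { replace (p + cexp (t, y) - p)%C with (cexp (t, y)) by ring.
      rewrite Cmod_cexp. simpl. unfold t. rewrite exp_ln by assumption.
      assert (R := Rmin_l (d / 2) rho). lra. }
    specialize (H1 _ Q). rewrite Hup in H1.
    assert (R := re_le_Cmod (u * h (p + cexp (t, y))%C - m)).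
    assert (R2 : Rabs (Re (u * h (p + cexp (t, y))%C - m)) < eps) by lra.
    apply Rabs_def2 in R2. unfold F. unfold Cminus in R2.
    rewrite re_plus, re_opp, re_RtoC in R2. lra. }
  assert (R : (m - eps) * (2 * PI) <= K * (2 * PI)) by lra.
  apply Rmult_le_reg_r in R; lra.
Qed.

(** * Maximum principles *)

Lemma rcont_mult (u v : C -> R) (z : C) : rcont u z -> rcont v z -> rcont (fun w => u w * v w) z.
Proof.
  intros Hu Hv eps He.
  set (a := Rabs (u z)). set (b := Rabs (v z)).
  assert (A : 0 <= a) by apply Rabs_pos. assert (B : 0 <= b) by apply Rabs_pos.
  set (e := Rmin 1 (eps / (a + b + 2))).
  assert (Pe : 0 < e) by (apply Rmin_glb_lt; [lra | apply Rdiv_lt_0_compat; lra]).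
  destruct (Hu e Pe) as [d1 [P1 H1]]. destruct (Hv e Pe) as [d2 [P2 H2]].
  exists (Rmin d1 d2). split; [now apply Rmin_glb_lt |]. intros w Hw.
  specialize (H1 w (Rlt_le_trans _ _ _ Hw (Rmin_l _ _))).
  specialize (H2 w (Rlt_le_trans _ _ _ Hw (Rmin_r _ _))).
  replace (u w * v w - u z * v z)
    with ((u w - u z) * (v w - v z) + (u w - u z) * v z + u z * (v w - v z)) by ring.
  eapply Rle_lt_trans; [apply Rabs_triang |].
  eapply Rle_lt_trans; [apply Rplus_le_compat_r, Rabs_triang |].
  rewrite !Rabs_mult. fold a b.
  assert (E1 : e <= 1) by apply Rmin_l.
  assert (E2 : e * (a + b + 2) <= eps).
  { apply Rle_trans with (eps / (a + b + 2) * (a + b + 2)).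
    - apply Rmult_le_compat_r; [lra | apply Rmin_r].
    - right. field. lra. }
  set (p := Rabs (u w - u z)) in *. set (q := Rabs (v w - v z)) in *.
  assert (0 <= p) by apply Rabs_pos. assert (0 <= q) by apply Rabs_pos. nra.
Qed.

Lemma rcont_comp (g : R -> R) (u : C -> R) (z : C) :
  continuity_pt g (u z) -> rcont u z -> rcont (fun w => g (u w)) z.
Proof.
  intros Hg Hu eps He. destruct (Hg eps He) as [d [Hd H1]].
  destruct (Hu d Hd) as [d2 [Hd2 H2]]. exists d2. split; [assumption |].
  intros w Hw. specialize (H2 w Hw).
  destruct (Req_dec (u w) (u z)) as [E | N].
  - rewrite E. replace (g (u z) - g (u z)) with 0 by ring. now rewrite Rabs_R0.
  - apply H1. split; [split; [exact I | intros Q; now apply N] | exact H2].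
Qed.

Lemma rcont_Cmod (z : C) : rcont Cmod z.
Proof. apply (ccont_rcont (fun w => w)). apply cdiff_ccont, cdiff_id. Qed.

Lemma closed_bounded_annulus (r1 r2 : R) : closed_bounded (fun z => r1 <= Cmod z <= r2).
Proof.
  split; [exists r2; intros z Hz; lra |]. intros z Hz.
  destruct (Rlt_le_dec (Cmod z) r1) as [Q | Q].
  - destruct (rcont_Cmod z (r1 - Cmod z) ltac:(lra)) as [d [Hd H1]]. exists d.
    split; [assumption |]. intros w Hw. specialize (H1 w Hw). apply Rabs_def2 in H1. lra.
  - destruct (rcont_Cmod z (Cmod z - r2)) as [d [Hd H1]].
    { apply Rlt_0_minus. apply Rnot_le_lt. intros S. apply Hz. lra. }
    exists d. split; [assumption |]. intros w Hw. specialize (H1 w Hw). apply Rabs_def2 in H1. lra.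
Qed.

(* [u] need only be locally the modulus of an analytic function [H] of a local parameter [s], with
   [E s] the point: this admits multivalued functions such as [|F z| * |z|^alpha].
   At a maximum [p] of [u z * exp (eps |z|^2)], the function
   [H s * exp (2 eps conj(p) (E s - p))] violates [cmod_le_circle], because
   [|z|^2 = |p|^2 + 2 Re (conj(p) (z - p)) + |z - p|^2]. *)
Lemma max_principle (A : C -> Prop) (u : C -> R) (B : R) :
  closed_bounded A -> (forall z, A z -> rcont u z) -> 0 <= B ->
  (forall p, A p -> B < u p -> exists rho c (H E : C -> C), 0 < rho /\ 0 < c /\
     (forall s, Cmod s <= rho -> cdiff H s /\ cdiff E s) /\ E 0 = p /\ Cmod (H 0) = u p /\
     forall s, Cmod s = rho -> A (E s) /\ u (E s) = Cmod (H s) /\ c <= Cmod (E s - p)) ->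
  forall z, A z -> u z <= B.
Proof.
  intros HA Hu HB Hloc z1 Az1. apply Rnot_lt_le. intros Hbig.
  assert (HA' := HA). destruct HA' as [[M HM] _].
  assert (M0 : 0 <= M) by (eapply Rle_trans; [apply (Cmod_ge_0 z1) | now apply HM]).
  (* [B'] lies strictly between [B] and [u z1], and is positive even if [B = 0]. Then [eps] is so
     small that the factor [exp (eps |z|^2)] cannot lift a point with [u z <= B] up to [u z1]; hence
     the maximum of [v] satisfies [u p > B]. *)
  set (B' := (B + u z1) / 2).
  assert (HB' : 0 < B') by (unfold B'; lra).
  assert (Q1 : 1 < u z1 / B') by (apply Rlt_div_r; unfold B' in *; lra).
  assert (L1 : 0 < ln (u z1 / B')) by (rewrite <- ln_1; apply ln_increasing; lra).
  set (eps := ln (u z1 / B') / (M ^ 2 + 1)).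
  assert (M2 : 0 <= M ^ 2) by apply pow2_ge_0.
  assert (Heps : 0 < eps) by (apply Rdiv_lt_0_compat; lra).
  assert (HBe : B * exp (eps * M ^ 2) < u z1).
  { apply Rlt_le_trans with (B' * exp (eps * M ^ 2)).
    - apply Rmult_lt_compat_r; [apply exp_pos | unfold B'; lra].
    - apply Rle_trans with (B' * exp (ln (u z1 / B'))).
      + apply Rmult_le_compat_l; [lra |].
        assert (R : eps * M ^ 2 <= ln (u z1 / B')).
        { replace (ln (u z1 / B')) with (eps * (M ^ 2 + 1)) by (unfold eps; field; lra).
          apply Rmult_le_compat_l; lra. }
        now apply exp_le_compat.
      + rewrite exp_ln by lra. right. field. lra. }
  set (v := fun z => u z * exp (eps * Cmod z ^ 2)).
  destruct (extreme_value A v HA (ex_intro _ z1 Az1)) as [p [Ap Hp]].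
  { intros z Az. apply rcont_mult; [now apply Hu |].
    apply (rcont_comp (fun t => exp (eps * t ^ 2))); [| apply rcont_Cmod]. reg. }
  assert (Vz1 : u z1 <= v z1).
  { unfold v. rewrite <- (Rmult_1_r (u z1)) at 1. apply Rmult_le_compat_l; [lra |].
    rewrite <- exp_0. assert (R : 0 <= eps * Cmod z1 ^ 2)
      by (apply Rmult_le_pos; [lra | apply pow2_ge_0]).
    destruct R as [R | <-]; [left; now apply exp_increasing | right; reflexivity]. }
  assert (Vp := Hp z1 Az1).
  assert (Up : B < u p).
  { apply Rnot_le_lt. intros R.
    assert (v p <= B * exp (eps * M ^ 2)); [| lra].
    unfold v. apply Rle_trans with (B * exp (eps * Cmod p ^ 2)).
    - apply Rmult_le_compat_r; [left; apply exp_pos | exact R].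
    - apply Rmult_le_compat_l; [exact HB |].
      assert (S : eps * Cmod p ^ 2 <= eps * M ^ 2).
      { apply Rmult_le_compat_l; [lra |]. apply pow_incr. split; [apply Cmod_ge_0 | now apply HM]. }
      now apply exp_le_compat. }
  destruct (Hloc p Ap Up) as [rho [c [H [E [Hrho [Hc [Hd [E0 [H0 Hcirc]]]]]]]]].
  set (h := fun s => (H s * cexp (RtoC (2 * eps) * Cconj p * (E s - p)))%C).
  (* Maximality of [v] at [p] cancels everything in the exponent except the square term, and the
     circle stays at distance at least [c] from [p]: the strict loss [exp (- eps c^2)] contradicts
     [|h 0| = u p]. *)
  assert (K : Cmod (h 0) <= u p * exp (- (eps * c ^ 2))).
  { apply (cmod_le_circle h 0 rho _ Hrho).
    - intros s Hs. replace (s - 0)%C with s in Hs by ring. destruct (Hd s Hs) as [D1 D2].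
      apply cdiff_mult; [assumption |].
      apply (cdiff_comp cexp); [| apply cdiff_cexp]. apply cdiff_scal.
      apply cdiff_minus; [assumption | apply cdiff_const].
    - intros s Hs. replace (s - 0)%C with s in Hs by ring. destruct (Hcirc s Hs) as [C1 [C2 C3]].
      unfold h. rewrite Cmod_mult, Cmod_cexp, <- C2.
      assert (V := Hp _ C1). unfold v in V.
      assert (Esq : Re (RtoC (2 * eps) * Cconj p * (E s - p))
                  = eps * Cmod (E s) ^ 2 - eps * Cmod p ^ 2 - eps * Cmod (E s - p) ^ 2).
      { rewrite !Cmod2_alt. destruct (E s) as [x y], p as [px py].
        unfold Cconj, Cminus, Cplus, Copp, Cmult, RtoC; simpl. ring. }
      rewrite Esq. unfold Rminus. rewrite !exp_plus, <- !Rmult_assoc.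
      apply Rle_trans with (u p * exp (eps * Cmod p ^ 2) * exp (- (eps * Cmod p ^ 2))
                              * exp (- (eps * Cmod (E s - p) ^ 2))).
      + apply Rmult_le_compat_r; [left; apply exp_pos |].
        apply Rmult_le_compat_r; [left; apply exp_pos | exact V].
      + rewrite (Rmult_assoc (u p)), <- exp_plus.
        replace (eps * Cmod p ^ 2 + - (eps * Cmod p ^ 2)) with 0 by ring.
        rewrite exp_0, Rmult_1_r. apply Rmult_le_compat_l; [lra |].
        assert (S : - (eps * Cmod (E s - p) ^ 2) <= - (eps * c ^ 2)).
        { apply Ropp_le_contravar, Rmult_le_compat_l; [lra |]. apply pow_incr. lra. }
        now apply exp_le_compat. }
  assert (Eh : Cmod (h 0) = u p).
  { unfold h. rewrite E0, Cmod_mult, H0. replace (p - p)%C with (RtoC 0) by ring.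
    rewrite Cmult_0_r, cexp_0, Cmod_1. ring. }
  rewrite Eh in K.
  assert (exp (- (eps * c ^ 2)) < 1); [| nra].
  rewrite <- exp_0. apply exp_increasing. assert (0 < c ^ 2) by (apply pow_lt; lra). nra.
Qed.

Lemma Rpower_pos (x a : R) : 0 < Rpower x a.
Proof. apply exp_pos. Qed.

(** In the coordinate [z = p exp s] the weight [|z|^alpha] is, up to a constant, the modulus of the
    single-valued function [exp (alpha s)]. So [max_principle] applies for every real [alpha]. *)
Lemma three_circles (F : C -> C) (R r1 r2 alpha B : R) :
  0 < r1 -> r2 < R -> 0 <= B -> (forall z, 0 < Cmod z < R -> cdiff F z) ->
  (forall z, Cmod z = r1 \/ Cmod z = r2 -> Cmod (F z) * Rpower (Cmod z) alpha <= B) ->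
  forall z, r1 <= Cmod z <= r2 -> Cmod (F z) * Rpower (Cmod z) alpha <= B.
Proof.
  intros Hr1 Hr2 HB HF Hbd z0 Hz0.
  apply (max_principle (fun z => r1 <= Cmod z <= r2)
           (fun z => Cmod (F z) * Rpower (Cmod z) alpha) B); try assumption.
  - apply closed_bounded_annulus.
  - intros z Hz. apply rcont_mult.
    + apply ccont_rcont, cdiff_ccont, HF. lra.
    + apply (rcont_comp (fun t => Rpower t alpha)); [| apply rcont_Cmod].
      apply derivable_continuous_pt. exists (alpha * Rpower (Cmod z) (alpha - 1)).
      apply derivable_pt_lim_power. lra.
  - intros p Hp Hup.
    assert (Hin : r1 < Cmod p < r2).
    { split; apply Rnot_le_lt; intros Q; apply (Rlt_not_le _ _ Hup), Hbd; lra. }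
    destruct (cderiv_cexp_0 (1 / 2) ltac:(lra)) as [d [Hd H1]].
    assert (L1 : 0 < ln (Cmod p) - ln r1) by (apply Rlt_0_minus, ln_increasing; lra).
    assert (L2 : 0 < ln r2 - ln (Cmod p)) by (apply Rlt_0_minus, ln_increasing; lra).
    (* The logarithmic distances keep [p exp s] in the annulus; [d / 2] ensures
       [|exp s - 1| >= |s| / 2], which yields the separation [c]. *)
    set (rho := Rmin (d / 2) (Rmin (ln (Cmod p) - ln r1) (ln r2 - ln (Cmod p)))).
    assert (Hrho : 0 < rho) by (repeat apply Rmin_glb_lt; lra).
    assert (R0 : rho <= d / 2) by apply Rmin_l.
    assert (R1 : rho <= ln (Cmod p) - ln r1)
      by (eapply Rle_trans; [apply Rmin_r | apply Rmin_l]).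
    assert (R2 : rho <= ln r2 - ln (Cmod p))
      by (eapply Rle_trans; [apply Rmin_r | apply Rmin_r]).
    assert (Hmod : forall s, Cmod s <= rho -> r1 <= Cmod (p * cexp s) <= r2).
    { intros s Hs. rewrite Cmod_mult, Cmod_cexp.
      assert (T := re_le_Cmod s). apply Rabs_le_between in T.
      rewrite <- (exp_ln (Cmod p)) by lra. rewrite <- exp_plus. split.
      - rewrite <- (exp_ln r1) by lra.
        assert (S : ln r1 <= ln (Cmod p) + Re s) by lra.
        now apply exp_le_compat.
      - rewrite <- (exp_ln r2) by lra.
        assert (S : ln (Cmod p) + Re s <= ln r2) by lra.
        now apply exp_le_compat. }
    exists rho, (Cmod p * (rho / 2)),
      (fun s => RtoC (Rpower (Cmod p) alpha) * (F (p * cexp s) * cexp (RtoC alpha * s)))%C,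
      (fun s => p * cexp s)%C.
    split; [assumption |]. split; [apply Rmult_lt_0_compat; lra |]. split; [| split; [| split]].
    + intros s Hs. assert (DE : cdiff (fun s => p * cexp s)%C s)
        by apply cdiff_scal, cdiff_cexp.
      split; [| exact DE]. apply cdiff_scal, cdiff_mult.
      * apply (cdiff_comp F); [exact DE | apply HF]. specialize (Hmod s Hs). lra.
      * apply (cdiff_comp cexp); [apply cdiff_scal, cdiff_id | apply cdiff_cexp].
    + rewrite cexp_0. ring.
    + rewrite Cmult_0_r, cexp_0, !Cmult_1_r, Cmod_mult, Cmod_R, Rabs_right.
      * ring.
      * left. apply Rpower_pos.
    + intros s Hs. split; [apply Hmod; lra |]. split.
      * rewrite !Cmod_mult, Cmod_R, !Cmod_cexp, Rabs_right by (left; apply Rpower_pos).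
        rewrite (Rmult_comm (Rpower (Cmod p) alpha)), Rmult_assoc. f_equal.
        rewrite re_scal_l. unfold Rpower. rewrite ln_mult, ln_exp; [| lra | apply exp_pos].
        rewrite <- exp_plus. f_equal. ring.
      * replace (p * cexp s - p)%C with (p * (cexp s - 1))%C by ring.
        rewrite Cmod_mult. apply Rmult_le_compat_l; [lra |].
        specialize (H1 s). replace (s - 0)%C with s in H1 by ring. specialize (H1 ltac:(lra)).
        rewrite cexp_0, Cmult_1_l in H1.
        assert (T := Cmod_triangle_rev s (s - (cexp s - 1))).
        replace (s - (s - (cexp s - 1)))%C with (cexp s - 1)%C in T by ring.
        rewrite (Cmod_minus_sym s) in T. lra.
Qed.

(** Constant factors disappear under [k]-th roots. Comparing with [q] strictly between [B] and [x]
    includes the case [B = 0]. *)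
Lemma pow_compare (x B D M : R) : 0 <= B -> 0 < D ->
  (forall k, x ^ k * D <= B ^ k * M) -> x <= B.
Proof.
  intros HB HD H. apply Rnot_lt_le. intros Hx.
  set (q := (B + x) / 2). assert (Hq : 0 < q) by (unfold q; lra).
  assert (Hg : 1 < x / q) by (apply Rlt_div_r; unfold q in *; lra).
  destruct (Pow_x_infinity (x / q) ltac:(rewrite Rabs_right; lra) (Rabs M / D + 1)) as [k Hk].
  specialize (Hk k (le_n k)). specialize (H k).
  assert (Pq : 0 < q ^ k) by (apply pow_lt; lra).
  rewrite Rabs_right in Hk.
  2: { apply Rle_ge, pow_le; lra. }
  unfold Rdiv in Hk at 1. rewrite Rpow_mult_distr, pow_inv in Hk.
  assert (H2 : x ^ k * D <= q ^ k * Rabs M).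
  { eapply Rle_trans; [exact H |]. assert (B ^ k <= q ^ k) by (apply pow_incr; unfold q; lra).
    assert (0 <= B ^ k) by now apply pow_le. assert (T := Rle_abs M). assert (S := Rabs_pos M).
    apply Rle_trans with (B ^ k * Rabs M).
    - now apply Rmult_le_compat_l.
    - now apply Rmult_le_compat_r. }
  assert (H3 : x ^ k * / q ^ k <= Rabs M / D).
  { apply (Rle_div_r _ _ D); [exact HD |]. apply (Rmult_le_reg_r (q ^ k)); [exact Pq |].
    replace (x ^ k * / q ^ k * D * q ^ k) with (x ^ k * D) by (field; lra).
    rewrite (Rmult_comm (Rabs M)). exact H2. }
  unfold Rdiv in *. lra.
Qed.

(** * Punctured discs and removable singularities *)

Definition bounded_near (F : C -> C) (p : C) : Prop :=
  exists M d, 0 < d /\ forall z, z <> p -> Cmod (z - p) < d -> Cmod (F z) <= M.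

Lemma cdiff_bounded_near (F : C -> C) (p : C) : cdiff F p -> bounded_near F p.
Proof.
  intros H. destruct (cdiff_ccont F p H 1 Rlt_0_1) as [d [Hd H1]].
  exists (Cmod (F p) + 1), d. split; [assumption |]. intros z _ Hz. specialize (H1 z Hz).
  assert (T := Cmod_triangle_rev (F z) (F p)). lra.
Qed.

(* Applied to [F^k (z - p1) (z - p2)], which vanishes at the punctures; then [k] tends to infinity. *)
Lemma max_principle_punctured (F : C -> C) (r B : R) (p1 p2 : C) :
  Cmod p1 <= r -> Cmod p2 <= r -> 0 <= B ->
  (forall z, Cmod z <= r -> z <> p1 -> z <> p2 -> cdiff F z) ->
  bounded_near F p1 -> bounded_near F p2 ->
  (forall z, Cmod z = r -> Cmod (F z) <= B) ->
  forall z, Cmod z <= r -> z <> p1 -> z <> p2 -> Cmod (F z) <= B.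
Proof.
  intros Hp1 Hp2 HB HF Hn1 Hn2 Hbd z0 Hz0 N1 N2.
  assert (Hr : 0 <= r) by (eapply Rle_trans; [apply Cmod_ge_0 | exact Hz0]).
  assert (Q1 : 0 < Cmod (z0 - p1)) by now apply Cmod_gt_0, Cminus_eq_contra.
  assert (Q2 : 0 < Cmod (z0 - p2)) by now apply Cmod_gt_0, Cminus_eq_contra.
  apply (pow_compare _ _ (Cmod (z0 - p1) * Cmod (z0 - p2)) (2 * r * (2 * r)));
    [exact HB | now apply Rmult_lt_0_compat |].
  intros k.
  set (G := fun z => (F z ^ k * (z - p1) * (z - p2))%C).
  assert (EG : forall z, Cmod (G z) = Cmod (F z) ^ k * Cmod (z - p1) * Cmod (z - p2))
    by (intros z; unfold G; now rewrite !Cmod_mult, Cmod_pow).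
  assert (Dist : forall z p, Cmod z <= r -> Cmod p <= r -> Cmod (z - p) <= 2 * r)
    by (intros z p A1 A2; eapply Rle_trans; [apply Cmod_triangle_minus | lra]).
  assert (HG : forall z, Cmod z <= r -> z <> p1 -> z <> p2 -> cdiff G z).
  { intros z A1 A2 A3. apply cdiff_mult; [apply cdiff_mult |].
    - now apply cdiff_pow, HF.
    - apply cdiff_minus; [apply cdiff_id | apply cdiff_const].
    - apply cdiff_minus; [apply cdiff_id | apply cdiff_const]. }
  (* At a puncture [G] is zero whatever value [F] takes there, and boundedness of [F] nearby makes
     [|G|] continuous. The two punctures may coincide. *)
  assert (Hzero : forall p q, bounded_near F p -> (p = p1 /\ q = p2 \/ p = p2 /\ q = p1) ->
    Cmod q <= r -> Cmod p <= r -> rcont (fun z => Cmod (G z)) p).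
  { intros p q [M [d [Hd H1]]] Hpq Hq Hp eps Heps.
    assert (EGp : forall z, Cmod (G z) = Cmod (F z) ^ k * (Cmod (z - p) * Cmod (z - q))).
    { intros z. rewrite EG. destruct Hpq as [[-> ->] | [-> ->]]; ring. }
    set (M' := Rmax M 0). assert (M0 : 0 <= M') by apply Rmax_r.
    assert (MM : M <= M') by apply Rmax_l.
    assert (Mk : 0 <= M' ^ k) by now apply pow_le.
    set (D := M' ^ k * (2 * r + 1) + 1).
    assert (HD : 0 < D) by (unfold D; nra).
    exists (Rmin (Rmin d 1) (eps / D)). split.
    { repeat apply Rmin_glb_lt; try lra. now apply Rdiv_lt_0_compat. }
    intros w Hw. apply Rmin_Rgt_l in Hw. destruct Hw as [Hw W3].
    apply Rmin_Rgt_l in Hw. destruct Hw as [W1 W2].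
    rewrite (EGp p). replace (p - p)%C with (RtoC 0) by ring. rewrite Cmod_0.
    rewrite Rmult_0_l, Rmult_0_r, Rminus_0_r, Rabs_right by (apply Rle_ge, Cmod_ge_0).
    destruct (Ceq_dec w p) as [-> | Nw].
    { rewrite (EGp p). replace (p - p)%C with (RtoC 0) by ring. rewrite Cmod_0. lra. }
    rewrite EGp. specialize (H1 w Nw W1).
    assert (Fk : Cmod (F w) ^ k <= M' ^ k)
      by (apply pow_incr; split; [apply Cmod_ge_0 | lra]).
    assert (Wq : Cmod (w - q) <= 2 * r + 1).
    { replace (w - q)%C with ((w - p) + (p - q))%C by ring.
      eapply Rle_trans; [apply Cmod_triangle |]. specialize (Dist p q Hp Hq). lra. }
    assert (Pw : 0 <= Cmod (w - p)) by apply Cmod_ge_0.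
    assert (Pq : 0 <= Cmod (w - q)) by apply Cmod_ge_0.
    assert (PF : 0 <= Cmod (F w) ^ k) by apply pow_le, Cmod_ge_0.
    apply Rle_lt_trans with (D * Cmod (w - p)).
    - apply Rle_trans with (M' ^ k * (Cmod (w - p) * (2 * r + 1))).
      + apply Rmult_le_compat; [assumption | now apply Rmult_le_pos | assumption |].
        now apply Rmult_le_compat_l.
      + unfold D. nra.
    - apply (Rmult_lt_compat_l D) in W3; [| assumption].
      replace (D * (eps / D)) with eps in W3 by (field; lra). exact W3. }
  rewrite <- Rmult_assoc, <- EG.
  apply (max_principle (fun z => 0 <= Cmod z <= r) (fun z => Cmod (G z))).
  - apply closed_bounded_annulus.
  - intros z Hz. destruct (Ceq_dec z p1) as [-> | Z1].
    { now apply (Hzero p1 p2); auto. }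
    destruct (Ceq_dec z p2) as [-> | Z2].
    { now apply (Hzero p2 p1); auto. }
    apply ccont_rcont, cdiff_ccont, HG; tauto.
  - apply Rmult_le_pos; [now apply pow_le | nra].
  - intros p [Hp0 Hp] Hup.
    assert (Z1 : p <> p1).
    { intros ->. revert Hup. rewrite EG. replace (p1 - p1)%C with (RtoC 0) by ring.
      rewrite Cmod_0. assert (0 <= B ^ k * (2 * r * (2 * r))); [| lra].
      apply Rmult_le_pos; [now apply pow_le | nra]. }
    assert (Z2 : p <> p2).
    { intros ->. revert Hup. rewrite EG. replace (p2 - p2)%C with (RtoC 0) by ring.
      rewrite Cmod_0. assert (0 <= B ^ k * (2 * r * (2 * r))); [| lra].
      apply Rmult_le_pos; [now apply pow_le | nra]. }
    assert (Zr : Cmod p < r).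
    { destruct Hp as [Hp | Hp]; [assumption |]. exfalso. apply (Rlt_not_le _ _ Hup).
      rewrite EG, Rmult_assoc. apply Rmult_le_compat.
      - apply pow_le, Cmod_ge_0.
      - apply Rmult_le_pos; apply Cmod_ge_0.
      - apply pow_incr. split; [apply Cmod_ge_0 | now apply Hbd].
      - apply Rmult_le_compat; try apply Cmod_ge_0; apply Dist; lra. }
    assert (P1 : 0 < Cmod (p - p1)) by now apply Cmod_gt_0, Cminus_eq_contra.
    assert (P2 : 0 < Cmod (p - p2)) by now apply Cmod_gt_0, Cminus_eq_contra.
    set (rho := Rmin (r - Cmod p) (Rmin (Cmod (p - p1) / 2) (Cmod (p - p2) / 2))).
    assert (Hrho : 0 < rho) by (repeat apply Rmin_glb_lt; lra).
    assert (R0 : rho <= r - Cmod p) by apply Rmin_l.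
    assert (R1 : rho <= Cmod (p - p1) / 2) by (eapply Rle_trans; [apply Rmin_r | apply Rmin_l]).
    assert (R2 : rho <= Cmod (p - p2) / 2) by (eapply Rle_trans; [apply Rmin_r | apply Rmin_r]).
    assert (In : forall s, Cmod s <= rho -> Cmod (p + s) <= r)
      by (intros s Hs; eapply Rle_trans; [apply Cmod_triangle | lra]).
    assert (DE : forall s, cdiff (fun s => p + s)%C s)
      by (intros s; apply cdiff_plus; [apply cdiff_const | apply cdiff_id]).
    exists rho, rho, (fun s => G (p + s)%C), (fun s => (p + s)%C).
    split; [assumption |]. split; [assumption |]. split; [| split; [| split]].
    + intros s Hs. split; [| apply DE]. apply (cdiff_comp G); [apply DE |].
      assert (Av : forall q, rho <= Cmod (p - q) / 2 -> 0 < Cmod (p - q) -> (p + s)%C <> q).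
      { intros q Hq Pq Eq. rewrite <- Eq in Hq, Pq.
        replace (p - (p + s))%C with (- s)%C in * by ring. rewrite Cmod_opp in *. lra. }
      apply HG; auto.
    + ring.
    + f_equal. f_equal. ring.
    + intros s Hs. split; [split; [apply Cmod_ge_0 | apply In; lra] |]. split; [reflexivity |].
      replace (p + s - p)%C with s by ring. lra.
  - split; [apply Cmod_ge_0 | assumption].
Qed.

Lemma bounded_on_circle (F : C -> C) (r : R) : 0 <= r ->
  (forall z, Cmod z = r -> cdiff F z) -> exists M, 0 <= M /\ forall z, Cmod z = r -> Cmod (F z) <= M.
Proof.
  intros Hr HF.
  destruct (extreme_value (fun z => r <= Cmod z <= r) (fun z => Cmod (F z))) as [p [_ Hp]].
  - apply closed_bounded_annulus.
  - exists (RtoC r). rewrite Cmod_R, Rabs_right; lra.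
  - intros z Hz. apply ccont_rcont, cdiff_ccont, HF. lra.
  - exists (Cmod (F p)). split; [apply Cmod_ge_0 |]. intros z Hz. apply Hp. lra.
Qed.

(** The maximum principle for [(F z - F w) / (z - w)], which is bounded near [w] by
    differentiability and has denominator at least [r - delta] on the circle. The puncture at [0] is
    kept so that the bound applies before [F] is known to extend there. *)
Lemma difference_quotient_bound (F : C -> C) (r delta M : R) (w : C) :
  0 <= delta -> delta < r -> Cmod w <= delta -> w <> 0 -> 0 <= M ->
  (forall z, Cmod z <= r -> z <> 0 -> cdiff F z) -> bounded_near F 0 ->
  (forall z, Cmod z = r -> Cmod (F z - F w) <= M) ->
  forall z, Cmod z <= r -> z <> 0 -> Cmod (F z - F w) <= M / (r - delta) * Cmod (z - w).
Proof.
  intros Hd Hdr Hw Nw HM HF Hn Hbd z Hz Nz.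
  destruct (Ceq_dec z w) as [-> | Nzw].
  { replace (F w - F w)%C with (RtoC 0) by ring. replace (w - w)%C with (RtoC 0) by ring.
    rewrite Cmod_0. lra. }
  assert (Pzw : 0 < Cmod (z - w)) by now apply Cmod_gt_0, Cminus_eq_contra.
  assert (Pw : 0 < Cmod w) by now apply Cmod_gt_0.
  apply Rle_div_l; [assumption |].
  rewrite <- Cmod_div by now apply Cminus_eq_contra.
  apply (max_principle_punctured (fun z => (F z - F w) / (z - w))%C r _ 0 w).
  - rewrite Cmod_0. lra.
  - lra.
  - apply Rdiv_le_0_compat; lra.
  - intros q Q1 Q2 Q3. apply cdiff_div.
    + apply cdiff_minus; [now apply HF | apply cdiff_const].
    + apply cdiff_minus; [apply cdiff_id | apply cdiff_const].
    + now apply Cminus_eq_contra.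
  - destruct Hn as [K [d [Hdp H1]]]. exists ((K + Cmod (F w)) / (Cmod w / 2)), (Rmin d (Cmod w / 2)).
    split; [apply Rmin_glb_lt; lra |]. intros q Q1 Q2. apply Rmin_Rgt_l in Q2.
    destruct Q2 as [Q2 Q3]. specialize (H1 q Q1 Q2).
    replace (q - 0)%C with q in Q3 by ring.
    assert (T := Cmod_triangle_rev w q). rewrite Cmod_minus_sym in T.
    assert (Cmod (q - w) >= Cmod w / 2) by lra.
    rewrite Cmod_div by (apply Cmod_gt_0; lra).
    assert (T2 := Cmod_triangle_minus (F q) (F w)).
    unfold Rdiv at 1 3. apply Rmult_le_compat.
    + apply Cmod_ge_0.
    + left. apply Rinv_0_lt_compat. lra.
    + lra.
    + apply Rinv_le_contravar; lra.
  - destruct (cdiff_lipschitz_at F w (HF w ltac:(lra) Nw)) as [K [d [HK [Hdp H1]]]].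
    exists K, d. split; [assumption |]. intros q Q1 Q2. specialize (H1 q Q2).
    rewrite Cmod_div by now apply Cminus_eq_contra.
    apply Rle_div_l; [now apply Cmod_gt_0, Cminus_eq_contra | exact H1].
  - intros q Hq. assert (T := Cmod_triangle_rev q w).
    rewrite Cmod_div by (apply Cmod_gt_0; lra).
    unfold Rdiv. apply Rmult_le_compat.
    + apply Cmod_ge_0.
    + left. apply Rinv_0_lt_compat. lra.
    + now apply Hbd.
    + apply Rinv_le_contravar; lra.
  - assumption.
  - assumption.
  - assumption.
Qed.

(** The difference quotient bound makes [F] Lipschitz on a punctured disc. Its values along [t n],
    which tends to [0], are then Cauchy, and the same Lipschitz constant gives the linear rate of
    convergence to the limit [l]. *)
Lemma removable_singularity (F : C -> C) (R : R) : 0 < R ->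
  (forall z, 0 < Cmod z < R -> cdiff F z) -> bounded_near F 0 ->
  exists l K d, 0 < d /\ 0 <= K /\ forall z, 0 < Cmod z < d -> Cmod (F z - l) <= K * Cmod z.
Proof.
  intros HR HF Hn. set (r := R / 2). assert (Hr : 0 < r) by (unfold r; lra).
  assert (HF' : forall z, Cmod z <= r -> z <> 0 -> cdiff F z).
  { intros z H1 H2. apply HF. apply Cmod_gt_0 in H2. unfold r in H1. lra. }
  destruct (bounded_on_circle F r ltac:(unfold r; lra)) as [M [HM Hcirc]].
  { intros z Hz. apply HF. unfold r in Hz. lra. }
  assert (Hall : forall z, Cmod z <= r -> z <> 0 -> Cmod (F z) <= M).
  { intros z H1 H2. apply (max_principle_punctured F r M 0 0); auto; rewrite Cmod_0; unfold r; lra. }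
  set (K := 2 * M / (r - r / 2)).
  assert (HK : 0 <= K) by (apply Rdiv_le_0_compat; unfold r; lra).
  assert (Hlip : forall z w, Cmod z <= r / 2 -> z <> 0 -> Cmod w <= r / 2 -> w <> 0 ->
     Cmod (F z - F w) <= K * Cmod (z - w)).
  { intros z w Z1 Z2 W1 W2.
    apply (difference_quotient_bound F r (r / 2)); auto; try (unfold r in *; lra).
    intros q Hq. eapply Rle_trans; [apply Cmod_triangle_minus |].
    assert (S1 := Hcirc q Hq). assert (S2 := Hall w ltac:(lra) W2). lra. }
  set (t := fun n => r / 2 * / (INR n + 1)).
  assert (Tp : forall n, 0 < t n).
  { intros n. apply Rmult_lt_0_compat; [unfold r; lra | apply Rinv_0_lt_compat].
    assert (Q := pos_INR n). lra. }
  assert (Tle : forall n, t n <= r / 2).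
  { intros n. unfold t. rewrite <- (Rmult_1_r (r / 2)) at 2.
    apply Rmult_le_compat_l; [unfold r; lra |]. rewrite <- Rinv_1.
    apply Rinv_le_contravar; assert (Q := pos_INR n); lra. }
  assert (T0 : forall eps, 0 < eps -> exists N, forall n, (N <= n)%nat -> t n < eps).
  { intros eps He. destruct (archimed_cor1 (eps / (r / 2))) as [N [N1 N2]].
    { apply Rdiv_lt_0_compat; unfold r; lra. }
    exists N. intros n Hn'. unfold t. apply Rlt_le_trans with (r / 2 * (eps / (r / 2))).
    - apply Rmult_lt_compat_l; [unfold r; lra |]. eapply Rle_lt_trans; [| exact N1].
      apply le_INR in Hn'. apply lt_INR in N2. simpl in N2.
      apply Rinv_le_contravar; lra.
    - right. field. unfold r. lra. }
  assert (Tc : forall n, RtoC (t n) <> 0 /\ Cmod (t n) = t n).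
  { intros n. specialize (Tp n). split; [intros Q; apply RtoC_inj in Q; lra |].
    rewrite Cmod_R, Rabs_right; lra. }
  assert (Hcau : forall eps, 0 < eps -> exists N, forall n m, (N <= n)%nat -> (N <= m)%nat ->
     Cmod (F (t n) - F (t m)) < eps).
  { intros eps He. destruct (T0 (eps / (2 * K + 1))) as [N HN].
    { apply Rdiv_lt_0_compat; lra. }
    exists N. intros n m H1 H2. destruct (Tc n) as [C1 C2]. destruct (Tc m) as [C3 C4].
    eapply Rle_lt_trans; [apply Hlip; auto; rewrite ?C2, ?C4; apply Tle |].
    apply HN in H1. apply HN in H2. assert (P1 := Tp n). assert (P2 := Tp m).
    apply Rle_lt_trans with (K * (eps / (2 * K + 1) + eps / (2 * K + 1))).
    - apply Rmult_le_compat_l; [assumption |].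
      eapply Rle_trans; [apply Cmod_triangle_minus |]. rewrite C2, C4. lra.
    - replace eps with ((2 * K + 1) * (eps / (2 * K + 1))) at 3 by (field; lra).
      assert (0 < eps / (2 * K + 1)) by (apply Rdiv_lt_0_compat; lra). nra. }
  assert (C1 : ex_finite_lim_seq (fun n => Re (F (t n)))).
  { apply ex_lim_seq_cauchy_corr. intros eps. destruct (Hcau eps (cond_pos eps)) as [N HN].
    exists N. intros n m H1 H2. eapply Rle_lt_trans; [| exact (HN n m H1 H2)].
    exact (re_le_Cmod (F (t n) - F (t m))). }
  assert (C2 : ex_finite_lim_seq (fun n => Im (F (t n)))).
  { apply ex_lim_seq_cauchy_corr. intros eps. destruct (Hcau eps (cond_pos eps)) as [N HN].
    exists N. intros n m H1 H2. eapply Rle_lt_trans; [| exact (HN n m H1 H2)].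
    exact (im_le_Cmod (F (t n) - F (t m))). }
  destruct C1 as [l1 L1]. destruct C2 as [l2 L2].
  exists (l1, l2), K, (r / 2). split; [unfold r; lra |]. split; [assumption |].
  intros z [Z1 Z2]. apply le_epsilon. intros eps He.
  apply is_lim_seq_spec in L1. apply is_lim_seq_spec in L2.
  destruct (L1 (mkposreal (eps / 4) ltac:(lra))) as [N1 H1].
  destruct (L2 (mkposreal (eps / 4) ltac:(lra))) as [N2 H2].
  destruct (T0 (eps / (2 * (K + 1)))) as [N3 H3]; [apply Rdiv_lt_0_compat; lra |].
  set (n := (N1 + N2 + N3)%nat).
  specialize (H1 n ltac:(lia)). specialize (H2 n ltac:(lia)). specialize (H3 n ltac:(lia)).
  simpl in H1, H2. destruct (Tc n) as [D1 D2].
  assert (S := Hlip z (t n) ltac:(lra) (proj2 (Cmod_gt_0 z) Z1) ltac:(rewrite D2; apply Tle) D1).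
  replace (F z - (l1, l2))%C with ((F z - F (t n)) + (F (t n) - (l1, l2)))%C by ring.
  eapply Rle_trans; [apply Cmod_triangle |].
  assert (S2 : Cmod (F (t n) - (l1, l2)) <= eps / 2).
  { destruct (F (t n)) as [x y]. replace ((x, y) - (l1, l2))%C with ((x - l1, y - l2) : C)
      by reflexivity.
    eapply Rle_trans; [apply Cmod_le_abs |]. simpl in H1, H2. lra. }
  assert (S3 : K * Cmod (z - t n) <= K * Cmod z + eps / 2).
  { assert (T := Cmod_triangle_minus z (t n)). rewrite D2 in T.
    assert (K * t n <= eps / 2).
    { apply Rle_trans with ((K + 1) * (eps / (2 * (K + 1)))).
      - specialize (Tp n). apply Rmult_le_compat; lra.
      - right. field. lra. }
    apply Rle_trans with (K * (Cmod z + t n)); [now apply Rmult_le_compat_l | lra]. }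
  lra.
Qed.

(** * Leading terms at the origin *)

Lemma cderiv_0_bound (f : C -> C) (l : C) : cderiv f 0 l -> forall eps, 0 < eps ->
  exists d, 0 < d /\ forall z, Cmod z < d -> Cmod (f z - f 0 - l * z) <= eps * Cmod z.
Proof.
  intros H eps He. destruct (H eps He) as [d [Hd H1]]. exists d. split; [assumption |].
  intros z Hz. specialize (H1 z). replace (z - 0)%C with z in H1 by ring. auto.
Qed.

(** Continuity of the derivative is bypassed: the Lipschitz constant of [g = f - l z] on a disc is
    controlled by the size of [g - g 0] on a larger circle. With accuracy [eta / 3] on radius [r]
    and points within [r / 2], the quotient is [(eta / 3) (r + r/2) / (r - r/2) = eta]. *)
Lemma strictly_differentiable_at_0 (f : C -> C) (R : R) (l : C) : 0 < R ->
  (forall z, Cmod z < R -> cdiff f z) -> cderiv f 0 l ->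
  forall eta, 0 < eta -> exists d, 0 < d /\ forall z w, Cmod z < d -> Cmod w < d ->
    Cmod (f z - f w - l * (z - w)) <= eta * Cmod (z - w).
Proof.
  intros HR Hf Hl eta Heta.
  destruct (cderiv_0_bound f l Hl (eta / 3) ltac:(lra)) as [d [Hd H1]].
  set (r := Rmin (d / 2) (R / 2)). assert (Hr : 0 < r) by (apply Rmin_glb_lt; lra).
  assert (R1 : r <= d / 2) by apply Rmin_l. assert (R2 : r <= R / 2) by apply Rmin_r.
  set (g := fun z => (f z - l * z)%C).
  assert (Hg : forall z, Cmod z < R -> cdiff g z).
  { intros z Hz. apply cdiff_minus; [now apply Hf | apply cdiff_scal, cdiff_id]. }
  assert (G0 : forall z, Cmod z < d -> Cmod (g z - g 0) <= eta / 3 * Cmod z).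
  { intros z Hz. unfold g. replace (f z - l * z - (f 0 - l * 0))%C
      with (f z - f 0 - l * z)%C by ring. auto. }
  exists (r / 2). split; [lra |]. intros z w Hz Hw.
  replace (f z - f w - l * (z - w))%C with (g z - g w)%C by (unfold g; ring).
  destruct (Ceq_dec z 0) as [-> | Nz].
  { rewrite Cmod_minus_sym, (Cmod_minus_sym 0). replace (w - 0)%C with w by ring.
    eapply Rle_trans; [apply G0; lra |]. apply Rmult_le_compat_r; [apply Cmod_ge_0 | lra]. }
  destruct (Ceq_dec w 0) as [-> | Nw].
  { replace (z - 0)%C with z by ring.
    eapply Rle_trans; [apply G0; lra |]. apply Rmult_le_compat_r; [apply Cmod_ge_0 | lra]. }
  replace eta with (eta / 3 * (r + r / 2) / (r - r / 2)) by (field; lra).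
  apply (difference_quotient_bound g r (r / 2)); try lra; try assumption.
  - apply Rmult_le_pos; lra.
  - intros q Q1 Q2. apply Hg. lra.
  - apply cdiff_bounded_near, Hg. rewrite Cmod_0. lra.
  - intros q Hq. replace (g q - g w)%C with ((g q - g 0) - (g w - g 0))%C by ring.
    eapply Rle_trans; [apply Cmod_triangle_minus |].
    assert (S1 := G0 q ltac:(lra)). assert (S2 := G0 w ltac:(lra)).
    assert (eta / 3 * Cmod w <= eta / 3 * (r / 2)) by (apply Rmult_le_compat_l; lra).
    rewrite Hq in S1. lra.
Qed.

Lemma cdiff_div_pow (g : C -> C) (N : nat) (z : C) : cdiff g z -> z <> 0 ->
  cdiff (fun w => g w / w ^ N)%C z.
Proof.
  intros Hg Hz. apply cdiff_div; [assumption | apply (cdiff_pow (fun w => w)), cdiff_id |].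
  now apply Cpow_nz.
Qed.

Lemma bounded_near_div_pow (g : C -> C) (N : nat) (K d : R) : 0 < d ->
  (forall z, 0 < Cmod z < d -> Cmod (g z) <= K * Cmod z ^ N) ->
  bounded_near (fun w => g w / w ^ N)%C 0.
Proof.
  intros Hd H. exists K, d. split; [assumption |]. intros z Nz Hz.
  replace (z - 0)%C with z in Hz by ring. assert (P := proj1 (Cmod_gt_0 z) Nz).
  rewrite Cmod_div, Cmod_pow by now apply Cpow_nz.
  apply Rle_div_l; [now apply pow_lt | auto].
Qed.

Definition leading_term (g : C -> C) (m : nat) (a : C) : Prop :=
  forall eps, 0 < eps -> exists d, 0 < d /\ forall z, 0 < Cmod z < d ->
    Cmod (g z - a * z ^ m) <= eps * Cmod z ^ m.

(** Without a leading term, the limit of [g / z^(N+k)] at [0] is zero for each [k], so the order of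
    vanishing rises forever. The maximum principle for [g / z^(N+k)] on a circle of radius [r > |z|]
    gives [|g z| <= M (|z| / r)^(N+k)] for all [k], hence [g z = 0]. *)
Lemma zero_or_leading_term (g : C -> C) (R K0 d0 : R) (N : nat) : 0 < d0 ->
  (forall z, Cmod z < R -> cdiff g z) ->
  (forall z, 0 < Cmod z < d0 -> Cmod (g z) <= K0 * Cmod z ^ N) ->
  (forall z, 0 < Cmod z < R -> g z = 0) \/
  exists m (a : C), (N <= m)%nat /\ a <> 0 /\ leading_term g m a.
Proof.
  intros Hd0 Hg H0.
  destruct (classic (exists m (a : C), (N <= m)%nat /\ a <> 0 /\ leading_term g m a)) as [Y | Hno];
    [now right | left].
  assert (Hex : forall z, 0 < Cmod z < R -> 0 < R) by (intros; lra).
  assert (Hk : 0 < R -> forall k, exists K d, 0 < d /\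
    forall z, 0 < Cmod z < d -> Cmod (g z) <= K * Cmod z ^ (N + k)).
  { intros HR. induction k as [| k [K [d [Hd H1]]]].
    { exists K0, d0. rewrite Nat.add_0_r. auto. }
    set (q := fun w => (g w / w ^ (N + k))%C).
    destruct (removable_singularity q R HR) as [l [K' [d' [Hd' [HK' H2]]]]].
    { intros z Hz. apply cdiff_div_pow; [apply Hg; lra | apply Cmod_gt_0; lra]. }
    { now apply (bounded_near_div_pow g (N + k) K d). }
    assert (H3 : forall z, 0 < Cmod z < d' ->
        Cmod (g z - l * z ^ (N + k)) <= K' * Cmod z * Cmod z ^ (N + k)).
    { intros z Hz. assert (Nz : z <> 0) by (apply Cmod_gt_0; lra).
      assert (Nzk : (z ^ (N + k))%C <> 0) by now apply Cpow_nz.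
      replace (g z - l * z ^ (N + k))%C with ((q z - l) * z ^ (N + k))%C
        by (unfold q; field; assumption).
      rewrite Cmod_mult, Cmod_pow. apply Rmult_le_compat_r; [apply pow_le; lra | auto]. }
    destruct (Ceq_dec l 0) as [-> | Nl].
    - exists K', d'. split; [assumption |]. intros z Hz. specialize (H3 z Hz).
      replace (g z - 0 * z ^ (N + k))%C with (g z) in H3 by ring.
      rewrite Nat.add_succ_r. simpl. lra.
    - exfalso. apply Hno. exists (N + k)%nat, l. split; [lia |]. split; [assumption |].
      intros eps He. exists (Rmin d' (eps / (K' + 1))). split.
      { apply Rmin_glb_lt; [assumption | apply Rdiv_lt_0_compat; lra]. }
      intros z [Z1 Z2]. apply Rmin_Rgt_l in Z2. destruct Z2 as [Z2 Z3].
      eapply Rle_trans; [apply H3; lra |]. apply Rmult_le_compat_r; [apply pow_le; lra |].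
      apply (Rmult_lt_compat_l (K' + 1)) in Z3; [| lra].
      replace ((K' + 1) * (eps / (K' + 1))) with eps in Z3 by (field; lra). nra. }
  intros z Hz. specialize (Hk (Hex z Hz)).
  set (r := (Cmod z + R) / 2).
  destruct (bounded_on_circle g r ltac:(unfold r; lra)) as [M [HM Hcirc]].
  { intros w Hw. apply Hg. unfold r in Hw. lra. }
  apply NNPP. intros Nz0. assert (Pg : 0 < Cmod (g z)) by now apply Cmod_gt_0.
  assert (Hr : 0 < r) by (unfold r; lra).
  assert (r <= Cmod z); [| unfold r in *; lra].
  apply (pow_compare r (Cmod z) (r ^ N * Cmod (g z)) (Cmod z ^ N * M)); [lra | |].
  { apply Rmult_lt_0_compat; [now apply pow_lt | assumption]. }
  intros k. destruct (Hk k) as [K [d [Hd H1]]].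
  assert (Nz : z <> 0) by (apply Cmod_gt_0; lra).
  assert (S : Cmod (g z / z ^ (N + k)) <= M / r ^ (N + k)).
  { apply (max_principle_punctured (fun w => g w / w ^ (N + k))%C r _ 0 0);
      try (rewrite Cmod_0; lra).
    - apply Rdiv_le_0_compat; [assumption | now apply pow_lt].
    - intros w W1 W2 _. apply cdiff_div_pow; [apply Hg; unfold r in *; lra | assumption].
    - now apply (bounded_near_div_pow g (N + k) K d).
    - now apply (bounded_near_div_pow g (N + k) K d).
    - intros w Hw. assert (Nw : w <> 0) by (apply Cmod_gt_0; lra).
      rewrite Cmod_div, Cmod_pow, Hw by now apply Cpow_nz.
      apply Rmult_le_compat_r; [left; now apply Rinv_0_lt_compat, pow_lt | auto].
    - unfold r. lra.
    - assumption.
    - assumption. }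
  rewrite Cmod_div, Cmod_pow in S by now apply Cpow_nz.
  assert (P1 : 0 < r ^ (N + k)) by now apply pow_lt.
  assert (P2 : 0 < Cmod z ^ (N + k)) by (apply pow_lt; lra).
  apply (Rmult_le_compat_r (r ^ (N + k) * Cmod z ^ (N + k))) in S; [| nra].
  replace (Cmod (g z) / Cmod z ^ (N + k) * (r ^ (N + k) * Cmod z ^ (N + k)))
    with (Cmod (g z) * r ^ (N + k)) in S by (field; lra).
  replace (M / r ^ (N + k) * (r ^ (N + k) * Cmod z ^ (N + k)))
    with (M * Cmod z ^ (N + k)) in S by (field; lra).
  rewrite !pow_add in S. lra.
Qed.

(** A leading term of order one is impossible: [a1] is the derivative, so the remainder is already
    [o(|z|)]. *)
Lemma linear_or_leading_term (f : C -> C) (a1 : C) :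
  (forall z, Cmod z < 1 -> cdiff f z) -> cderiv f 0 a1 -> ~ is_linear_on_disc f ->
  exists m (a : C), (1 <= m)%nat /\ a <> 0 /\ leading_term (fun z => f z - f 0 - a1 * z)%C (S m) a.
Proof.
  intros Hf H1 Hnl.
  set (g := fun z => (f z - f 0 - a1 * z)%C).
  assert (Hg : forall z, Cmod z < 1 -> cdiff g z).
  { intros z Hz. apply cdiff_minus; [apply cdiff_minus; [now apply Hf | apply cdiff_const] |].
    apply cdiff_scal, cdiff_id. }
  destruct (cderiv_0_bound f a1 H1 1 Rlt_0_1) as [d [Hd H2]].
  destruct (zero_or_leading_term g 1 1 d 1 Hd Hg) as [Hz0 | [m [a [Hm [Na Hlead]]]]].
  - intros z Hz. unfold g. specialize (H2 z (proj2 Hz)). lra.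
  - exfalso. apply Hnl. exists a1, (f 0). intros z Hz.
    destruct (Ceq_dec z 0) as [-> | Nz]; [ring |].
    assert (Q : g z = 0) by (apply Hz0; split; [now apply Cmod_gt_0 | assumption]).
    unfold g in Q. replace (f z) with ((f z - f 0 - a1 * z) + a1 * z + f 0)%C by ring.
    rewrite Q. ring.
  - destruct m as [| [| m]]; [lia | | exists (S m), a; split; [lia | auto]].
    exfalso. assert (Pa : 0 < Cmod a) by now apply Cmod_gt_0.
    destruct (Hlead (Cmod a / 4) ltac:(lra)) as [d1 [Hd1 H3]].
    destruct (cderiv_0_bound f a1 H1 (Cmod a / 4) ltac:(lra)) as [d2 [Hd2 H4]].
    set (t := Rmin d1 d2 / 2).
    assert (T0 : 0 < Rmin d1 d2) by now apply Rmin_glb_lt.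
    assert (T1 := Rmin_l d1 d2). assert (T2 := Rmin_r d1 d2).
    assert (Ct : Cmod t = t) by (rewrite Cmod_R, Rabs_right; unfold t; lra).
    specialize (H3 t ltac:(rewrite Ct; unfold t; lra)).
    specialize (H4 t ltac:(rewrite Ct; unfold t; lra)).
    fold (g t) in H4. simpl in H3. rewrite Cmult_1_r, Rmult_1_r in H3.
    assert (T := Cmod_triangle_rev (a * t) (g t)). rewrite Cmod_minus_sym, Cmod_mult, Ct in T.
    rewrite Ct in H3, H4. assert (Pt : 0 < t) by (unfold t; lra). nra.
Qed.

(** * The [n]-diameter *)

Lemma prod_upto_ext (m : nat) (g h : nat -> R) :
  (forall i, (i < m)%nat -> g i = h i) -> prod_upto m g = prod_upto m h.
Proof.
  intros H. induction m as [| m IH]; [reflexivity |]. simpl.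
  rewrite IH by (intros; apply H; lia). now rewrite H by lia.
Qed.

Lemma prod_upto_nonneg (m : nat) (g : nat -> R) :
  (forall i, (i < m)%nat -> 0 <= g i) -> 0 <= prod_upto m g.
Proof.
  intros H. induction m as [| m IH]; simpl; [lra |].
  apply Rmult_le_pos; [apply IH; intros; apply H; lia | apply H; lia].
Qed.

Lemma prod_upto_le (m : nat) (g h : nat -> R) :
  (forall i, (i < m)%nat -> 0 <= g i <= h i) -> prod_upto m g <= prod_upto m h.
Proof.
  intros H. induction m as [| m IH]; simpl; [lra |].
  apply Rmult_le_compat.
  - apply prod_upto_nonneg. intros; apply H; lia.
  - apply H; lia.
  - apply IH. intros; apply H; lia.
  - apply H; lia.
Qed.

Lemma prod_upto_const (m : nat) (c : R) : prod_upto m (fun _ => c) = c ^ m.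
Proof. induction m as [| m IH]; simpl; [reflexivity | rewrite IH; ring]. Qed.

Lemma prod_upto_mult (m : nat) (g h : nat -> R) :
  prod_upto m (fun i => g i * h i) = prod_upto m g * prod_upto m h.
Proof. induction m as [| m IH]; simpl; [ring | rewrite IH; ring]. Qed.

(** The number of pairs [j < k < n], defined by recursion so that it unfolds in step with
    [pair_prod]. *)
Fixpoint tri (n : nat) : nat := match n with O => O | S m => (tri m + m)%nat end.

Lemma INR_tri (n : nat) : INR (tri n) = INR n * (INR n - 1) / 2.
Proof.
  induction n as [| n IH]; [simpl; lra |].
  change (tri (S n)) with (tri n + n)%nat. rewrite plus_INR, IH, S_INR. lra.
Qed.

Lemma tri_pos (n : nat) : (2 <= n)%nat -> (0 < tri n)%nat.
Proof. intros H. destruct n as [| [| n]]; simpl; lia. Qed.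

Lemma prod_upto_le_const (m : nat) (g : nat -> R) (K : R) :
  (forall i, (i < m)%nat -> 0 <= g i <= K) -> prod_upto m g <= K ^ m.
Proof. intros H. rewrite <- prod_upto_const. now apply prod_upto_le. Qed.

Lemma pair_prod_nonneg (n : nat) (z : nat -> C) : 0 <= pair_prod n z.
Proof.
  apply prod_upto_nonneg. intros k _. apply prod_upto_nonneg. intros j _. apply Cmod_ge_0.
Qed.

Lemma pair_prod_S (n : nat) (z : nat -> C) :
  pair_prod (S n) z = pair_prod n z * prod_upto n (fun j => Cmod (z j - z n)).
Proof. reflexivity. Qed.

Lemma pair_prod_ext (n : nat) (z w : nat -> C) :
  (forall i, (i < n)%nat -> z i = w i) -> pair_prod n z = pair_prod n w.
Proof.
  intros H. apply prod_upto_ext. intros k Hk. apply prod_upto_ext. intros j Hj.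
  now rewrite !H by lia.
Qed.

Lemma pair_prod_scal_le (n : nat) (z w : nat -> C) (L : R) : 0 <= L ->
  (forall i j, (i < n)%nat -> (j < n)%nat -> Cmod (z i - z j) <= L * Cmod (w i - w j)) ->
  pair_prod n z <= L ^ tri n * pair_prod n w.
Proof.
  intros HL. induction n as [| n IH]; intros H; [unfold pair_prod; simpl; lra |].
  rewrite !pair_prod_S. change (tri (S n)) with (tri n + n)%nat. rewrite pow_add.
  replace (L ^ tri n * L ^ n * (pair_prod n w * prod_upto n (fun j => Cmod (w j - w n))))
    with (L ^ tri n * pair_prod n w * (L ^ n * prod_upto n (fun j => Cmod (w j - w n)))) by ring.
  apply Rmult_le_compat.
  - apply pair_prod_nonneg.
  - apply prod_upto_nonneg. intros; apply Cmod_ge_0.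
  - apply IH. intros. apply H; lia.
  - rewrite <- prod_upto_const, <- prod_upto_mult. apply prod_upto_le.
    intros i Hi. split; [apply Cmod_ge_0 | apply H; lia].
Qed.

Lemma pair_prod_bound (n : nat) (z : nat -> C) (D : R) :
  (forall i j, (i < n)%nat -> (j < n)%nat -> Cmod (z i - z j) <= D) ->
  pair_prod n z <= D ^ tri n.
Proof.
  intros H. induction n as [| n IH]; [unfold pair_prod; simpl; lra |].
  rewrite pair_prod_S. change (tri (S n)) with (tri n + n)%nat. rewrite pow_add.
  apply Rmult_le_compat.
  - apply pair_prod_nonneg.
  - apply prod_upto_nonneg. intros; apply Cmod_ge_0.
  - apply IH. intros. apply H; lia.
  - apply prod_upto_le_const. intros i Hi. split; [apply Cmod_ge_0 | apply H; lia].
Qed.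

Lemma pow_le_reg (a b : R) (m : nat) : (0 < m)%nat -> 0 <= b -> a ^ m <= b ^ m -> a <= b.
Proof.
  intros Hm Hb H. apply Rnot_lt_le. intros Hab.
  assert (b ^ m < a ^ m); [| lra]. destruct m as [| m]; [lia |]. clear Hm H.
  induction m as [| m IH]; [simpl; lra |]. change (b * b ^ S m < a * a ^ S m).
  assert (0 <= b ^ S m) by now apply pow_le. nra.
Qed.

(** It trades the real exponent [2 / (n (n - 1))] for the natural power [tri n], so that roots do
    not occur in later estimates of [pair_prod]. *)
Lemma nnpow_le_iff (n : nat) (x K : R) : (2 <= n)%nat -> 0 <= x -> 0 <= K ->
  nnpow x (2 / (INR n * INR (n - 1))) <= K <-> x <= K ^ tri n.
Proof.
  intros Hn Hx HK. assert (HN := tri_pos n Hn).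
  assert (N0 : 0 < INR (tri n)) by now apply lt_0_INR.
  assert (E : 2 / (INR n * INR (n - 1)) * INR (tri n) = 1).
  { rewrite INR_tri, minus_INR by lia. simpl. field.
    assert (2 <= INR n) by (apply (le_INR 2); lia). split; lra. }
  unfold nnpow. destruct (Rle_dec x 0) as [L | L].
  - assert (x = 0) by lra. subst x. split; intros _; [now apply pow_le | assumption].
  - set (y := Rpower x (2 / (INR n * INR (n - 1)))).
    assert (Py : 0 < y) by apply Rpower_pos.
    assert (Ey : y ^ tri n = x).
    { rewrite <- Rpower_pow by assumption. unfold y. rewrite Rpower_mult, E.
      apply Rpower_1. lra. }
    rewrite <- Ey. split; intros H.
    + apply pow_incr. lra.
    + now apply (pow_le_reg _ _ (tri n)).
Qed.

(** Nonemptiness and boundedness keep the least upper bound away from both infinities, where [real]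
    would return the default [0]. *)
Definition has_diameter (E : C -> Prop) : Prop :=
  (exists p, E p) /\ exists D, forall p q, E p -> E q -> Cmod (p - q) <= D.

Lemma ndiam_vals_nonneg (n : nat) (E : C -> Prop) (x : R) : ndiam_vals n E x -> 0 <= x.
Proof.
  intros [z [_ ->]]. unfold nnpow. destruct (Rle_dec _ 0); [lra | left; apply Rpower_pos].
Qed.

Lemma ndiam_lub (n : nat) (E : C -> Prop) : (2 <= n)%nat -> has_diameter E ->
  0 <= ndiam n E /\ is_lub_Rbar (ndiam_vals n E) (ndiam n E).
Proof.
  intros Hn [[p Hp] [D HD]]. unfold ndiam. assert (L := Lub_Rbar_correct (ndiam_vals n E)).
  assert (D0 : 0 <= D) by (eapply Rle_trans; [apply (Cmod_ge_0 (p - p)) | now apply HD]).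
  assert (V : ndiam_vals n E (nnpow (pair_prod n (fun _ => p)) (2 / (INR n * INR (n - 1)))))
    by (exists (fun _ => p); auto).
  assert (U : is_ub_Rbar (ndiam_vals n E) D).
  { intros x [z [Hz ->]]. apply nnpow_le_iff; [assumption | apply pair_prod_nonneg | assumption |].
    apply pair_prod_bound. intros i j Hi Hj. apply HD; auto. }
  assert (L1 := proj1 L _ V). assert (L2 := proj2 L _ U). assert (V0 := ndiam_vals_nonneg _ _ _ V).
  destruct (Lub_Rbar (ndiam_vals n E)) as [l | |]; simpl in *; [| contradiction | contradiction].
  split; [lra | exact L].
Qed.

Lemma ndiam_nonneg (n : nat) (E : C -> Prop) : (2 <= n)%nat -> has_diameter E -> 0 <= ndiam n E.
Proof. intros Hn HE. exact (proj1 (ndiam_lub n E Hn HE)). Qed.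

Lemma pair_prod_le_ndiam (n : nat) (E : C -> Prop) (z : nat -> C) : (2 <= n)%nat -> has_diameter E ->
  (forall i, (i < n)%nat -> E (z i)) -> pair_prod n z <= ndiam n E ^ tri n.
Proof.
  intros Hn HE Hz. destruct (ndiam_lub n E Hn HE) as [H0 [H1 _]].
  apply nnpow_le_iff; [assumption | apply pair_prod_nonneg | assumption |].
  apply (H1 (nnpow (pair_prod n z) (2 / (INR n * INR (n - 1))))). now exists z.
Qed.

Lemma ndiam_le (n : nat) (E : C -> Prop) (K : R) : (2 <= n)%nat -> has_diameter E -> 0 <= K ->
  (forall z, (forall i, (i < n)%nat -> E (z i)) -> pair_prod n z <= K ^ tri n) -> ndiam n E <= K.
Proof.
  intros Hn HE HK H. destruct (ndiam_lub n E Hn HE) as [_ [_ H2]].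
  apply (H2 (Finite K)). intros x [z [Hz ->]]. simpl.
  apply nnpow_le_iff; [assumption | apply pair_prod_nonneg | assumption | auto].
Qed.

(** * Monotonicity of the [n]-diameter in [n] *)

Definition skip (i j : nat) : nat := if (j <? i)%nat then j else S j.

Lemma skip_lt (i j : nat) : (j < i)%nat -> skip i j = j.
Proof. intros H. unfold skip. apply Nat.ltb_lt in H. now rewrite H. Qed.

Lemma skip_ge (i j : nat) : (i <= j)%nat -> skip i j = S j.
Proof. intros H. unfold skip. apply Nat.ltb_ge in H. now rewrite H. Qed.

(** [skip i] enumerates the indices other than [i]; every factor is left out once in [n + 1]
    products, so it occurs [n] times. *)
Lemma prod_upto_skip (n : nat) (x : nat -> R) :
  prod_upto (S n) (fun i => prod_upto n (fun j => x (skip i j))) = prod_upto (S n) x ^ n.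
Proof.
  induction n as [| n IH]; [simpl; ring |].
  change (prod_upto (S (S n)) ?g) with (prod_upto (S n) g * g (S n)).
  assert (E1 : prod_upto (S n) (fun i => prod_upto (S n) (fun j => x (skip i j)))
             = prod_upto (S n) (fun i => prod_upto n (fun j => x (skip i j)) * x (S n))).
  { apply prod_upto_ext. intros i Hi. simpl. rewrite (skip_ge i n) by lia. reflexivity. }
  assert (E2 : prod_upto (S n) (fun j => x (skip (S n) j)) = prod_upto (S n) x).
  { apply prod_upto_ext. intros j Hj. now rewrite skip_lt. }
  cbv beta. rewrite E1, E2, prod_upto_mult, IH, prod_upto_const.
  rewrite Rpow_mult_distr. simpl. ring.
Qed.

(** A pair survives the omission of a point unless that point is one of its two members: [m] times
    out of [m + 2]. *)
Lemma pair_prod_skip (m : nat) (z : nat -> C) :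
  prod_upto (S (S m)) (fun i => pair_prod (S m) (fun j => z (skip i j)))
  = pair_prod (S (S m)) z ^ m.
Proof.
  induction m as [| m IH]; [unfold pair_prod; simpl; ring |].
  change (prod_upto (S (S (S m))) ?g) with (prod_upto (S (S m)) g * g (S (S m))).
  set (d := fun j => Cmod (z j - z (S (S m)))).
  assert (E1 : prod_upto (S (S m)) (fun i => pair_prod (S (S m)) (fun j => z (skip i j)))
    = prod_upto (S (S m)) (fun i => pair_prod (S m) (fun j => z (skip i j))
                                     * prod_upto (S m) (fun j => d (skip i j)))).
  { apply prod_upto_ext. intros i Hi. rewrite pair_prod_S. f_equal.
    apply prod_upto_ext. intros j Hj. unfold d. now rewrite (skip_ge i (S m)) by lia. }
  assert (E2 : pair_prod (S (S m)) (fun j => z (skip (S (S m)) j)) = pair_prod (S (S m)) z).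
  { apply pair_prod_ext. intros j Hj. now rewrite skip_lt. }
  cbv beta. rewrite E1, E2, prod_upto_mult, IH, prod_upto_skip.
  rewrite (pair_prod_S (S (S m))). fold d. rewrite Rpow_mult_distr. simpl. ring.
Qed.

(** Fekete's averaging: the product over [n + 1] points is a geometric mean of products over [n] of
    them. The exponents match because [tri (n+1) (n-1) = tri n (n+1)]. *)
Lemma ndiam_decr (n : nat) (E : C -> Prop) : (2 <= n)%nat -> has_diameter E ->
  ndiam (S n) E <= ndiam n E.
Proof.
  intros Hn HE. assert (D0 := ndiam_nonneg n E Hn HE).
  apply ndiam_le; [lia | assumption | assumption |]. intros z Hz.
  destruct n as [| m]; [lia |].
  apply (pow_le_reg _ _ m); [lia | now apply pow_le |].
  rewrite <- pair_prod_skip, <- pow_mult.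
  replace (tri (S (S m)) * m)%nat with (tri (S m) * S (S m))%nat.
  2: { apply INR_eq. rewrite !mult_INR, !INR_tri, !S_INR. lra. }
  rewrite pow_mult. apply prod_upto_le_const. intros i Hi.
  split; [apply pair_prod_nonneg |]. apply pair_prod_le_ndiam; [assumption | assumption |].
  intros j Hj. apply Hz. unfold skip. destruct (j <? i)%nat; lia.
Qed.

Lemma ndiam_tdiam (E : C -> Prop) : has_diameter E ->
  is_lim_seq (fun m => ndiam (m + 2) E) (tdiam E).
Proof.
  intros HE. unfold tdiam. apply Lim_seq_correct'.
  apply (ex_finite_lim_seq_decr _ 0).
  - intros m. apply ndiam_decr; [lia | assumption].
  - intros m. apply ndiam_nonneg; [lia | assumption].
Qed.

Lemma has_diameter_disc (r : R) : 0 < r -> has_diameter (Defs.disc r).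
Proof.
  intros Hr. split.
  - exists (RtoC 0). unfold Defs.disc. rewrite Cmod_0. exact Hr.
  - exists (2 * r). intros p q Hp Hq. unfold Defs.disc in *.
    eapply Rle_trans; [apply Cmod_triangle_minus | lra].
Qed.

Lemma ndiam_disc_scal (n : nat) (r : R) : (2 <= n)%nat -> 0 < r ->
  ndiam n (Defs.disc r) = r * ndiam n (Defs.disc 1).
Proof.
  intros Hn Hr.
  assert (H : forall a b, 0 < a -> 0 < b -> ndiam n (Defs.disc a) <= a / b * ndiam n (Defs.disc b)).
  { intros a b Ha Hb. assert (P : 0 < a / b) by now apply Rdiv_lt_0_compat.
    assert (D0 := ndiam_nonneg n (Defs.disc b) Hn (has_diameter_disc b Hb)).
    apply ndiam_le; [assumption | now apply has_diameter_disc | apply Rmult_le_pos; lra |].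
    intros z Hz. rewrite Rpow_mult_distr.
    assert (Hb0 : RtoC b <> 0) by (intros Q; apply RtoC_inj in Q; lra).
    assert (Ha0 : RtoC a <> 0) by (intros Q; apply RtoC_inj in Q; lra).
    eapply Rle_trans.
    - apply (pair_prod_scal_le n z (fun i => RtoC (b / a) * z i)%C (a / b)); [lra |].
      intros i j _ _.
      replace (RtoC (b / a) * z i - RtoC (b / a) * z j)%C with (RtoC (b / a) * (z i - z j))%C by ring.
      rewrite Cmod_mult, Cmod_R, Rabs_right.
      + right. field. lra.
      + apply Rle_ge, Rlt_le, Rdiv_lt_0_compat; lra.
    - apply Rmult_le_compat_l; [apply pow_le; lra |].
      apply pair_prod_le_ndiam; [assumption | now apply has_diameter_disc |].
      intros i Hi. unfold Defs.disc in *. specialize (Hz i Hi). rewrite Cmod_mult, Cmod_R, Rabs_right.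
      + apply Rlt_le_trans with (b / a * a); [| right; field; lra].
        apply Rmult_lt_compat_l; [now apply Rdiv_lt_0_compat | assumption].
      + apply Rle_ge, Rlt_le, Rdiv_lt_0_compat; lra. }
  assert (H1 := H r 1 Hr Rlt_0_1). assert (H2 := H 1 r Rlt_0_1 Hr).
  apply Rle_antisym; [lra |].
  apply (Rmult_le_compat_l r) in H2; [| lra].
  replace (r * (1 / r * ndiam n (Defs.disc r))) with (ndiam n (Defs.disc r)) in H2 by (field; lra). exact H2.
Qed.

(** * Growth of the [n]-diameter of the image *)

Fixpoint cprod_upto (m : nat) (g : nat -> C) : C :=
  match m with O => RtoC 1 | S m' => (cprod_upto m' g * g m')%C end.

Definition cpair_prod (n : nat) (z : nat -> C) : C :=
  cprod_upto n (fun k => cprod_upto k (fun j => z j - z k)%C).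

Lemma Cmod_cprod_upto (m : nat) (g : nat -> C) :
  Cmod (cprod_upto m g) = prod_upto m (fun i => Cmod (g i)).
Proof. induction m as [| m IH]; simpl; [apply Cmod_1 | now rewrite Cmod_mult, IH]. Qed.

Lemma Cmod_cpair_prod (n : nat) (z : nat -> C) : Cmod (cpair_prod n z) = pair_prod n z.
Proof.
  unfold cpair_prod, pair_prod. rewrite Cmod_cprod_upto. apply prod_upto_ext. intros k _.
  apply Cmod_cprod_upto.
Qed.

Lemma cdiff_cprod_upto (m : nat) (g : nat -> C -> C) (z : C) :
  (forall i, (i < m)%nat -> cdiff (g i) z) -> cdiff (fun w => cprod_upto m (fun i => g i w)) z.
Proof.
  intros H. induction m as [| m IH]; simpl; [apply cdiff_const |].
  apply cdiff_mult; [apply IH; intros; apply H; lia | apply H; lia].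
Qed.

Lemma cdiff_cpair_prod (n : nat) (g : nat -> C -> C) (z : C) :
  (forall i, (i < n)%nat -> cdiff (g i) z) -> cdiff (fun w => cpair_prod n (fun i => g i w)) z.
Proof.
  intros H. apply (cdiff_cprod_upto n (fun k w => cprod_upto k (fun j => g j w - g k w)%C)).
  intros k Hk. apply (cdiff_cprod_upto k (fun j w => g j w - g k w)%C).
  intros j Hj. apply cdiff_minus; apply H; lia.
Qed.

(** Points are matched by a relation [Q] instead of a map, so that tuples can also be pulled back
    along [f], where an image point may have several preimages. *)
Lemma ndiam_lipschitz (n : nat) (E E' : C -> Prop) (Q : C -> C -> Prop) (L : R) :
  (2 <= n)%nat -> has_diameter E -> has_diameter E' -> 0 <= L ->
  (forall p, E p -> exists q, E' q /\ Q p q) ->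
  (forall p q p' q', Q p q -> Q p' q' -> Cmod (p - p') <= L * Cmod (q - q')) ->
  ndiam n E <= L * ndiam n E'.
Proof.
  intros Hn HE HE' HL Hex HQ. assert (D0 := ndiam_nonneg n E' Hn HE').
  apply ndiam_le; [assumption | assumption | now apply Rmult_le_pos |]. intros z Hz.
  destruct (choice (fun i q => (i < n)%nat -> E' q /\ Q (z i) q)) as [w Hw].
  { intros i. destruct (Nat.lt_ge_cases i n) as [Hi | Hi].
    - destruct (Hex (z i) (Hz i Hi)) as [q Hq]. now exists q.
    - exists (RtoC 0). lia. }
  rewrite Rpow_mult_distr. eapply Rle_trans.
  - apply (pair_prod_scal_le n z w L HL). intros i j Hi Hj.
    apply HQ; [now apply Hw | now apply Hw].
  - apply Rmult_le_compat_l; [now apply pow_le |].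
    apply pair_prod_le_ndiam; [assumption | assumption |]. intros i Hi. now apply Hw.
Qed.

Lemma ndiam_subset (n : nat) (E E' : C -> Prop) : (2 <= n)%nat -> has_diameter E ->
  has_diameter E' -> (forall p, E p -> E' p) -> ndiam n E <= ndiam n E'.
Proof.
  intros Hn HE HE' Hs. rewrite <- (Rmult_1_l (ndiam n E')).
  apply (ndiam_lipschitz n E E' (fun p q => p = q)); auto; [lra | |].
  - intros p Hp. exists p. auto.
  - intros p q p' q' -> ->. lra.
Qed.

Section Disc.
Variable f : C -> C.
Hypothesis Hf : forall z, Cmod z < 1 -> cdiff f z.

Lemma bounded_on_closed_disc (r : R) : 0 <= r < 1 ->
  exists M, forall z, Cmod z <= r -> Cmod (f z) <= M.
Proof.
  intros Hr. destruct (extreme_value (fun z => 0 <= Cmod z <= r) (fun z => Cmod (f z))) as [p [_ Hp]].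
  - apply closed_bounded_annulus.
  - exists (RtoC 0). rewrite Cmod_0. lra.
  - intros z Hz. apply ccont_rcont, cdiff_ccont, Hf. lra.
  - exists (Cmod (f p)). intros z Hz. apply Hp. split; [apply Cmod_ge_0 | assumption].
Qed.

Lemma has_diameter_image (r : R) : 0 < r < 1 -> has_diameter (image_disc f r).
Proof.
  intros Hr. split.
  - exists (f 0), (RtoC 0). rewrite Cmod_0. split; [lra | reflexivity].
  - destruct (bounded_on_closed_disc r ltac:(lra)) as [M HM]. exists (2 * M).
    intros p q [z [Hz ->]] [w [Hw ->]].
    eapply Rle_trans; [apply Cmod_triangle_minus |].
    assert (S1 := HM z ltac:(lra)). assert (S2 := HM w ltac:(lra)). lra.
Qed.

Lemma cdiff_dilated_cpair_prod (n : nat) (w : nat -> C) (z : C) :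
  (forall i, (i < n)%nat -> Cmod (w i) <= 1) -> Cmod z < 1 ->
  cdiff (fun s => cpair_prod n (fun i => f (w i * s))%C) z.
Proof.
  intros Hw Hz. apply (cdiff_cpair_prod n (fun i s => f (w i * s)%C)). intros i Hi.
  apply (cdiff_comp f (fun s => w i * s)%C); [apply cdiff_scal, cdiff_id |].
  apply Hf. rewrite Cmod_mult. specialize (Hw i Hi).
  assert (A := Cmod_ge_0 (w i)). assert (B := Cmod_ge_0 z). nra.
Qed.

Lemma dilated_pair_prod_le (n : nat) (r : R) (w : nat -> C) (z : C) : (2 <= n)%nat -> 0 < r < 1 ->
  (forall i, (i < n)%nat -> Cmod (w i * z) < r) ->
  Cmod (cpair_prod n (fun i => f (w i * z)%C)) <= ndiam n (image_disc f r) ^ tri n.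
Proof.
  intros Hn Hr Hw. rewrite Cmod_cpair_prod.
  apply pair_prod_le_ndiam; [assumption | now apply has_diameter_image |].
  intros i Hi. exists (w i * z)%C. auto.
Qed.

Lemma dilated_pair_prod_near_0 (n : nat) (w : nat -> C) :
  (forall i, (i < n)%nat -> Cmod (w i) <= 1) ->
  exists K d, 0 < d /\ forall z, 0 < Cmod z < d ->
    Cmod (cpair_prod n (fun i => f (w i * z)%C)) <= K * Cmod z ^ tri n.
Proof.
  intros Hw. destruct (cdiff_lipschitz_at f 0) as [K [d [HK [Hd H1]]]].
  { apply Hf. rewrite Cmod_0. lra. }
  exists ((2 * K) ^ tri n), d. split; [assumption |]. intros z Hz.
  rewrite Cmod_cpair_prod, <- Rpow_mult_distr. apply pair_prod_bound.
  assert (H2 : forall i, (i < n)%nat -> Cmod (f (w i * z) - f 0) <= K * Cmod z).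
  { intros i Hi. specialize (Hw i Hi).
    assert (Q : Cmod (w i * z) <= Cmod z).
    { rewrite Cmod_mult. assert (A := Cmod_ge_0 (w i)). nra. }
    eapply Rle_trans; [apply H1; replace (w i * z - 0)%C with (w i * z)%C by ring; lra |].
    replace (w i * z - 0)%C with (w i * z)%C by ring. apply Rmult_le_compat_l; lra. }
  intros i j Hi Hj.
  replace (f (w i * z) - f (w j * z))%C with ((f (w i * z) - f 0) - (f (w j * z) - f 0))%C by ring.
  eapply Rle_trans; [apply Cmod_triangle_minus |].
  assert (A := H2 i Hi). assert (B := H2 j Hj). lra.
Qed.

Lemma dilate_tuple (n : nat) (r : R) (z : nat -> C) : 0 < r ->
  (forall i, (i < n)%nat -> image_disc f r (z i)) ->
  exists w, (forall i, (i < n)%nat -> Cmod (w i) < 1) /\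
    forall i, (i < n)%nat -> z i = f (w i * r)%C.
Proof.
  intros Hr Hz.
  destruct (choice (fun i q => (i < n)%nat -> Cmod q < 1 /\ z i = f (q * r)%C)) as [w Hw].
  { intros i. destruct (Nat.lt_ge_cases i n) as [Hi | Hi]; [| exists (RtoC 0); lia].
    destruct (Hz i Hi) as [p [Hp E]].
    assert (Nr : RtoC r <> 0) by (intros Q; apply RtoC_inj in Q; lra).
    exists (p / r)%C. intros _. split.
    - rewrite Cmod_div, Cmod_R, Rabs_right by (assumption || lra). apply Rlt_div_l; lra.
    - rewrite E. f_equal. field. assumption. }
  exists w. split; intros i Hi; now apply Hw.
Qed.

(** The diameters are replaced by positive upper bounds [A1], [A2], since a constant [f] has
    diameter zero and [ln] needs positive arguments. *)
Lemma ndiam_image_log_convex_aux (n : nat) (t1 t2 l A1 A2 : R) : (2 <= n)%nat ->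
  t1 < t2 -> t2 < 0 -> 0 <= l <= 1 -> 0 < A1 -> 0 < A2 ->
  ndiam n (image_disc f (exp t1)) <= A1 -> ndiam n (image_disc f (exp t2)) <= A2 ->
  ndiam n (image_disc f (exp (l * t1 + (1 - l) * t2))) <= exp (l * ln A1 + (1 - l) * ln A2).
Proof.
  intros Hn Ht Ht2 Hl PA1 PA2 HA1 HA2. set (t := l * t1 + (1 - l) * t2).
  assert (E1 : 0 < exp t1) by apply exp_pos. assert (E2 : 0 < exp t2) by apply exp_pos.
  assert (E : 0 < exp t) by apply exp_pos.
  assert (T1 : t1 <= t) by (unfold t; nra). assert (T2 : t <= t2) by (unfold t; nra).
  assert (X12 : exp t1 < exp t2) by now apply exp_increasing.
  assert (X2 : exp t2 < 1) by (rewrite <- exp_0; now apply exp_increasing).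
  assert (X1t : exp t1 <= exp t) by now apply exp_le_compat.
  assert (Xt2 : exp t <= exp t2) by now apply exp_le_compat.
  apply ndiam_le; [assumption | apply has_diameter_image; lra | left; apply exp_pos |].
  intros z Hz. destruct (dilate_tuple n (exp t) z E Hz) as [w [Hw Hzw]].
  set (F := fun s => cpair_prod n (fun i => f (w i * s)%C)).
  set (N := INR (tri n)).
  (* The exponent for which the bounds on the two boundary circles are the same number [exp b]. *)
  set (alpha := N * (ln A2 - ln A1) / (t1 - t2)).
  set (b := N * ln A1 + alpha * t1).
  assert (Eb : b = N * ln A2 + alpha * t2) by (unfold b, alpha; field; lra).
  assert (Pw : forall A, 0 < A -> A ^ tri n = exp (N * ln A))
    by (intros A PA; rewrite <- Rpower_pow by assumption; reflexivity).
  assert (Hcirc : forall u A, exp t1 <= exp u -> exp u <= exp t2 -> 0 < A ->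
     ndiam n (image_disc f (exp u)) <= A -> forall s, Cmod s = exp u ->
     Cmod (F s) * Rpower (Cmod s) alpha <= exp (N * ln A + alpha * u)).
  { intros u A U1 U2 PA HA s Hs. unfold Rpower. rewrite Hs, ln_exp, exp_plus.
    apply Rmult_le_compat_r; [left; apply exp_pos |]. rewrite <- Pw by assumption.
    eapply Rle_trans.
    - apply (dilated_pair_prod_le n (exp u) w s Hn); [lra |]. intros i Hi.
      rewrite Cmod_mult, Hs. specialize (Hw i Hi). nra.
    - apply pow_incr. split; [apply ndiam_nonneg; [assumption | apply has_diameter_image; lra] |].
      assumption. }
  assert (K := three_circles F 1 (exp t1) (exp t2) alpha (exp b) E1 X2 ltac:(left; apply exp_pos)).
  assert (K' : Cmod (F (RtoC (exp t))) * Rpower (Cmod (exp t)) alpha <= exp b).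
  { apply K.
    - intros s Hs. apply cdiff_dilated_cpair_prod; [| lra]. intros i Hi. left. auto.
    - intros s [Hs | Hs].
      + unfold b. apply (Hcirc t1 A1); auto; lra.
      + rewrite Eb. apply (Hcirc t2 A2); auto; lra.
    - rewrite Cmod_R, Rabs_right by lra. lra. }
  rewrite Cmod_R, Rabs_right in K' by lra. unfold Rpower in K'. rewrite ln_exp in K'.
  unfold F in K'. rewrite Cmod_cpair_prod in K'.
  rewrite (pair_prod_ext n z (fun i => f (w i * exp t)%C) Hzw).
  apply (Rmult_le_reg_r (exp (alpha * t))); [apply exp_pos |].
  eapply Rle_trans; [exact K' |]. rewrite Pw by apply exp_pos. rewrite ln_exp, <- exp_plus.
  right. f_equal.
  replace b with (l * b + (1 - l) * b) by ring. rewrite Eb at 2. unfold b, t. ring.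
Qed.

Lemma exp_convex (x y l : R) : 0 <= l <= 1 -> exp (l * x + (1 - l) * y) <= l * exp x + (1 - l) * exp y.
Proof.
  intros Hl. set (m := l * x + (1 - l) * y).
  assert (H : forall u, exp m * (1 + (u - m)) <= exp u).
  { intros u. replace (exp u) with (exp m * exp (u - m)) by (rewrite <- exp_plus; f_equal; ring).
    apply Rmult_le_compat_l; [left; apply exp_pos | apply exp_ineq1_le]. }
  assert (H1 := H x). assert (H2 := H y).
  assert (E : exp m = l * (exp m * (1 + (x - m))) + (1 - l) * (exp m * (1 + (y - m))))
    by (unfold m at 3 5; ring).
  nra.
Qed.

Lemma ndiam_ratio_convex (n : nat) (t1 t2 l : R) : (2 <= n)%nat ->
  t1 < 0 -> t2 < 0 -> 0 <= l <= 1 ->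
  ndiam n (image_disc f (exp (l * t1 + (1 - l) * t2))) / exp (l * t1 + (1 - l) * t2)
  <= l * (ndiam n (image_disc f (exp t1)) / exp t1)
     + (1 - l) * (ndiam n (image_disc f (exp t2)) / exp t2).
Proof.
  intros Hn.
  assert (Hlt : forall t1 t2 l, t1 < t2 -> t2 < 0 -> 0 <= l <= 1 ->
    ndiam n (image_disc f (exp (l * t1 + (1 - l) * t2))) / exp (l * t1 + (1 - l) * t2)
    <= l * (ndiam n (image_disc f (exp t1)) / exp t1)
       + (1 - l) * (ndiam n (image_disc f (exp t2)) / exp t2)).
  { clear t1 t2 l. intros t1 t2 l H12 H2 Hl.
    assert (I : forall u, u < 0 -> 0 < exp u < 1).
    { intros u Hu. split; [apply exp_pos |]. rewrite <- exp_0. now apply exp_increasing. }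
    assert (D1 := ndiam_nonneg n _ Hn (has_diameter_image _ (I t1 ltac:(lra)))).
    assert (D2 := ndiam_nonneg n _ Hn (has_diameter_image _ (I t2 H2))).
    set (d1 := ndiam n (image_disc f (exp t1))) in *.
    set (d2 := ndiam n (image_disc f (exp t2))) in *.
    assert (P1 := exp_pos t1). assert (P2 := exp_pos t2).
    set (q1 := / exp t1). set (q2 := / exp t2).
    assert (Q1 : 0 < q1) by now apply Rinv_0_lt_compat.
    assert (Q2 : 0 < q2) by now apply Rinv_0_lt_compat.
    apply le_epsilon. intros eps He.
    (* Raising both diameters by [eta] makes them positive and raises the right-hand side by at most
       [eta (q1 + q2) = eps]. *)
    set (eta := eps / (q1 + q2)). assert (Heta : 0 < eta) by (apply Rdiv_lt_0_compat; lra).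
    assert (K := ndiam_image_log_convex_aux n t1 t2 l (d1 + eta) (d2 + eta) Hn H12 H2 Hl
      ltac:(lra) ltac:(lra) ltac:(fold d1; lra) ltac:(fold d2; lra)).
    set (t := l * t1 + (1 - l) * t2) in *.
    assert (X := exp_convex (ln (d1 + eta) - t1) (ln (d2 + eta) - t2) l Hl).
    replace (l * (ln (d1 + eta) - t1) + (1 - l) * (ln (d2 + eta) - t2))
      with (l * ln (d1 + eta) + (1 - l) * ln (d2 + eta) + - t) in X by (unfold t; ring).
    unfold Rminus in X at 2 4. rewrite !exp_plus, !exp_ln, !exp_Ropp in X by lra.
    fold q1 q2 in X. unfold Rdiv. fold q1 q2.
    assert (Qt : 0 < / exp t) by apply Rinv_0_lt_compat, exp_pos.
    assert (Y : ndiam n (image_disc f (exp t)) * / exp t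
              <= exp (l * ln (d1 + eta) + (1 - l) * ln (d2 + eta)) * / exp t)
      by (apply Rmult_le_compat_r; lra).
    rewrite exp_plus in Y.
    assert (Z : l * ((d1 + eta) * q1) + (1 - l) * ((d2 + eta) * q2)
                <= l * (d1 * q1) + (1 - l) * (d2 * q2) + eps).
    { assert (Ee : eps = eta * (q1 + q2)) by (unfold eta; field; lra).
      rewrite Ee.
      assert (0 < eta * q1) by now apply Rmult_lt_0_compat.
      assert (0 < eta * q2) by now apply Rmult_lt_0_compat. nra. }
    lra. }
  intros H1 H2 Hl. destruct (Rtotal_order t1 t2) as [H | [-> | H]].
  - now apply Hlt.
  - replace (l * t2 + (1 - l) * t2) with t2 by ring. right. ring.
  - assert (K := Hlt t2 t1 (1 - l) H H1 ltac:(lra)).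
    replace (1 - (1 - l)) with l in K by ring.
    replace (l * t1 + (1 - l) * t2) with ((1 - l) * t2 + l * t1) by ring. lra.
Qed.

Lemma ndiam_ratio_increasing (n : nat) (r1 r2 : R) : (2 <= n)%nat ->
  0 < r1 -> r1 <= r2 -> r2 < 1 ->
  ndiam n (image_disc f r1) / r1 <= ndiam n (image_disc f r2) / r2.
Proof.
  intros Hn H1 H12 H2. set (d2 := ndiam n (image_disc f r2)).
  assert (D2 : 0 <= d2) by (apply ndiam_nonneg; [assumption | apply has_diameter_image; lra]).
  apply Rle_div_l; [assumption |].
  assert (P : 0 <= d2 / r2) by (apply Rdiv_le_0_compat; lra).
  apply ndiam_le; [assumption | apply has_diameter_image; lra | apply Rmult_le_pos; lra |].
  intros z Hz. destruct (dilate_tuple n r1 z H1 Hz) as [w [Hw Hzw]].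
  rewrite (pair_prod_ext n z _ Hzw), <- Cmod_cpair_prod.
  assert (Hw' : forall i, (i < n)%nat -> Cmod (w i) <= 1) by (intros i Hi; left; auto).
  destruct (dilated_pair_prod_near_0 n w Hw') as [K [d [Hd Hnear]]].
  assert (Nr1 : RtoC r1 <> 0) by (intros Q; apply RtoC_inj in Q; lra).
  assert (M : Cmod (cpair_prod n (fun i => f (w i * r1)%C) / r1 ^ tri n) <= (d2 / r2) ^ tri n).
  { apply (max_principle_punctured (fun s => cpair_prod n (fun i => f (w i * s)%C) / s ^ tri n)%C
             r2 _ 0 0); try (rewrite Cmod_0; lra).
    - now apply pow_le.
    - intros s S1 S2 _. apply cdiff_div_pow; [| assumption].
      apply cdiff_dilated_cpair_prod; [assumption | lra].
    - now apply (bounded_near_div_pow _ _ K d).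
    - now apply (bounded_near_div_pow _ _ K d).
    - intros s Hs. assert (Ns : s <> 0) by (apply Cmod_gt_0; lra).
      rewrite Cmod_div, Cmod_pow, Hs by now apply Cpow_nz.
      unfold Rdiv at 2. rewrite Rpow_mult_distr, pow_inv.
      apply Rmult_le_compat_r; [left; apply Rinv_0_lt_compat, pow_lt; lra |].
      apply dilated_pair_prod_le; [assumption | lra |]. intros i Hi. rewrite Cmod_mult, Hs.
      specialize (Hw i Hi). nra.
    - rewrite Cmod_R, Rabs_right; lra.
    - assumption.
    - assumption. }
  rewrite Cmod_div, Cmod_pow, Cmod_R, Rabs_right in M by (lra || now apply Cpow_nz).
  rewrite Rpow_mult_distr. apply Rle_div_l in M; [assumption | now apply pow_lt].
Qed.

(** Strict differentiability makes [f] near [0] stretch distances by factors between [|a1| - eta]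
    and [|a1| + eta]. The radius [d] does not depend on [n], so the bounds pass to the capacity. *)
Lemma ndiam_image_near_0 (a1 : C) (eta : R) : cderiv f 0 a1 -> 0 < eta ->
  exists d, 0 < d <= 1 /\ forall n r, (2 <= n)%nat -> 0 < r < d ->
    (Cmod a1 - eta) * ndiam n (Defs.disc r) <= ndiam n (image_disc f r)
      <= (Cmod a1 + eta) * ndiam n (Defs.disc r).
Proof.
  intros Ha Heta.
  destruct (strictly_differentiable_at_0 f 1 a1 Rlt_0_1 Hf Ha eta Heta) as [d [Hd H1]].
  exists (Rmin d 1). assert (M1 := Rmin_l d 1). assert (M2 := Rmin_r d 1).
  split; [split; [apply Rmin_glb_lt; lra | assumption] |]. intros n r Hn Hr.
  assert (HE : has_diameter (image_disc f r)) by (apply has_diameter_image; lra).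
  assert (HD : has_diameter (Defs.disc r)) by (apply has_diameter_disc; lra).
  assert (D0 := ndiam_nonneg n _ Hn HE). assert (D1 := ndiam_nonneg n _ Hn HD).
  assert (A0 := Cmod_ge_0 a1).
  split.
  - destruct (Rle_lt_dec (Cmod a1) eta) as [Hs | Hs]; [nra |].
    assert (P : 0 < Cmod a1 - eta) by lra.
    assert (K : ndiam n (Defs.disc r) <= / (Cmod a1 - eta) * ndiam n (image_disc f r)).
    { apply (ndiam_lipschitz n _ _ (fun p q => Cmod p < r /\ q = f p)); auto.
      - left. now apply Rinv_0_lt_compat.
      - intros p Hp. exists (f p). split; [exists p; auto | auto].
      - intros p q p' q' [B1 ->] [B2 ->]. specialize (H1 p p' ltac:(lra) ltac:(lra)).
        assert (T := Cmod_triangle_rev (a1 * (p - p')) (f p - f p')).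
        rewrite (Cmod_minus_sym (a1 * (p - p'))), Cmod_mult in T.
        apply (Rmult_le_reg_l (Cmod a1 - eta)); [assumption |].
        rewrite <- Rmult_assoc, Rinv_r, Rmult_1_l by lra. lra. }
    apply (Rmult_le_compat_l (Cmod a1 - eta)) in K; [| lra].
    rewrite <- Rmult_assoc, Rinv_r, Rmult_1_l in K by lra. exact K.
  - apply (ndiam_lipschitz n _ _ (fun p q => Cmod q < r /\ p = f q)); auto.
    + lra.
    + intros p [z [Hz ->]]. exists z. auto.
    + intros p q p' q' [B1 ->] [B2 ->]. specialize (H1 q q' ltac:(lra) ltac:(lra)).
      assert (T := Cmod_triangle_rev (f q - f q') (a1 * (q - q'))).
      rewrite Cmod_mult in T. lra.
Qed.

(** The ratio is almost at least [|a1|] times its value for the disc at a tiny radius [s], and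
    monotonicity carries this from [s] to [r]. *)
Lemma ndiam_image_ge_derivative (n : nat) (r : R) (a1 : C) : (2 <= n)%nat -> 0 < r < 1 ->
  cderiv f 0 a1 -> Cmod a1 * r * ndiam n (Defs.disc 1) <= ndiam n (image_disc f r).
Proof.
  intros Hn Hr Ha. set (c := ndiam n (Defs.disc 1)).
  assert (C0 : 0 <= c) by (apply ndiam_nonneg; [assumption | apply has_diameter_disc; lra]).
  apply le_epsilon. intros eps He.
  set (eta := eps / (r * c + 1)).
  assert (Prc : 0 <= r * c) by (apply Rmult_le_pos; lra).
  assert (Heta : 0 < eta) by (apply Rdiv_lt_0_compat; lra).
  destruct (ndiam_image_near_0 a1 eta Ha Heta) as [d [Hd H1]].
  set (s := Rmin (d / 2) r).
  assert (S0 : 0 < s) by (apply Rmin_glb_lt; lra).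
  assert (S1 : s <= d / 2) by apply Rmin_l. assert (S2 : s <= r) by apply Rmin_r.
  destruct (H1 n s Hn ltac:(lra)) as [H2 _]. rewrite ndiam_disc_scal in H2 by assumption.
  assert (H3 := ndiam_ratio_increasing n s r Hn S0 S2 ltac:(lra)).
  apply Rle_div_r in H3; [| lra].
  assert (H4 : (Cmod a1 - eta) * c <= ndiam n (image_disc f s) / s).
  { apply (Rle_div_r _ _ s); [assumption |]. unfold c. lra. }
  assert (H5 : (Cmod a1 - eta) * c * r <= ndiam n (image_disc f r)).
  { eapply Rle_trans; [| exact H3]. apply Rmult_le_compat_r; lra. }
  assert (H6 : eta * (r * c) <= eps).
  { replace eps with (eta * (r * c + 1)) by (unfold eta; field; lra).
    apply Rmult_le_compat_l; lra. }
  lra.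
Qed.
End Disc.

Lemma constant_of_not_strictly_increasing (phi : R -> R) :
  increasing_01 phi -> log_convex_01 phi -> ~ strictly_increasing_01 phi ->
  exists r0, 0 < r0 < 1 /\ forall r, 0 < r <= r0 -> phi r = phi r0.
Proof.
  intros Hi Hc Hns.
  assert (Hex : exists r1 r2, 0 < r1 /\ r1 < r2 /\ r2 < 1 /\ phi r2 <= phi r1).
  { apply NNPP. intros Hno. apply Hns. intros r1 r2 A B D. apply Rnot_le_lt. intros Q.
    apply Hno. now exists r1, r2. }
  destruct Hex as [r1 [r2 [A [B [D Hle]]]]]. exists r1. split; [lra |].
  intros r [Hr [Hr1 | ->]]; [| reflexivity].
  apply Rle_antisym; [apply Hi; lra |].
  assert (L1 : ln r < ln r1) by now apply ln_increasing.
  assert (L2 : ln r1 < ln r2) by now apply ln_increasing.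
  assert (L3 : ln r2 < 0) by (rewrite <- ln_1; apply ln_increasing; lra).
  (* The weight that writes [ln r1] as a convex combination of [ln r] and [ln r2]. With equal values
     at [r1] and [r2], convexity forbids a smaller value at [r]. *)
  set (l := (ln r2 - ln r1) / (ln r2 - ln r)).
  assert (Hl : 0 < l <= 1).
  { split; [apply Rdiv_lt_0_compat; lra |]. apply Rle_div_l; lra. }
  assert (K := Hc (ln r) (ln r2) l ltac:(lra) L3 ltac:(lra)).
  replace (l * ln r + (1 - l) * ln r2) with (ln r1) in K by (unfold l; field; lra).
  rewrite !exp_ln in K by lra.
  assert (K2 : phi r1 <= phi r2) by (apply Hi; lra). nra.
Qed.

(** * The Vandermonde determinant on the unit circle *)

Fixpoint csum_upto (m : nat) (g : nat -> C) : C :=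
  match m with O => RtoC 0 | S m' => (csum_upto m' g + g m')%C end.

Module VandermondeBound.
Import all_boot all_order all_algebra Rstruct complex.
Import GRing.Theory Num.Theory Order.TTheory.
Local Open Scope ring_scope.
Local Open Scope sesquilinear_scope.

Lemma dotmx_sum (C : numClosedFieldType) (n : nat) (u v : 'rV[C]_n) :
  dotmx u v = \sum_k u 0 k * (v 0 k)^*.
Proof. by rewrite dotmxE !mxE; apply: eq_bigr => k _; rewrite !mxE. Qed.

(** Gram-Schmidt gives a unitary [U] for which [T = A U^*] is lower triangular. So [|det A|] is the
    product of the [|T i i|], and each of these, the scalar product of row [i] of [A] with a unit
    vector, is bounded by Cauchy-Schwarz. *)
Lemma hadamard (C : numClosedFieldType) (n : nat) (A : 'M[C]_n) :
  `|\det A| ^+ 2 <= \prod_i dotmx (row i A) (row i A).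
Proof.
pose U := schmidt A; have Uu : U \is unitarymx by apply: schmidt_unitarymx.
have /unitarymxP UU := Uu.
have detU : `|\det U| ^+ 2 = 1.
  by rewrite normCK -det_map_mx -[X in _ * X]det_tr map_trmx -det_mulmx UU det1.
pose T := A *m U^t*.
have TE i k : T i k = dotmx (row i A) (row k U).
  by rewrite dotmx_sum !mxE; apply: eq_bigr => l _; rewrite !mxE.
have Ttrig : is_trig_mx T.
  apply/is_trig_mxP => i j ltij; rewrite TE.
  (* Row [i] of [A] lies in the span of the rows of [U] up to index [i], all orthogonal to row [j]
     for [j > i]. *)
  have /sub_kermxP E : (row i A <= kermx ((row j U)^t*))%MS.
    apply: submx_trans (row_schmidt_sub A i) _; apply/sumsmx_subP => k leki.
    rewrite genmxE; apply/sub_kermxP/matrixP => p q; rewrite !ord1 [RHS]mxE.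
    have /row_unitarymxP UR := Uu; rewrite -dotmxE UR.
    by case: eqP leki => // ->; rewrite leqNgt ltij.
  by rewrite dotmxE E mxE.
have -> : `|\det A| ^+ 2 = `|\det T| ^+ 2.
  by rewrite /T det_mulmx normrM exprMn [X in _ * X](_ : _ = 1) ?mulr1 // det_map_mx det_tr norm_conjC.
rewrite det_trig // normr_prod -prodrXl; apply: ler_prod => i _.
rewrite exprn_ge0 //= TE.
have U1 : dotmx (row i U) (row i U) = 1 by move/row_unitarymxP: Uu => ->; rewrite eqxx.
rewrite -[dotmx (row i A) (row i A)]mulr1 -U1.
by have [H _] := CauchySchwarz (@dotmx C n : {dot 'rV[C]_n for Num.conj}) (row i A) (row i U).
Qed.

(** Each row consists of [n] powers of modulus at most [1], so its squared norm is at most [n]. *)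
Lemma vandermonde_le (C : numClosedFieldType) (n : nat) (a : 'rV[C]_n) :
  (forall i, `|a 0 i| <= 1) -> `|\det (Vandermonde n a)| ^+ 2 <= n%:R ^+ n.
Proof.
move=> Ha; apply: le_trans (hadamard C n _) _.
have -> : n%:R ^+ n = \prod_(i < n) (n%:R : C) by rewrite prodr_const card_ord.
apply: ler_prod => i _; rewrite dotmx_sum.
have P j : 0 <= (row i (Vandermonde n a)) 0 j * ((row i (Vandermonde n a)) 0 j)^*.
  exact: mul_conjC_ge0.
rewrite sumr_ge0 //=.
have -> : n%:R = \sum_(j < n) (1 : C) by rewrite sumr_const card_ord.
apply: ler_sum => j _; rewrite !mxE -normCK normrX -exprM.
exact: exprn_ile1.
Qed.

(** The rows are orthogonal: off the diagonal, [V V^*] contains geometric sums of an [n]-th root of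
    unity other than [1]. Hence [V V^* = n I], and Hadamard's bound is attained. *)
Lemma vandermonde_primitive_root (C : numClosedFieldType) (n : nat) (w : C) :
  n.-primitive_root w -> `|w| = 1 ->
  `|\det (Vandermonde n (\row_(i < n) w ^+ i))| ^+ 2 = n%:R ^+ n.
Proof.
move=> Hw Hw1; set V := Vandermonde n _.
have w0 : w != 0 by rewrite -normr_eq0 Hw1 oner_eq0.
have E : V *m V ^t* = (n%:R)%:M.
  apply/matrixP => i j; rewrite !mxE.
  have -> : \sum_k V i k * (V ^t* ) k j = \sum_(k < n) (w ^+ i / w ^+ j) ^+ k.
    apply: eq_bigr => k _; rewrite !mxE rmorphXn /= rmorphXn /=.
    have -> : w^* = w^-1 by rewrite invC_norm Hw1 expr1n invr1 mul1r.
    by rewrite -!exprM mulnC exprMn -exprM -exprVn -exprM mulnC [(_ * k)%N]mulnC.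
  have [->|neq] := eqVneq i j.
    rewrite divff ?expf_neq0 // mulr1n.
    under eq_bigr => k _ do rewrite expr1n.
    by rewrite sumr_const card_ord.
  rewrite mulr0n; set q := w ^+ i / w ^+ j.
  have q1 : q != 1.
    apply: contra neq => /eqP /(canRL (mulfVK (expf_neq0 _ w0))); rewrite mul1r => /eqP.
    by rewrite (eq_prim_root_expr Hw) !modn_small ?ltn_ord.
  have /eqP := subrX1 q n.
  have -> : q ^+ n = 1.
    by rewrite exprMn exprVn -!exprM ![(_ * n)%N]mulnC !exprM (prim_expr_order Hw) !expr1n divr1.
  by rewrite subrr eq_sym mulf_eq0 subr_eq0 (negPf q1) => /eqP.
have := congr1 determinant E; rewrite det_mulmx det_scalar => <-.
by rewrite normCK -det_map_mx -[X in _ * X = _]det_tr map_trmx.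
Qed.


Definition toC (z : Coquelicot.Complex.C) : R[i] := Complex z.1 z.2.

Lemma toC_sub (z w : Coquelicot.Complex.C) : toC (Cminus z w) = toC z - toC w.
Proof. by []. Qed.

Lemma toC_mul (z w : Coquelicot.Complex.C) : toC (Cmult z w) = toC z * toC w.
Proof. by []. Qed.

Lemma toC_pow (z : Coquelicot.Complex.C) (k : nat) : toC (Cpow z k) = toC z ^+ k.
Proof. by elim: k => [|k IH] //=; rewrite toC_mul IH exprS. Qed.

Lemma norm_toC (z : Coquelicot.Complex.C) : `|toC z| = (Cmod z)%:C%C.
Proof. by rewrite normc_def /Cmod RsqrtE !RealsE. Qed.

Lemma prod_uptoE (m : nat) (g : nat -> R) : prod_upto m g = \prod_(i < m) g i.
Proof. by elim: m => [|m IH]; rewrite ?big_ord0 // big_ord_recr /= IH. Qed.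

Lemma pair_prod_det (n : nat) (z : nat -> Coquelicot.Complex.C) :
  (pair_prod n z)%:C%C = `|\det (Vandermonde n (\row_(i < n) toC (z i)))|.
Proof.
rewrite det_Vandermonde (exchange_big_dep xpredT) //= normr_prod /pair_prod prod_uptoE rmorph_prod.
apply: eq_bigr => k _; rewrite prod_uptoE rmorph_prod normr_prod.
rewrite (big_ord_widen n (fun i => (Cmod (Cminus (z i) (z k)))%:C%C)) ?(ltnW (ltn_ord k)) //.
by apply: eq_bigr => j _; rewrite !mxE -toC_sub norm_toC -Cmod_opp Copp_minus_distr.
Qed.

Lemma pair_prod_unit_disc (n : nat) (z : nat -> Coquelicot.Complex.C) :
  (forall i, Peano.lt i n -> Rle (Cmod (z i)) 1) -> Rle (pow (pair_prod n z) 2) (pow (INR n) n).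
Proof.
move=> Hz; apply/RleP; rewrite !RealsE -lecR !rmorphXn /= pair_prod_det rmorph_nat.
apply: vandermonde_le => i; rewrite mxE norm_toC -(rmorph1 (real_complex R)) lecR.
by apply/RleP/Hz/ssrnat.ltP.
Qed.

Lemma primitive_root_toC (n : nat) (w : Coquelicot.Complex.C) : Peano.lt 0 n ->
  Cpow w n = RtoC 1 -> (forall k, Peano.lt 0 k -> Peano.lt k n -> Cpow w k <> RtoC 1) ->
  n.-primitive_root (toC w).
Proof.
move=> /ssrnat.ltP n0 Hwn Hwk.
rewrite /primitive_root_of_unity n0 /=; apply/forallP => i; apply/eqP.
rewrite unity_rootE -toC_pow; have [->|ne] := eqVneq i.+1 n.
  by rewrite Hwn; apply/eqP.
apply/eqP => E; apply: (Hwk i.+1); [exact/ssrnat.ltP| |].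
  by apply/ssrnat.ltP; rewrite ltn_neqAle ne ltn_ord.
by case: (Cpow w i.+1) E => x y [-> ->].
Qed.

Lemma pair_prod_roots_of_unity (n : nat) (w : Coquelicot.Complex.C) : Peano.lt 0 n ->
  Cmod w = 1 -> Cpow w n = RtoC 1 -> (forall k, Peano.lt 0 k -> Peano.lt k n -> Cpow w k <> RtoC 1) ->
  pow (pair_prod n (fun i => Cpow w i)) 2 = pow (INR n) n.
Proof.
move=> n0 Hw Hwn Hwk.
apply: (@complexI R); rewrite !RealsE !rmorphXn /= pair_prod_det rmorph_nat.
rewrite (_ : \row_i _ = \row_(i < n) (toC w) ^+ i); last first.
  by apply/rowP => i; rewrite !mxE toC_pow.
by apply: vandermonde_primitive_root; [exact: primitive_root_toC | rewrite norm_toC Hw].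
Qed.

(** The factor [X - 1] is cancelled from [X^(p+1) - 1] as a polynomial, so evaluation at [x = 1] is
    included. *)
Lemma prod_sub_roots_of_unity (F : fieldType) (p : nat) (w x : F) : p.+1.-primitive_root w ->
  \prod_(j < p) (x - w ^+ j.+1) = \sum_(j < p.+1) x ^+ j.
Proof.
move=> Hw; have := factor_Xn_sub_1 Hw; rewrite big_nat_recl // expr0 big_mkord subrX1 polyC1.
move/(mulfI (negbT (polyXsubC_eq0 1))) => /(congr1 (horner^~ x)).
rewrite horner_prod horner_sum => E.
under eq_bigr => j _ do rewrite -hornerXsubC.
rewrite E.
by apply: eq_bigr => j _; rewrite hornerXn.
Qed.

Lemma toC_csum_upto (m : nat) (g : nat -> Coquelicot.Complex.C) :
  toC (csum_upto m g) = \sum_(i < m) toC (g i).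
Proof. by elim: m => [|m IH]; rewrite ?big_ord0 // big_ord_recr /= -IH. Qed.

Lemma prod_upto_sub_roots_of_unity (p : nat) (w x : Coquelicot.Complex.C) :
  Cpow w (S p) = RtoC 1 ->
  (forall k, Peano.lt 0 k -> Peano.lt k (S p) -> Cpow w k <> RtoC 1) ->
  prod_upto p (fun j => Cmod (Cminus (Cpow w (S j)) x)) = Cmod (csum_upto (S p) (fun j => Cpow x j)).
Proof.
move=> Hwn Hwk.
have Hp : p.+1.-primitive_root (toC w) by apply: primitive_root_toC => //; exact/ssrnat.ltP.
apply: (@complexI R); rewrite -norm_toC toC_csum_upto prod_uptoE rmorph_prod.
under [in RHS]eq_bigr => j _ do rewrite toC_pow.
rewrite -(prod_sub_roots_of_unity _ _ _ (toC x) Hp) normr_prod; apply: eq_bigr => j _.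
by rewrite -toC_pow -toC_sub norm_toC -Cmod_opp Copp_minus_distr.
Qed.
End VandermondeBound.

(** * Second coefficients *)

Lemma cexp_pow (s : C) (k : nat) : (cexp s ^ k)%C = cexp (INR k * s)%C.
Proof.
  induction k as [| k IH].
  - simpl. rewrite Cmult_0_l, cexp_0. reflexivity.
  - rewrite Cpow_S, IH, <- cexp_plus. f_equal. rewrite S_INR, RtoC_plus. ring.
Qed.

Lemma exists_primitive_root (n : nat) : (0 < n)%nat -> exists w : C,
  Cmod w = 1 /\ (w ^ n)%C = RtoC 1 /\ forall k, (0 < k)%nat -> (k < n)%nat -> (w ^ k)%C <> RtoC 1.
Proof.
  intros Hn. assert (N0 : 0 < INR n) by now apply lt_0_INR.
  set (th := 2 * PI / INR n).
  assert (E : forall k, (cexp (0, th) ^ k)%C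
      = (cos (2 * (INR k * PI / INR n)), sin (2 * (INR k * PI / INR n))) :> C).
  { intros k. rewrite cexp_pow. unfold cexp, Cmult, RtoC; simpl.
    replace (INR k * 0 - 0 * th) with 0 by ring. rewrite exp_0.
    f_equal; rewrite Rmult_1_l; f_equal; unfold th; field; lra. }
  exists (cexp (0, th)). split; [rewrite Cmod_cexp; apply exp_0 |]. split.
  - rewrite E. replace (2 * (INR n * PI / INR n)) with (2 * PI) by (field; lra).
    rewrite cos_2PI, sin_2PI. reflexivity.
  - intros k K0 Kn Q. rewrite E in Q. apply (f_equal fst) in Q. simpl in Q.
    (* [w^k = 1] would force the sine of the half angle [k PI / n] to vanish, but this angle lies
       strictly between [0] and [PI]. *)
    rewrite cos_2a_sin in Q.
    assert (S : 0 < sin (INR k * PI / INR n)); [| nra].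
    assert (P := PI_RGT_0). apply lt_0_INR in K0. apply lt_INR in Kn.
    apply sin_gt_0.
    + apply Rdiv_lt_0_compat; [apply Rmult_lt_0_compat; lra | assumption].
    + apply Rlt_div_l; nra.
Qed.

(** The upper bound is Hadamard's. The roots of unity attain it but lie on the boundary, outside the
    open disc; they are placed in a disc of radius [t > 1], and the scaling law is used with [t]
    close to [1]. *)
Lemma ndiam_unit_disc (n : nat) : (2 <= n)%nat ->
  ndiam n (Defs.disc 1) = Rpower (INR n) (/ (INR n - 1)).
Proof.
  intros Hn. assert (N2 : 2 <= INR n) by (apply (le_INR 2); lia).
  set (K := Rpower (INR n) (/ (INR n - 1))). assert (PK : 0 < K) by apply Rpower_pos.
  assert (HK : (K ^ tri n) ^ 2 = INR n ^ n).
  { rewrite <- pow_mult, <- !Rpower_pow by lra. unfold K. rewrite Rpower_mult. f_equal.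
    rewrite mult_INR, INR_tri. simpl. field. lra. }
  assert (PKN : 0 < K ^ tri n) by now apply pow_lt.
  apply Rle_antisym.
  - apply ndiam_le; [assumption | apply has_diameter_disc; lra | lra |]. intros z Hz.
    apply (pow_le_reg _ _ 2); [lia | lra |]. rewrite HK.
    apply VandermondeBound.pair_prod_unit_disc. intros i Hi. left. now apply Hz.
  - destruct (exists_primitive_root n ltac:(lia)) as [w [W1 [W2 W3]]].
    assert (V : pair_prod n (fun i => (w ^ i)%C) = K ^ tri n).
    { assert (Q := VandermondeBound.pair_prod_roots_of_unity n w ltac:(lia) W1 W2 W3).
      rewrite <- HK in Q. assert (P := pair_prod_nonneg n (fun i => (w ^ i)%C)).
      apply Rle_antisym; apply (pow_le_reg _ _ 2); try lia; lra. }
    set (c := ndiam n (Defs.disc 1)).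
    assert (C0 : 0 <= c) by (apply ndiam_nonneg; [assumption | apply has_diameter_disc; lra]).
    assert (H : forall t, 1 < t -> K <= t * c).
    { intros t Ht. unfold c. rewrite <- ndiam_disc_scal by (assumption || lra).
      apply (pow_le_reg _ _ (tri n)); [now apply tri_pos | |].
      - apply ndiam_nonneg; [assumption | apply has_diameter_disc; lra].
      - rewrite <- V. apply pair_prod_le_ndiam; [assumption | apply has_diameter_disc; lra |].
        intros i _. unfold Defs.disc. rewrite Cmod_pow, W1, pow1. exact Ht. }
    apply le_epsilon. intros eps He.
    assert (Pc : 0 < eps / (c + 1)) by (apply Rdiv_lt_0_compat; lra).
    specialize (H (1 + eps / (c + 1)) ltac:(lra)).
    assert (eps / (c + 1) * c <= eps); [| lra].
    replace eps with (eps / (c + 1) * (c + 1)) at 2 by (field; lra).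
    apply Rmult_le_compat_l; lra.
Qed.

(** [P z = A (1 + s z^m) + o(z^m)]: the coefficient is taken relative to [A], so that it adds under
    products. *)
Definition expands (m : nat) (P : C -> C) (A s : C) : Prop :=
  forall eps, 0 < eps -> exists d, 0 < d /\ forall z, 0 < Cmod z < d ->
    Cmod (P z - A - A * s * z ^ m) <= eps * Cmod z ^ m.

Lemma expands_const_1 (m : nat) : expands m (fun _ => RtoC 1) 1 0.
Proof.
  intros eps He. exists 1. split; [lra |]. intros z Hz.
  replace (1 - 1 - 1 * 0 * z ^ m)%C with (RtoC 0) by ring. rewrite Cmod_0.
  apply Rmult_le_pos; [lra | apply pow_le, Cmod_ge_0].
Qed.

Lemma expands_mult (m : nat) (P Q : C -> C) (A B s t : C) : (1 <= m)%nat ->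
  expands m P A s -> expands m Q B t -> expands m (fun z => P z * Q z)%C (A * B) (s + t).
Proof.
  intros Hm HP HQ eps He.
  assert (a0 := Cmod_ge_0 A). assert (b0 := Cmod_ge_0 B).
  assert (s0 := Cmod_ge_0 (A * s)). assert (t0 := Cmod_ge_0 (B * t)).
  set (a := Cmod A) in *. set (b := Cmod B) in *.
  set (sa := Cmod (A * s)) in *. set (tb := Cmod (B * t)) in *.
  set (e := Rmin 1 (eps / (3 * (a + b + sa + tb + 1)))).
  assert (Pe : 0 < e) by (apply Rmin_glb_lt; [lra | apply Rdiv_lt_0_compat; lra]).
  assert (E1 : e <= 1) by apply Rmin_l.
  assert (E2 : e * (a + b + sa + tb + 1) <= eps / 3).
  { apply Rle_trans with (eps / (3 * (a + b + sa + tb + 1)) * (a + b + sa + tb + 1)).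
    - apply Rmult_le_compat_r; [lra | apply Rmin_r].
    - right. field. lra. }
  destruct (HP e Pe) as [d1 [D1 H1]]. destruct (HQ e Pe) as [d2 [D2 H2]].
  set (d3 := Rmin 1 (eps / (3 * (sa * tb + 1)))).
  assert (Pst : 0 <= sa * tb) by now apply Rmult_le_pos.
  assert (D3 : 0 < d3) by (apply Rmin_glb_lt; [lra | apply Rdiv_lt_0_compat; lra]).
  exists (Rmin (Rmin d1 d2) d3). split; [apply Rmin_glb_lt; [now apply Rmin_glb_lt | exact D3] |].
  intros z [Z0 Z]. apply Rmin_Rgt_l in Z. destruct Z as [Z Z3].
  apply Rmin_Rgt_l in Z. destruct Z as [Z1 Z2].
  specialize (H1 z (conj Z0 Z1)). specialize (H2 z (conj Z0 Z2)).
  assert (Zl : Cmod z < 1) by (eapply Rlt_le_trans; [exact Z3 | apply Rmin_l]).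
  assert (Zs : Cmod z * (sa * tb) <= eps / 3).
  { apply Rle_trans with (eps / (3 * (sa * tb + 1)) * (sa * tb + 1)).
    - apply Rmult_le_compat; try lra. left. eapply Rlt_le_trans; [exact Z3 | apply Rmin_r].
    - right. field. lra. }
  set (zm := Cmod z ^ m) in *.
  assert (Zm : 0 <= zm) by (apply pow_le; lra).
  assert (Zm1 : zm <= Cmod z).
  { unfold zm. destruct m as [| m]; [lia |]. simpl. apply Rle_trans with (Cmod z * 1); [| lra].
    apply Rmult_le_compat_l; [lra |]. rewrite <- (pow1 m). apply pow_incr. lra. }
  assert (EQ : Cmod (Q z) <= b + tb + 1).
  { replace (Q z) with ((Q z - B - B * t * z ^ m) + (B + B * t * z ^ m))%C by ring.
    eapply Rle_trans; [apply Cmod_triangle |].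
    assert (T := Cmod_triangle B (B * t * z ^ m)). rewrite (Cmod_mult (B * t)), Cmod_pow in T.
    fold b tb zm in T. nra. }
  (* Two terms inherit the errors of [P] and [Q]; the third is of order [z^(2m)] and is absorbed by
     the choice of [d3]. *)
  replace (P z * Q z - A * B - A * B * (s + t) * z ^ m)%C
    with ((P z - A - A * s * z ^ m) * Q z + (A + A * s * z ^ m) * (Q z - B - B * t * z ^ m)
          + (A * s) * (B * t) * (z ^ m * z ^ m))%C by ring.
  eapply Rle_trans; [apply Cmod_triangle |].
  eapply Rle_trans; [apply Rplus_le_compat_r, Cmod_triangle |].
  rewrite (Cmod_mult (P z - A - A * s * z ^ m)), (Cmod_mult (A + A * s * z ^ m)),
    (Cmod_mult (A * s * (B * t))), (Cmod_mult (A * s)), (Cmod_mult (z ^ m)), Cmod_pow.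
  fold sa tb zm.
  assert (EA : Cmod (A + A * s * z ^ m) <= a + sa).
  { eapply Rle_trans; [apply Cmod_triangle |]. rewrite (Cmod_mult (A * s)), Cmod_pow.
    fold a sa zm. nra. }
  assert (F1 : Cmod (P z - A - A * s * z ^ m) * Cmod (Q z) <= e * zm * (b + tb + 1))
    by (apply Rmult_le_compat; try apply Cmod_ge_0; assumption).
  assert (F2 : Cmod (A + A * s * z ^ m) * Cmod (Q z - B - B * t * z ^ m) <= (a + sa) * (e * zm))
    by (apply Rmult_le_compat; try apply Cmod_ge_0; assumption).
  assert (F3 : sa * tb * (zm * zm) <= eps / 3 * zm).
  { apply Rle_trans with (Cmod z * (sa * tb) * zm).
    - replace (sa * tb * (zm * zm)) with (zm * (sa * tb) * zm) by ring.
      apply Rmult_le_compat_r; [assumption |]. apply Rmult_le_compat_r; assumption.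
    - apply Rmult_le_compat_r; assumption. }
  assert (F4 : e * (a + b + sa + tb + 1) * zm <= eps / 3 * zm)
    by (apply Rmult_le_compat_r; assumption).
  nra.
Qed.

Lemma expands_cprod_upto (m k : nat) (P : nat -> C -> C) (A s : nat -> C) : (1 <= m)%nat ->
  (forall i, (i < k)%nat -> expands m (P i) (A i) (s i)) ->
  expands m (fun z => cprod_upto k (fun i => P i z)) (cprod_upto k A) (csum_upto k s).
Proof.
  intros Hm H. induction k as [| k IH]; simpl; [apply expands_const_1 |].
  apply (expands_mult m (fun z => cprod_upto k (fun i => P i z)) (P k)); [assumption | |].
  - apply IH. intros; apply H; lia.
  - apply H; lia.
Qed.

Lemma expands_ext (m : nat) (P Q : C -> C) (A s : C) :
  (forall z : C, z <> 0 -> P z = Q z) -> expands m P A s -> expands m Q A s.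
Proof.
  intros E H eps He. destruct (H eps He) as [d [Hd H1]]. exists d. split; [assumption |].
  intros z Hz. rewrite <- E by (apply Cmod_gt_0; lra). auto.
Qed.

Lemma csum_upto_ext (m : nat) (g h : nat -> C) :
  (forall i, (i < m)%nat -> g i = h i) -> csum_upto m g = csum_upto m h.
Proof.
  intros H. induction m as [| m IH]; [reflexivity |]. simpl.
  rewrite IH by (intros; apply H; lia). now rewrite H by lia.
Qed.

Lemma cprod_upto_div (m : nat) (g : nat -> C) (z : C) : z <> 0 ->
  cprod_upto m (fun i => g i / z)%C = (cprod_upto m g / z ^ m)%C.
Proof.
  intros Hz. induction m as [| m IH]; simpl; [field |].
  rewrite IH. field. split; [now apply Cpow_nz | assumption].
Qed.

Lemma cpair_prod_div (n : nat) (w : nat -> C) (z : C) : z <> 0 ->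
  cprod_upto n (fun k => cprod_upto k (fun j => (w j - w k) / z))%C = (cpair_prod n w / z ^ tri n)%C.
Proof.
  intros Hz. unfold cpair_prod. induction n as [| n IH]; [simpl; field |].
  change (tri (S n)) with (tri n + n)%nat. simpl cprod_upto. rewrite IH, cprod_upto_div by assumption.
  rewrite Cpow_add_r. field. split; now apply Cpow_nz.
Qed.

(* The complete homogeneous polynomial [(x^(m+1) - y^(m+1)) / (x - y)]. *)
Fixpoint hsum (m : nat) (x y : C) : C :=
  match m with O => RtoC 1 | S k => (x ^ S k + y * hsum k x y)%C end.

Lemma hsum_spec (m : nat) (x y : C) : ((x - y) * hsum m x y)%C = (x ^ S m - y ^ S m)%C.
Proof.
  induction m as [| m IH]; [simpl; ring |].
  change (hsum (S m) x y) with (x ^ S m + y * hsum m x y)%C.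
  replace ((x - y) * (x ^ S m + y * hsum m x y))%C
    with ((x - y) * x ^ S m + y * ((x - y) * hsum m x y))%C by ring.
  rewrite IH. simpl. ring.
Qed.

Definition pair_hsum (m n : nat) (w : nat -> C) : C :=
  csum_upto n (fun k => csum_upto k (fun j => hsum m (w j) (w k))).

(** Each factor is [(f(w_j z) - f(w_k z)) / z = a1 (w_j - w_k) (1 + (a / a1) h_m(w_j, w_k) z^m) +
    o(z^m)], and relative coefficients add. The points may coincide. *)
Lemma expands_dilated_cpair_prod (f : C -> C) (m n : nat) (a1 a : C) (w : nat -> C) :
  (1 <= m)%nat -> a1 <> 0 -> leading_term (fun z => f z - f 0 - a1 * z)%C (S m) a ->
  (forall i, (i < n)%nat -> Cmod (w i) = 1) ->
  expands m (fun z => cpair_prod n (fun i => f (w i * z)) / z ^ tri n)%C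
    (cpair_prod n w * a1 ^ tri n) (a / a1 * pair_hsum m n w).
Proof.
  intros Hm Na1 Hlead Hw.
  assert (Nia1 : (/ a1)%C <> 0).
  { intros Q. apply C1_nz. rewrite <- (Cinv_r a1 Na1), Q. ring. }
  (* The factor [a1] is written as a division by [/ a1], so that [cpair_prod_div] also collects its
     powers. *)
  replace (cpair_prod n w * a1 ^ tri n)%C
    with (cprod_upto n (fun k => cprod_upto k (fun j => (w j - w k) / / a1)))%C.
  2: { rewrite cpair_prod_div by assumption. unfold Cdiv. f_equal.
       rewrite Cpow_inv by assumption. field. now apply Cpow_nz. }
  replace (a / a1 * pair_hsum m n w)%C
    with (csum_upto n (fun k => csum_upto k (fun j => a / a1 * hsum m (w j) (w k))))%C.
  2: { unfold pair_hsum. clear Hw. induction n as [| n IH]; simpl; [ring |].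
       rewrite IH. rewrite Cmult_plus_distr_l. f_equal.
       generalize n at 1 3. intros q. induction q as [| q IHq]; simpl; [ring | rewrite IHq; ring]. }
  apply (expands_ext m (fun z => cprod_upto n (fun k => cprod_upto k
    (fun j => (f (w j * z) - f (w k * z)) / z)))%C).
  { intros z Hz. apply (cpair_prod_div n (fun i => f (w i * z)%C) z Hz). }
  apply (expands_cprod_upto m n (fun k z => cprod_upto k
     (fun j => (f (w j * z) - f (w k * z)) / z)%C)); [assumption |]. intros k Hk.
  apply (expands_cprod_upto m k (fun j z => (f (w j * z) - f (w k * z)) / z)%C); [assumption |].
  intros j Hj eps He. destruct (Hlead (eps / 2) ltac:(lra)) as [d [Hd H1]].
  exists d. split; [assumption |]. intros z Hz.
  assert (Nz : z <> 0) by (apply Cmod_gt_0; lra).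
  assert (Hmod : forall i, (i < n)%nat -> Cmod (w i * z) = Cmod z)
    by (intros i Hi; rewrite Cmod_mult, Hw by assumption; ring).
  assert (Hjk : (j < n)%nat) by lia.
  assert (A1 := H1 (w j * z)%C ltac:(rewrite Hmod by assumption; exact Hz)).
  assert (A2 := H1 (w k * z)%C ltac:(rewrite Hmod by assumption; exact Hz)).
  rewrite Hmod in A1, A2 by assumption.
  replace ((f (w j * z) - f (w k * z)) / z - (w j - w k) / / a1
           - (w j - w k) / / a1 * (a / a1 * hsum m (w j) (w k)) * z ^ m)%C
    with (((f (w j * z) - f 0 - a1 * (w j * z) - a * (w j * z) ^ S m)
           - (f (w k * z) - f 0 - a1 * (w k * z) - a * (w k * z) ^ S m)) / z)%C.
  2: { rewrite !Cpow_mult_l.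
       replace ((w j - w k) / / a1 * (a / a1 * hsum m (w j) (w k)) * z ^ m)%C
         with (a * ((w j - w k) * hsum m (w j) (w k)) * z ^ m)%C by (field; auto).
       rewrite hsum_spec. rewrite (Cpow_S z m). field. auto. }
  rewrite Cmod_div by assumption.
  apply Rle_div_l; [lra |]. eapply Rle_trans; [apply Cmod_triangle_minus |].
  simpl in A1, A2 |- *. lra.
Qed.

(* Schwarz's lemma for [(b - A) / (M^2 - conj(A) b)], which is bounded by [1 / M]. *)
Lemma schwarz_pick_coefficient (b : C -> C) (A sg : C) (m : nat) (s M : R) :
  (1 <= m)%nat -> 0 < s -> 0 < M -> Cmod A < M ->
  (forall z, Cmod z <= s -> z <> 0 -> cdiff b z) ->
  (forall z, 0 < Cmod z <= s -> Cmod (b z) <= M) ->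
  expands m b A sg -> Cmod (A * sg) * s ^ m * M <= M ^ 2 - Cmod A ^ 2.
Proof.
  intros Hm Hs HM HA Hb HbM Hexp.
  assert (A0 := Cmod_ge_0 A).
  assert (Hden : forall z, 0 < Cmod z <= s ->
     M * (M - Cmod A) <= Cmod (RtoC (M ^ 2) - Cconj A * b z)).
  { intros z Hz. assert (T := Cmod_triangle_rev (RtoC (M ^ 2)) (Cconj A * b z)).
    rewrite Cmod_R, Rabs_right, Cmod_mult, Cmod_conj in T by (apply Rle_ge, pow2_ge_0).
    specialize (HbM z Hz). assert (B0 := Cmod_ge_0 (b z)). nra. }
  assert (Pden : 0 < M * (M - Cmod A)) by (apply Rmult_lt_0_compat; lra).
  assert (Nden : forall z, 0 < Cmod z <= s -> (RtoC (M ^ 2) - Cconj A * b z)%C <> 0).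
  { intros z Hz. apply Cmod_gt_0. specialize (Hden z Hz). lra. }
  set (q := fun z => ((b z - A) / (RtoC (M ^ 2) - Cconj A * b z) / z ^ m)%C).
  assert (Hq0 : bounded_near q 0).
  { destruct (Hexp 1 Rlt_0_1) as [d [Hd H1]].
    apply (bounded_near_div_pow _ m ((Cmod (A * sg) + 1) / (M * (M - Cmod A))) (Rmin d s));
      [now apply Rmin_glb_lt |].
    intros u [U1 U2]. apply Rmin_Rgt_l in U2. destruct U2 as [U2 U3].
    specialize (H1 u (conj U1 U2)). assert (P := pow_lt _ m U1).
    rewrite Cmod_div by (apply Nden; lra).
    assert (Q : Cmod (b u - A) <= (Cmod (A * sg) + 1) * Cmod u ^ m).
    { replace (b u - A)%C with ((b u - A - A * sg * u ^ m) + A * sg * u ^ m)%C by ring.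
      eapply Rle_trans; [apply Cmod_triangle |].
      rewrite (Cmod_mult (A * sg)), Cmod_pow. lra. }
    replace ((Cmod (A * sg) + 1) / (M * (M - Cmod A)) * Cmod u ^ m)
      with ((Cmod (A * sg) + 1) * Cmod u ^ m * / (M * (M - Cmod A))) by (field; lra).
    apply Rmult_le_compat; [apply Cmod_ge_0 | | assumption |].
    + left. apply Rinv_0_lt_compat. specialize (Hden u ltac:(lra)). lra.
    + apply Rinv_le_contravar; [assumption | apply Hden; lra]. }
  assert (Hq : forall z, Cmod z <= s -> z <> 0 -> Cmod (q z) <= / (M * s ^ m)).
  { intros z Z1 Z2. apply (max_principle_punctured q s _ 0 0); auto; try (rewrite Cmod_0; lra).
    - left. apply Rinv_0_lt_compat, Rmult_lt_0_compat; [assumption | now apply pow_lt].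
    - intros u U1 U2 _. apply cdiff_div_pow; [| assumption]. apply cdiff_div.
      + apply cdiff_minus; [now apply Hb | apply cdiff_const].
      + apply cdiff_minus; [apply cdiff_const | now apply cdiff_scal, Hb].
      + apply Nden. split; [now apply Cmod_gt_0 | assumption].
    - intros u Hu. unfold q. assert (Nu : u <> 0) by (apply Cmod_gt_0; lra).
      rewrite !Cmod_div, Cmod_pow, Hu by (try (now apply Cpow_nz); apply Nden; lra).
      assert (D := Hden u ltac:(lra)). assert (P := pow_lt s m Hs).
      unfold Rdiv. rewrite Rinv_mult.
      apply Rmult_le_compat_r; [left; now apply Rinv_0_lt_compat |].
      apply (Rle_div_l _ (/ M)); [lra |].
      apply (Rmult_le_reg_l M); [assumption |].
      rewrite <- Rmult_assoc, Rinv_r, Rmult_1_l by lra.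
      apply (pow_le_reg _ _ 2); [lia | apply Cmod_ge_0 |].
      specialize (HbM u ltac:(lra)). rewrite Rpow_mult_distr, !Cmod2_alt.
      assert (I1 : Cmod (b u) ^ 2 <= M ^ 2) by (apply pow_incr; split; [apply Cmod_ge_0 | assumption]).
      assert (I2 : Cmod A ^ 2 <= M ^ 2) by (apply pow_incr; lra).
      rewrite Cmod2_alt in I1, I2.
      destruct (b u) as [x y], A as [p r]. unfold Cconj, Cminus, Cplus, Copp, Cmult, RtoC; simpl in *.
      (* The identity [|M^2 - conj(A) b|^2 - M^2 |b - A|^2 = (M^2 - |b|^2) (M^2 - |A|^2)], in
         coordinates. *)
      assert (0 <= (M * (M * 1) - (x * (x * 1) + y * (y * 1)))
                   * (M * (M * 1) - (p * (p * 1) + r * (r * 1)))) by (apply Rmult_le_pos; lra).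
      nra. }
  assert (Psm := pow_lt s m Hs).
  assert (S0 := Cmod_ge_0 (A * sg)). set (k := Cmod (A * sg)) in *.
  assert (PMs : 0 < M * s ^ m) by now apply Rmult_lt_0_compat.
  (* The coefficient is read off at a small positive real [t]: the numerator is at least
     [(k - eps) t^m], and [t <= eps / D] brings the denominator within [eps] of [M^2 - |A|^2]. *)
  assert (Key : forall eps, 0 < eps -> (k - eps) * (M * s ^ m) <= M ^ 2 - Cmod A ^ 2 + eps).
  { intros eps He. destruct (Hexp eps He) as [d [Hd H1]].
    set (D := (Cmod A + 1) * (k + eps)).
    assert (PD : 0 < D) by (apply Rmult_lt_0_compat; lra).
    set (t := Rmin (Rmin (d / 2) s) (Rmin 1 (eps / D))).
    assert (T0 : 0 < t) by (repeat apply Rmin_glb_lt; try lra; now apply Rdiv_lt_0_compat).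
    assert (T1 : t <= d / 2) by (eapply Rle_trans; [apply Rmin_l | apply Rmin_l]).
    assert (T2 : t <= s) by (eapply Rle_trans; [apply Rmin_l | apply Rmin_r]).
    assert (T3 : t <= 1) by (eapply Rle_trans; [apply Rmin_r | apply Rmin_l]).
    assert (T4 : t <= eps / D) by (eapply Rle_trans; [apply Rmin_r | apply Rmin_r]).
    assert (Ct : Cmod t = t) by (rewrite Cmod_R, Rabs_right; lra).
    assert (Nt : RtoC t <> 0) by (apply Cmod_gt_0; lra).
    assert (Htm : 0 < t ^ m) by now apply pow_lt.
    assert (Htm1 : t ^ m <= t).
    { destruct m as [| m']; [lia |]. simpl. apply Rle_trans with (t * 1); [| lra].
      apply Rmult_le_compat_l; [lra |]. rewrite <- (pow1 m'). apply pow_incr. lra. }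
    specialize (H1 t ltac:(rewrite Ct; lra)). rewrite Ct in H1.
    assert (L1 := Cmod_triangle_rev (A * sg * t ^ m) (b t - A)).
    replace (A * sg * t ^ m - (b t - A))%C with (- (b t - A - A * sg * t ^ m))%C in L1 by ring.
    assert (L2 := Cmod_triangle (b t - A - A * sg * t ^ m) (A * sg * t ^ m)).
    replace (b t - A - A * sg * t ^ m + A * sg * t ^ m)%C with (b t - A)%C in L2 by ring.
    rewrite Cmod_opp in L1. rewrite (Cmod_mult (A * sg)), Cmod_pow, Ct in L1, L2. fold k in L1, L2.
    assert (Hqt := Hq t ltac:(lra) Nt). unfold q in Hqt.
    assert (Dt := Hden t ltac:(lra)).
    rewrite !Cmod_div, Cmod_pow, Ct in Hqt by ((now apply Cpow_nz) || (apply Nden; lra)).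
    apply (proj1 (Rle_div_l _ _ _ Htm)) in Hqt.
    apply (proj1 (Rle_div_l _ _ _ (Rlt_le_trans _ _ _ Pden Dt))) in Hqt.
    assert (L3 : Cmod (RtoC (M ^ 2) - Cconj A * b t) <= M ^ 2 - Cmod A ^ 2 + Cmod A * Cmod (b t - A)).
    { replace (RtoC (M ^ 2) - Cconj A * b t)%C
        with (RtoC (M ^ 2 - Cmod A ^ 2) - Cconj A * (b t - A))%C.
      2: { rewrite RtoC_minus, (RtoC_pow (Cmod A)), <- RtoC_pow, Cmod2_conj. ring. }
      eapply Rle_trans; [apply Cmod_triangle_minus |].
      rewrite Cmod_mult, Cmod_conj, Cmod_R, Rabs_right; [lra |].
      assert (Cmod A ^ 2 <= M ^ 2) by (apply pow_incr; lra). lra. }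
    assert (L4 : Cmod A * Cmod (b t - A) <= eps).
    { apply Rle_trans with (D * t).
      - unfold D. rewrite Rmult_assoc. apply Rmult_le_compat; try apply Cmod_ge_0; [lra |].
        apply Rle_trans with ((k + eps) * t ^ m); [lra | apply Rmult_le_compat_l; lra].
      - apply (Rmult_le_compat_l D) in T4; [| lra].
        replace (D * (eps / D)) with eps in T4 by (field; lra). exact T4. }
    assert (L5 : (k - eps) * t ^ m <= / (M * s ^ m) * t ^ m * (M ^ 2 - Cmod A ^ 2 + eps)).
    { apply Rle_trans with (Cmod (b t - A)); [lra |]. eapply Rle_trans; [exact Hqt |].
      apply Rmult_le_compat_l; [| lra].
      apply Rmult_le_pos; [left; now apply Rinv_0_lt_compat | lra]. }
    apply (Rmult_le_compat_r (M * s ^ m * / t ^ m)) in L5.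
    2: { apply Rmult_le_pos; [lra | left; now apply Rinv_0_lt_compat]. }
    replace ((k - eps) * t ^ m * (M * s ^ m * / t ^ m)) with ((k - eps) * (M * s ^ m)) in L5
      by (field; lra).
    replace (/ (M * s ^ m) * t ^ m * (M ^ 2 - Cmod A ^ 2 + eps) * (M * s ^ m * / t ^ m))
      with (M ^ 2 - Cmod A ^ 2 + eps) in L5 by (field; lra).
    exact L5. }
  apply le_epsilon. intros eps He.
  assert (Pe : 0 < eps / (1 + M * s ^ m)) by (apply Rdiv_lt_0_compat; lra).
  specialize (Key _ Pe).
  replace eps with (eps / (1 + M * s ^ m) * (1 + M * s ^ m)) by (field; lra). lra.
Qed.

(** * Rigidity for the [n]-diameter *)

Lemma ndiam_unit_disc_pow (n : nat) : (2 <= n)%nat ->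
  0 < ndiam n (Defs.disc 1) /\ (ndiam n (Defs.disc 1) ^ tri n) ^ 2 = INR n ^ n.
Proof.
  intros Hn. assert (N2 : 2 <= INR n) by (apply (le_INR 2); lia).
  rewrite ndiam_unit_disc by assumption. split; [apply Rpower_pos |].
  rewrite <- pow_mult, <- !Rpower_pow by (lra || apply Rpower_pos). rewrite Rpower_mult. f_equal.
  rewrite mult_INR, INR_tri. simpl. field. lra.
Qed.

Lemma csum_upto_plus (m : nat) (g h : nat -> C) :
  csum_upto m (fun i => g i + h i)%C = (csum_upto m g + csum_upto m h)%C.
Proof. induction m as [| m IH]; simpl; [ring | rewrite IH; ring]. Qed.

Lemma csum_upto_scal (m : nat) (c : C) (g : nat -> C) :
  csum_upto m (fun i => c * g i)%C = (c * csum_upto m g)%C.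
Proof. induction m as [| m IH]; simpl; [ring | rewrite IH; ring]. Qed.

Lemma csum_upto_shift (m : nat) (g : nat -> C) :
  csum_upto (S m) g = (g O + csum_upto m (fun i => g (S i)))%C.
Proof.
  induction m as [| m IH]; [simpl; ring |].
  change (csum_upto (S (S m)) g) with (csum_upto (S m) g + g (S m))%C. rewrite IH. simpl. ring.
Qed.

Lemma csum_upto_geometric (m : nat) (q : C) :
  ((q - 1) * csum_upto m (fun i => q ^ i))%C = (q ^ m - 1)%C.
Proof.
  induction m as [| m IH]; simpl; [ring |]. rewrite Cmult_plus_distr_l, IH. ring.
Qed.

Lemma csum_upto_const_1 (m : nat) : csum_upto m (fun _ => RtoC 1) = RtoC (INR m).
Proof.
  induction m as [| m IH]; [reflexivity |]. rewrite S_INR, RtoC_plus. simpl. now rewrite IH.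
Qed.

(** * Power sums of the roots of unity *)

Section Rotation.
Variables (p : nat) (w : C).
Hypothesis Hwn : (w ^ S p)%C = RtoC 1.
Hypothesis Hwk : forall k, (0 < k)%nat -> (k < S p)%nat -> (w ^ k)%C <> RtoC 1.

(** The sum of the [i]-th powers of the [(p+1)]-th roots of unity other than [1]; the root [1] is
    the one that will be rotated. *)
Definition root_power_sum (i : nat) : R := if (i mod S p =? 0)%nat then INR p else -1.

Lemma csum_upto_root_power (i : nat) :
  csum_upto p (fun j => (w ^ S j) ^ i)%C = RtoC (root_power_sum i).
Proof.
  assert (Ei : (w ^ i)%C = (w ^ (i mod S p))%C).
  { rewrite (Nat.div_mod_eq i (S p)) at 1. rewrite Cpow_add_r, Cpow_mult_r, Hwn, Cpow_1_l. ring. }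
  assert (Ej : forall j, ((w ^ S j) ^ i)%C = ((w ^ i) ^ S j)%C).
  { intros j. rewrite <- !Cpow_mult_r. f_equal. lia. }
  rewrite (csum_upto_ext p _ (fun j => (w ^ i) ^ S j)%C) by (intros; apply Ej).
  unfold root_power_sum. destruct (Nat.eqb_spec (i mod S p) 0) as [E0 | N0].
  - rewrite <- csum_upto_const_1. apply csum_upto_ext. intros j _.
    rewrite Ei, E0. apply Cpow_1_l.
  - assert (Nq : (w ^ i)%C <> RtoC 1).
    { rewrite Ei. apply Hwk; [lia |]. apply Nat.mod_upper_bound. lia. }
    assert (G := csum_upto_geometric (S p) (w ^ i)%C). rewrite csum_upto_shift in G.
    assert (Eq : ((w ^ i) ^ S p)%C = RtoC 1).
    { rewrite <- Cpow_mult_r, Nat.mul_comm, Cpow_mult_r, Hwn. apply Cpow_1_l. }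
    rewrite Eq in G. replace (1 - 1)%C with (RtoC 0) in G by ring.
    set (s := csum_upto p (fun j => (w ^ i) ^ S j)%C) in *.
    assert (Nq1 : (w ^ i - 1)%C <> 0) by now apply Cminus_eq_contra.
    replace s with ((w ^ i - 1) * ((w ^ i) ^ 0 + s) / (w ^ i - 1) - 1)%C
      by (simpl; field; assumption).
    rewrite G. replace (RtoC (-1)) with (- (1))%C by (unfold Copp, RtoC; simpl; f_equal; ring).
    field. assumption.
Qed.

Fixpoint root_power_sum_prefix (k : nat) : R :=
  match k with O => root_power_sum O | S j => root_power_sum_prefix j + root_power_sum (S j) end.

(** The prefix sum is the distance from [k + 1] up to the least multiple [(p+1) q] not below it;
    this makes it visibly nonnegative. *)
Lemma root_power_sum_prefix_spec (k : nat) : exists q,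
  root_power_sum_prefix k + INR (S k) = INR (S p * q) /\
  (S k <= S p * q)%nat /\ (S p * q < S k + S p)%nat.
Proof.
  induction k as [| k [q [E [H1 H2]]]].
  - exists 1%nat. unfold root_power_sum_prefix, root_power_sum. rewrite Nat.mod_0_l by lia.
    rewrite Nat.mul_1_r. split; [rewrite !S_INR; simpl; lra | lia].
  - change (root_power_sum_prefix (S k)) with (root_power_sum_prefix k + root_power_sum (S k)).
    unfold root_power_sum. destruct (Nat.eqb_spec (S k mod S p) 0) as [E0 | N0].
    + assert (Eq : S k = (S p * q)%nat).
      { assert (D := Nat.div_mod_eq (S k) (S p)). rewrite E0, Nat.add_0_r in D.
        rewrite D in H1, H2 |- *. f_equal. nia. }
      exists (S q). split; [| nia].
      replace (S p * S q)%nat with (S p * q + S p)%nat by lia. rewrite plus_INR, <- E.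
      rewrite (S_INR (S k)), (S_INR p). lra.
    + exists q. assert (S k <> (S p * q)%nat).
      { intros Q. apply N0. rewrite Q, Nat.mul_comm. apply Nat.Div0.mod_mul. }
      split; [rewrite <- E, (S_INR (S k)); lra | lia].
Qed.

Lemma root_power_sum_prefix_nonneg (k : nat) : 0 <= root_power_sum_prefix k.
Proof.
  destruct (root_power_sum_prefix_spec k) as [q [E [H1 _]]]. apply le_INR in H1. lra.
Qed.

(** The only part of [pair_hsum] that involves the rotated point [exp (i eta)]. Its slope, defined
    next, is the derivative of its imaginary part at [0]. *)
Definition rotated_hsum (k : nat) (eta : R) : C :=
  csum_upto p (fun j => hsum k (w ^ S j) (cexp (0, eta)))%C.

Fixpoint rotated_hsum_slope (k : nat) : R :=
  match k with O => 0 | S j => rotated_hsum_slope j + root_power_sum_prefix j end.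

Lemma rotated_hsum_S (k : nat) (eta : R) :
  rotated_hsum (S k) eta
  = (RtoC (root_power_sum (S k)) + cexp (0, eta) * rotated_hsum k eta)%C.
Proof.
  unfold rotated_hsum. rewrite <- csum_upto_root_power, <- csum_upto_scal, <- csum_upto_plus.
  reflexivity.
Qed.

Lemma rotated_hsum_0 (k : nat) : rotated_hsum k 0 = RtoC (root_power_sum_prefix k).
Proof.
  induction k as [| k IH].
  - unfold rotated_hsum. simpl hsum. rewrite csum_upto_const_1. unfold root_power_sum_prefix, root_power_sum.
    rewrite Nat.mod_0_l by lia. reflexivity.
  - rewrite rotated_hsum_S, IH. change (cexp (0, 0)) with (cexp (RtoC 0)). rewrite cexp_0.
    change (root_power_sum_prefix (S k)) with (root_power_sum_prefix k + root_power_sum (S k)).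
    rewrite RtoC_plus. ring.
Qed.

(** The recursion [rotated_hsum_S] is differentiated at [0]. Since the value there is the real
    prefix sum, the factor [exp (i eta)] adds that sum to the imaginary derivative and nothing to
    the real one. *)
Lemma is_derive_rotated_hsum (k : nat) :
  is_derive (fun t => Re (rotated_hsum k t)) 0 0 /\
  is_derive (fun t => Im (rotated_hsum k t)) 0 (rotated_hsum_slope k).
Proof.
  induction k as [| k [IH1 IH2]].
  - unfold rotated_hsum. simpl hsum. rewrite csum_upto_const_1. simpl.
    split; apply is_derive_Reals, derivable_pt_lim_const.
  - assert (V := rotated_hsum_0 k).
    apply is_derive_Reals in IH1. apply is_derive_Reals in IH2.
    assert (D1 := derivable_pt_lim_cos 0). assert (D2 := derivable_pt_lim_sin 0).
    rewrite sin_0 in D1. rewrite cos_0 in D2.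
    assert (ER : forall t, root_power_sum (S k) + (cos t * Re (rotated_hsum k t)
        - sin t * Im (rotated_hsum k t)) = Re (rotated_hsum (S k) t)).
    { intros t. rewrite rotated_hsum_S, re_plus, re_mult, re_RtoC. unfold cexp. simpl.
      rewrite exp_0. ring. }
    assert (EI : forall t, cos t * Im (rotated_hsum k t) + sin t * Re (rotated_hsum k t)
        = Im (rotated_hsum (S k) t)).
    { intros t. rewrite rotated_hsum_S, im_plus, im_mult, im_RtoC. unfold cexp. simpl.
      rewrite exp_0. ring. }
    split.
    + apply (is_derive_ext _ _ _ _ ER). apply is_derive_Reals.
      assert (M1 := derivable_pt_lim_mult _ _ _ _ _ D1 IH1).
      assert (M2 := derivable_pt_lim_mult _ _ _ _ _ D2 IH2).
      assert (M3 := derivable_pt_lim_minus _ _ _ _ _ M1 M2).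
      assert (M4 := derivable_pt_lim_plus _ _ _ _ _ (derivable_pt_lim_const (root_power_sum (S k)) 0) M3).
      cbv beta in M4. rewrite V, sin_0, cos_0, re_RtoC, im_RtoC in M4.
      match type of M4 with derivable_pt_lim _ _ ?l => replace 0 with l at 2 by ring end.
      exact M4.
    + apply (is_derive_ext _ _ _ _ EI). apply is_derive_Reals.
      assert (M1 := derivable_pt_lim_mult _ _ _ _ _ D1 IH2).
      assert (M2 := derivable_pt_lim_mult _ _ _ _ _ D2 IH1).
      assert (M3 := derivable_pt_lim_plus _ _ _ _ _ M1 M2).
      cbv beta in M3. rewrite V, sin_0, cos_0, re_RtoC, im_RtoC in M3.
      match type of M3 with derivable_pt_lim _ _ ?l =>
        replace (rotated_hsum_slope (S k)) with l by (simpl; ring) end.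
      exact M3.
Qed.

Lemma rotated_hsum_slope_pos (k : nat) : (1 <= p)%nat -> (1 <= k)%nat -> 0 < rotated_hsum_slope k.
Proof.
  intros Hp Hk. destruct k as [| k]; [lia |]. clear Hk. induction k as [| k IH].
  - unfold rotated_hsum_slope, root_power_sum_prefix, root_power_sum. rewrite Nat.mod_0_l by lia.
    apply lt_0_INR in Hp. simpl. lra.
  - change (rotated_hsum_slope (S (S k))) with (rotated_hsum_slope (S k) + root_power_sum_prefix (S k)).
    assert (Q := root_power_sum_prefix_nonneg (S k)). lra.
Qed.
End Rotation.

Lemma cos_ge_quadratic (u : R) : 1 - u ^ 2 / 2 <= cos u.
Proof.
  assert (H : forall v, 0 <= v -> 1 - v ^ 2 / 2 <= cos v).
  { intros v Hv. replace v with (2 * (v / 2)) at 2 by field. rewrite cos_2a_sin.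
    assert (S : Rabs (sin (v / 2)) <= v / 2).
    { destruct Hv as [Hv | <-].
      - destruct (Rle_lt_dec (v / 2) 1) as [L | L].
        + assert (P := PI2_1). assert (0 < sin (v / 2)) by (apply sin_gt_0; lra).
          assert (sin (v / 2) < v / 2) by (apply sin_lt_x; lra). rewrite Rabs_right; lra.
        + assert (B := SIN_bound (v / 2)). apply Rabs_le. lra.
      - replace (0 / 2) with 0 by field. rewrite sin_0, Rabs_R0. lra. }
    apply Rabs_le_between in S. nra. }
  destruct (Rle_dec 0 u) as [L | L]; [now apply H |].
  rewrite <- cos_neg. replace (u ^ 2) with ((- u) ^ 2) by ring. apply H. lra.
Qed.

Lemma Re_csum_upto (m : nat) (g : nat -> C) (c : R) :
  (forall i, (i < m)%nat -> c <= Re (g i)) -> INR m * c <= Re (csum_upto m g).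
Proof.
  intros H. induction m as [| m IH]; [simpl; lra |].
  change (csum_upto (S m) g) with (csum_upto m g + g m)%C. rewrite re_plus, S_INR.
  assert (A := H m ltac:(lia)). assert (B := IH ltac:(intros; apply H; lia)). lra.
Qed.

Section NdiamRigidity.
Variables (f : C -> C) (n m : nat) (a1 a : C) (r0 : R).
Hypothesis Hf : forall z, Cmod z < 1 -> cdiff f z.
Hypothesis Hn : (2 <= n)%nat.
Hypothesis Hm : (1 <= m)%nat.
Hypothesis Na1 : a1 <> 0.
Hypothesis Na : a <> 0.
Hypothesis Hlead : leading_term (fun z => f z - f 0 - a1 * z)%C (S m) a.
Hypothesis Hr0 : 0 < r0 < 1.
Hypothesis Hconst : forall r, 0 < r <= r0 ->
  ndiam n (image_disc f r) <= Cmod a1 * ndiam n (Defs.disc 1) * r.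

(** Schwarz-Pick for [b z], the pair product of the [f (w_i z)] over [z^N]: its value at [0] has
    modulus [V |a1|^N], and the hypothesis on the diameters bounds it by [mu = (|a1| c)^N], the
    largest value that [V |a1|^N] can take. *)
Lemma rigidity_inequality : exists kappa, 0 < kappa /\
  forall w, (forall i, (i < n)%nat -> Cmod (w i) = 1) ->
    kappa * pair_prod n w * Cmod (pair_hsum m n w) * ndiam n (Defs.disc 1) ^ tri n
    <= (ndiam n (Defs.disc 1) ^ tri n) ^ 2 - pair_prod n w ^ 2.
Proof.
  set (c := ndiam n (Defs.disc 1)). set (N := tri n).
  destruct (ndiam_unit_disc_pow n Hn) as [Pc Ec]. fold c N in Pc, Ec.
  assert (PN : (0 < N)%nat) by now apply tri_pos.
  assert (A1 : 0 < Cmod a1) by now apply Cmod_gt_0.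
  assert (A0 : 0 < Cmod (a / a1)) by (rewrite Cmod_div by assumption;
    apply Rdiv_lt_0_compat; [now apply Cmod_gt_0 | assumption]).
  set (s := r0 / 2).
  assert (Ps : 0 < s ^ m) by (apply pow_lt; unfold s; lra).
  exists (Cmod (a / a1) * s ^ m). split; [now apply Rmult_lt_0_compat |].
  intros w Hw. set (V := pair_prod n w). set (h := Cmod (pair_hsum m n w)).
  assert (V0 : 0 <= V) by apply pair_prod_nonneg. assert (h0 : 0 <= h) by apply Cmod_ge_0.
  assert (PcN : 0 < c ^ N) by now apply pow_lt.
  assert (HV : V <= c ^ N).
  { apply (pow_le_reg _ _ 2); [lia | lra |]. rewrite Ec.
    apply VandermondeBound.pair_prod_unit_disc. intros i Hi. right. now apply Hw. }
  set (g := Cmod a1 ^ N). assert (Pg : 0 < g) by now apply pow_lt.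
  set (mu := g * c ^ N). assert (Pmu : 0 < mu) by now apply Rmult_lt_0_compat.
  set (b := fun z => (cpair_prod n (fun i => f (w i * z)) / z ^ N)%C).
  set (A := (cpair_prod n w * a1 ^ N)%C).
  assert (EA : Cmod A = V * g) by (unfold A; rewrite Cmod_mult, Cmod_pow, Cmod_cpair_prod; reflexivity).
  assert (Hexp : expands m b A (a / a1 * pair_hsum m n w))
    by now apply expands_dilated_cpair_prod.
  assert (EAs : Cmod (A * (a / a1 * pair_hsum m n w)) = V * g * (Cmod (a / a1) * h))
    by (rewrite Cmod_mult, EA, Cmod_mult; reflexivity).
  (* Schwarz-Pick asks for [|A| < M], while extremal [w] have [|A| = mu]; so [M > mu] is taken first
     and [M] tends to [mu] afterwards. *)
  assert (HM : forall M, mu < M -> V * g * (Cmod (a / a1) * h) * s ^ m * M <= M ^ 2 - (V * g) ^ 2).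
  { intros M HM. rewrite <- EA at 2. rewrite <- EAs.
    apply (schwarz_pick_coefficient b); [assumption | unfold s; lra | lra | | | | assumption].
    - rewrite EA. apply Rle_lt_trans with mu; [| assumption]. unfold mu.
      rewrite Rmult_comm. apply Rmult_le_compat_l; lra.
    - intros z Hz Nz. apply cdiff_div_pow; [| assumption].
      apply cdiff_dilated_cpair_prod; [assumption | | unfold s in Hz; lra].
      intros i Hi. right. now apply Hw.
    - intros z Hz. assert (Nz : z <> 0) by (apply Cmod_gt_0; lra).
      set (q := M / mu). assert (Hq : 1 < q) by (apply Rlt_div_r; lra).
      assert (Lq : 0 < ln q) by (rewrite <- ln_1; apply ln_increasing; lra).
      assert (PNR : 0 < INR N) by now apply lt_0_INR.
      (* The points [w_i z] lie on the circle of radius [|z|], hence in the open disc of radius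
         [t |z|]. As [|z| <= r0 / 2], the bound [t <= 2] keeps this radius below [r0], and
         [t^N <= M / mu] keeps the product below [M]. *)
      set (t := Rmin 2 (exp (ln q / INR N))).
      assert (T1 : 1 < t).
      { apply Rmin_glb_lt; [lra |]. rewrite <- exp_0. apply exp_increasing.
        now apply Rdiv_lt_0_compat. }
      assert (T2 : t <= 2) by apply Rmin_l.
      assert (T3 : t ^ N <= q).
      { apply Rle_trans with (exp (ln q / INR N) ^ N).
        - apply pow_incr. split; [lra | apply Rmin_r].
        - rewrite <- Rpower_pow by apply exp_pos. unfold Rpower. rewrite ln_exp.
          replace (INR N * (ln q / INR N)) with (ln q) by (field; lra).
          rewrite exp_ln; lra. }
      set (r := t * Cmod z).
      assert (Rr : Cmod z < r <= r0) by (unfold r, s in *; nra).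
      unfold b. rewrite Cmod_div, Cmod_pow by now apply Cpow_nz.
      assert (Pz : 0 < Cmod z ^ N) by (apply pow_lt; lra).
      apply (proj2 (Rle_div_l _ _ _ Pz)).
      eapply Rle_trans.
      + apply (dilated_pair_prod_le f Hf n r w z Hn); [lra |].
        intros i Hi. rewrite Cmod_mult, Hw by assumption. lra.
      + apply Rle_trans with ((Cmod a1 * c * r) ^ N).
        * apply pow_incr. split; [| apply Hconst; lra].
          apply ndiam_nonneg; [assumption | apply has_diameter_image; [assumption | lra]].
        * unfold r. replace (Cmod a1 * c * (t * Cmod z)) with (Cmod a1 * c * t * Cmod z) by ring.
          rewrite !Rpow_mult_distr. fold g. apply Rmult_le_compat_r; [lra |].
          replace (g * c ^ N) with mu by reflexivity.
          apply Rle_trans with (mu * q); [apply Rmult_le_compat_l; lra |].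
          right. unfold q. field. lra. }
  assert (Hmu : V * g * (Cmod (a / a1) * h) * s ^ m * mu <= mu ^ 2 - (V * g) ^ 2).
  { apply le_epsilon. intros eps He.
    set (e := Rmin 1 (eps / (2 * mu + 1))).
    assert (Pe : 0 < e) by (apply Rmin_glb_lt; [lra | apply Rdiv_lt_0_compat; lra]).
    assert (E1 : e <= 1) by apply Rmin_l.
    assert (E2 : e * (2 * mu + 1) <= eps).
    { replace eps with (eps / (2 * mu + 1) * (2 * mu + 1)) by (field; lra).
      apply Rmult_le_compat_r; [lra | apply Rmin_r]. }
    specialize (HM (mu + e) ltac:(lra)).
    assert (P0 : 0 <= V * g * (Cmod (a / a1) * h) * s ^ m).
    { repeat apply Rmult_le_pos; lra. }
    nra. }
  apply (Rmult_le_reg_l (g ^ 2)); [now apply pow_lt |]. unfold mu in Hmu.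
  replace (g ^ 2 * (Cmod (a / a1) * s ^ m * V * h * c ^ N))
    with (V * g * (Cmod (a / a1) * h) * s ^ m * (g * c ^ N)) by ring.
  replace (g ^ 2 * ((c ^ N) ^ 2 - V ^ 2)) with ((g * c ^ N) ^ 2 - (V * g) ^ 2) by ring.
  exact Hmu.
Qed.

(* Rotating one of the [n] roots of unity by [eta] changes [pair_prod] only to second order, but
   [pair_hsum] to first order. *)
Lemma ndiam_rigidity : False.
Proof.
  destruct rigidity_inequality as [kappa [Hk Hineq]].
  destruct (ndiam_unit_disc_pow n Hn) as [Pc Ec].
  destruct (exists_primitive_root n ltac:(lia)) as [w [W1 [W2 W3]]].
  destruct n as [| p] eqn:En; [lia |]. rewrite <- En in *.
  assert (Hp : (1 <= p)%nat) by lia.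
  rewrite En in W2, W3.
  set (V0 := pair_prod p (fun i => (w ^ S i)%C)).
  (* The roots [w^1, ..., w^p], followed by [exp (i eta)] in place of the root [1]. *)
  set (tup := fun (eta : R) (i : nat) => if (i <? p)%nat then (w ^ S i)%C else cexp (0, eta)).
  set (sg := fun eta : R => csum_upto n (fun j => cexp (0, eta) ^ j)%C).
  assert (Tlt : forall eta i, (i < p)%nat -> tup eta i = (w ^ S i)%C).
  { intros eta i Hi. unfold tup. apply Nat.ltb_lt in Hi. now rewrite Hi. }
  assert (Tp : forall eta, tup eta p = cexp (0, eta)).
  { intros eta. unfold tup. now rewrite Nat.ltb_irrefl. }
  assert (Hunit : forall eta i, (i < n)%nat -> Cmod (tup eta i) = 1).
  { intros eta i Hi. unfold tup. destruct (i <? p)%nat.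
    - rewrite Cmod_pow, W1. apply pow1.
    - rewrite Cmod_cexp. apply exp_0. }
  (* The distances to the moving point [x] multiply to [|1 + x + ... + x^p|], and the other
     distances are fixed. *)
  assert (HV : forall eta, pair_prod n (tup eta) = V0 * Cmod (sg eta)).
  { intros eta. unfold sg. rewrite En, pair_prod_S. f_equal.
    - apply pair_prod_ext. intros i Hi. now apply Tlt.
    - rewrite <- (VandermondeBound.prod_upto_sub_roots_of_unity p w) by assumption.
      apply prod_upto_ext. intros j Hj. now rewrite Tlt, Tp. }
  assert (Hh : forall eta, pair_hsum m n (tup eta)
     = (pair_hsum m p (fun i => (w ^ S i)%C) + rotated_hsum p w m eta)%C).
  { intros eta. rewrite En. unfold pair_hsum, rotated_hsum.
    change (csum_upto (S p) ?g) with (csum_upto p g + g p)%C. cbv beta. f_equal.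
    - apply csum_upto_ext. intros k Hk'. apply csum_upto_ext. intros j Hj.
      now rewrite !Tlt by lia.
    - apply csum_upto_ext. intros j Hj. now rewrite Tlt, Tp. }
  set (c := ndiam n (Defs.disc 1) ^ tri n) in *.
  assert (N2 : 2 <= INR n) by (apply (le_INR 2); lia).
  assert (Pcn : 0 < c) by now apply pow_lt.
  (* At [eta = 0] the tuple is [w^1, ..., w^n], the roots of unity rotated by [w], where Hadamard's
     bound is attained. *)
  assert (Hc : c = V0 * INR n).
  { assert (S0 : Cmod (sg 0) = INR n).
    { unfold sg. change (cexp (0, 0)) with (cexp (RtoC 0)). rewrite cexp_0.
      rewrite (csum_upto_ext n _ (fun _ => RtoC 1)) by (intros; apply Cpow_1_l).
      rewrite csum_upto_const_1, Cmod_R, Rabs_right; lra. }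
    rewrite <- S0, <- HV.
    assert (Q := VandermondeBound.pair_prod_roots_of_unity n w ltac:(lia) W1
      ltac:(rewrite En; exact W2) ltac:(rewrite En; exact W3)).
    assert (E : pair_prod n (fun i => (w ^ i)%C) <= pair_prod n (tup 0)).
    { rewrite <- (Rmult_1_l (pair_prod n (tup 0))), <- (pow1 (tri n)).
      apply pair_prod_scal_le; [lra |]. intros i j Hi Hj.
      assert (Et : forall i, (i < n)%nat -> tup 0 i = (w * w ^ i)%C).
      { intros k Hk'. unfold tup. destruct (Nat.ltb_spec k p) as [L | L]; [reflexivity |].
        replace k with p by lia. rewrite <- Cpow_S, W2.
        change (cexp (0, 0)) with (cexp (RtoC 0)). apply cexp_0. }
      rewrite !Et by assumption. replace (w * w ^ i - w * w ^ j)%C with (w * (w ^ i - w ^ j))%C by ring.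
      rewrite Cmod_mult, W1. lra. }
    assert (P1 := pair_prod_nonneg n (fun i => (w ^ i)%C)).
    assert (P2 := pair_prod_nonneg n (tup 0)).
    apply Rle_antisym.
    - eapply Rle_trans; [| exact E]. apply (pow_le_reg _ _ 2); [lia | assumption | lra].
    - apply (pow_le_reg _ _ 2); [lia | lra |]. rewrite Ec.
      apply VandermondeBound.pair_prod_unit_disc. intros i Hi. right. now apply Hunit. }
  assert (PV0 : 0 < V0).
  { apply (Rmult_lt_reg_r (INR n)); [lra |]. rewrite Rmult_0_l, <- Hc. exact Pcn. }
  assert (Hsg : forall eta, INR n * (1 - (INR n * eta) ^ 2 / 2) <= Cmod (sg eta)).
  { intros eta. eapply Rle_trans; [| eapply Rle_trans; [apply Rle_abs | apply re_le_Cmod]].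
    apply Re_csum_upto. intros j Hj. rewrite cexp_pow.
    unfold cexp, Cmult, RtoC; simpl. replace (INR j * 0 - 0 * eta) with 0 by ring.
    rewrite exp_0, Rmult_1_l. replace (INR j * eta + 0 * 0) with (INR j * eta) by ring.
    eapply Rle_trans; [| apply cos_ge_quadratic].
    apply lt_INR in Hj. assert (J := pos_INR j).
    assert (INR j ^ 2 <= INR n ^ 2) by (apply pow_incr; lra).
    assert (E2 : 0 <= eta ^ 2) by apply pow2_ge_0. simpl in *. nra. }
  (* With [x = |sg eta| >= n / 2] and [n^2 - x^2 <= n^2 (n eta)^2], the rigidity inequality reads
     [(kappa n^2 / 2) |h| <= n^4 eta^2], where [h] is the [pair_hsum]. *)
  set (K := 2 * INR n ^ 2 / kappa).
  assert (PK : 0 < K) by (apply Rdiv_lt_0_compat; nra).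
  assert (Hsmall : forall eta, Rabs eta <= / INR n ->
     Cmod (pair_hsum m n (tup eta)) <= K * eta ^ 2).
  { intros eta He. assert (I := Hineq (tup eta) (Hunit eta)).
    rewrite HV, Hc in I. set (x := Cmod (sg eta)) in *. set (y := Cmod (pair_hsum m n (tup eta))) in *.
    assert (Y0 : 0 <= y) by apply Cmod_ge_0.
    set (u := (INR n * eta) ^ 2).
    assert (U1 : u <= 1).
    { unfold u. rewrite <- (pow2_abs (INR n * eta)), <- (pow1 2). apply pow_incr.
      split; [apply Rabs_pos |]. rewrite Rabs_mult, (Rabs_right (INR n)) by lra.
      apply (Rmult_le_compat_l (INR n)) in He; [| lra]. rewrite Rinv_r in He; lra. }
    assert (U0 : 0 <= u) by apply pow2_ge_0.
    assert (Hx := Hsg eta). fold u x in Hx.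
    assert (X1 : INR n / 2 <= x) by (assert (INR n * u <= INR n * 1) by (apply Rmult_le_compat_l; lra); lra).
    assert (J : kappa * x * y * INR n <= INR n ^ 2 - x ^ 2).
    { apply (Rmult_le_reg_l (V0 ^ 2)); [now apply pow_lt |].
      replace (V0 ^ 2 * (kappa * x * y * INR n)) with (kappa * (V0 * x) * y * (V0 * INR n)) by ring.
      replace (V0 ^ 2 * (INR n ^ 2 - x ^ 2)) with ((V0 * INR n) ^ 2 - (V0 * x) ^ 2) by ring.
      exact I. }
    assert (J2 : INR n ^ 2 - x ^ 2 <= INR n ^ 2 * u).
    { assert ((INR n * (1 - u / 2)) ^ 2 <= x ^ 2) by (apply pow_incr; split; [nra | exact Hx]).
      assert (0 <= INR n ^ 2 * u ^ 2) by (apply Rmult_le_pos; apply pow2_ge_0). nra. }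
    assert (J3 : kappa * (INR n / 2) * y * INR n <= kappa * x * y * INR n).
    { apply Rmult_le_compat_r; [lra |]. apply Rmult_le_compat_r; [assumption |].
      apply Rmult_le_compat_l; lra. }
    unfold K. apply (Rmult_le_reg_l (kappa * INR n ^ 2 / 2)).
    - apply Rdiv_lt_0_compat; [apply Rmult_lt_0_compat; [assumption | apply pow_lt; lra] | lra].
    - replace (kappa * INR n ^ 2 / 2 * (2 * INR n ^ 2 / kappa * eta ^ 2)) with (INR n ^ 2 * u)
        by (unfold u; field; lra).
      replace (kappa * INR n ^ 2 / 2 * y) with (kappa * (INR n / 2) * y * INR n) by field. lra. }
  assert (Pin : 0 < / INR n) by (apply Rinv_0_lt_compat; lra).
  assert (Z0 : pair_hsum m n (tup 0) = RtoC 0).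
  { apply Cmod_eq_0. apply Rle_antisym; [| apply Cmod_ge_0].
    specialize (Hsmall 0 ltac:(rewrite Rabs_R0; lra)). simpl in Hsmall. lra. }
  assert (Hg : forall eta, Rabs eta <= / INR n ->
     Rabs (Im (rotated_hsum p w m eta) - Im (rotated_hsum p w m 0)) <= K * eta ^ 2).
  { intros eta He. eapply Rle_trans; [| apply (Hsmall eta He)].
    replace (pair_hsum m n (tup eta)) with (pair_hsum m n (tup eta) - pair_hsum m n (tup 0))%C
      by (rewrite Z0; ring).
    rewrite !Hh. eapply Rle_trans; [| apply im_le_Cmod].
    right. f_equal. unfold Cminus. rewrite !im_plus, im_opp, im_plus. ring. }
  destruct (is_derive_rotated_hsum p w W2 W3 m) as [_ D].
  apply is_derive_Reals in D.
  assert (PT := rotated_hsum_slope_pos p m Hp Hm).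
  set (T := rotated_hsum_slope p m) in *.
  destruct (D (T / 2) ltac:(lra)) as [d Hd].
  (* Small enough for the difference quotient to exceed [T / 2] while the quadratic bound keeps it
     at most [K eta <= T / 4]. *)
  set (eta := Rmin (d / 2) (Rmin (/ INR n) (T / (4 * K)))).
  assert (Pd := cond_pos d).
  assert (Pe : 0 < eta).
  { repeat apply Rmin_glb_lt; try lra. apply Rdiv_lt_0_compat; lra. }
  assert (E1 : eta <= d / 2) by apply Rmin_l.
  assert (E2 : eta <= / INR n) by (eapply Rle_trans; [apply Rmin_r | apply Rmin_l]).
  assert (E3 : eta <= T / (4 * K)) by (eapply Rle_trans; [apply Rmin_r | apply Rmin_r]).
  specialize (Hd eta ltac:(lra) ltac:(rewrite Rabs_right; lra)). rewrite Rplus_0_l in Hd.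
  specialize (Hg eta ltac:(rewrite Rabs_right; lra)).
  set (dg := Im (rotated_hsum p w m eta) - Im (rotated_hsum p w m 0)) in *.
  assert (F1 : T / 2 < dg / eta) by (apply Rabs_def2 in Hd; lra).
  apply (Rmult_lt_compat_r eta) in F1; [| assumption].
  replace (dg / eta * eta) with dg in F1 by (field; lra).
  assert (F2 : dg <= K * eta ^ 2) by (eapply Rle_trans; [apply Rle_abs | exact Hg]).
  assert (F3 : K * eta <= T / 4).
  { apply (Rmult_le_compat_l K) in E3; [| lra].
    replace (K * (T / (4 * K))) with (T / 4) in E3 by (field; lra). exact E3. }
  simpl in F2. nra.
Qed.
End NdiamRigidity.

(** * Rigidity for the capacity *)

Lemma tdiam_unit_disc : tdiam (Defs.disc 1) = 1.
Proof.
  assert (H := ndiam_tdiam (Defs.disc 1) (has_diameter_disc 1 Rlt_0_1)).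
  apply is_lim_seq_unique in H.
  assert (L : is_lim_seq (fun m => ndiam (m + 2) (Defs.disc 1)) 1);
    [| apply is_lim_seq_unique in L; rewrite H in L; now injection L].
  apply (is_lim_seq_ext (fun m => exp (/ (INR (m + 2) - 1) * ln (INR (m + 2))))).
  { intros m. rewrite ndiam_unit_disc by lia. reflexivity. }
  replace (Finite 1) with (Finite (exp 0)) by (now rewrite exp_0).
  apply (is_lim_seq_continuous exp (fun m => / (INR (m + 2) - 1) * ln (INR (m + 2))) 0).
  { apply derivable_continuous_pt, derivable_pt_exp. }
  assert (L1 : is_lim_seq (fun m => ln (INR (m + 2)) / INR (m + 2)) 0).
  { apply (is_lim_comp_seq (fun y => ln y / y) (fun m => INR (m + 2)) p_infty 0).
    - apply is_lim_div_ln_p.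
    - exists O. intros n _. discriminate.
    - apply (is_lim_seq_incr_n INR 2 p_infty). apply is_lim_seq_INR. }
  assert (L2 : is_lim_seq (fun m => 2 * (ln (INR (m + 2)) / INR (m + 2))) 0).
  { replace (Finite 0) with (Rbar_mult 2 0) by (simpl; f_equal; ring).
    now apply is_lim_seq_scal_l. }
  apply (is_lim_seq_le_le (fun _ => 0) _ (fun m => 2 * (ln (INR (m + 2)) / INR (m + 2))));
    [| apply is_lim_seq_const | exact L2].
  intros m. assert (M : 2 <= INR (m + 2)) by (apply (le_INR 2); lia).
  assert (P : 0 <= ln (INR (m + 2))) by (rewrite <- ln_1; apply Rcomplements.ln_le; lra).
  set (x := INR (m + 2)) in *. split.
  - apply Rmult_le_pos; [left; apply Rinv_0_lt_compat; lra | exact P].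
  - replace (2 * (ln x / x)) with (/ (x / 2) * ln x) by (field; lra).
    apply Rmult_le_compat_r; [exact P |]. apply Rinv_le_contravar; lra.
Qed.

Lemma tdiam_disc (r : R) : 0 < r -> tdiam (Defs.disc r) = r.
Proof.
  intros Hr. assert (H := ndiam_tdiam (Defs.disc r) (has_diameter_disc r Hr)).
  assert (L : is_lim_seq (fun m => ndiam (m + 2) (Defs.disc r)) (Rbar_mult r (tdiam (Defs.disc 1)))).
  { apply (is_lim_seq_ext (fun m => r * ndiam (m + 2) (Defs.disc 1))).
    - intros m. symmetry. apply ndiam_disc_scal; [lia | assumption].
    - apply is_lim_seq_scal_l, ndiam_tdiam, has_diameter_disc. lra. }
  apply is_lim_seq_unique in H. apply is_lim_seq_unique in L. rewrite H in L.
  rewrite tdiam_unit_disc in L. simpl in L. injection L. intros ->. ring.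
Qed.

Lemma tdiam_le (E E' : C -> Prop) (K : R) : has_diameter E -> has_diameter E' ->
  (forall n, (2 <= n)%nat -> ndiam n E <= K * ndiam n E') -> tdiam E <= K * tdiam E'.
Proof.
  intros HE HE' H.
  apply (is_lim_seq_le (fun m => ndiam (m + 2) E) (fun m => K * ndiam (m + 2) E')
           (tdiam E) (Rbar_mult K (tdiam E'))).
  - intros m. apply H. lia.
  - now apply ndiam_tdiam.
  - now apply is_lim_seq_scal_l, ndiam_tdiam.
Qed.

(** * Two clusters of points *)

Lemma prod_upto_app (n k : nat) (g : nat -> R) :
  prod_upto (n + k) g = prod_upto n g * prod_upto k (fun i => g (n + i)%nat).
Proof.
  induction k as [| k IH]; [rewrite Nat.add_0_r; simpl; ring |].
  rewrite Nat.add_succ_r. simpl. rewrite IH. ring.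
Qed.

Lemma pair_prod_app (n k : nat) (u : nat -> C) :
  pair_prod (n + k) u = pair_prod n u
    * prod_upto k (fun l => prod_upto n (fun j => Cmod (u j - u (n + l)%nat)))
    * pair_prod k (fun l => u (n + l)%nat).
Proof.
  induction k as [| k IH]; [rewrite Nat.add_0_r; unfold pair_prod; simpl; ring |].
  rewrite Nat.add_succ_r, !pair_prod_S, IH, prod_upto_app. simpl. ring.
Qed.

Lemma prod_upto_ge_const (m : nat) (g : nat -> R) (K : R) : 0 <= K ->
  (forall i, (i < m)%nat -> K <= g i) -> K ^ m <= prod_upto m g.
Proof. intros HK H. rewrite <- prod_upto_const. apply prod_upto_le. auto. Qed.

(** The pair product of the roots of unity has square [n^n >= 1]; discarding it leaves the clean
    bound [L^(tri n)]. *)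
Lemma pair_prod_roots_ge (n : nat) : (2 <= n)%nat -> exists w : C, Cmod w = 1 /\
  forall (z : nat -> C) (L : R), 0 <= L ->
    (forall i j, (i < n)%nat -> (j < n)%nat -> L * Cmod (w ^ i - w ^ j) <= Cmod (z i - z j)) ->
    L ^ tri n <= pair_prod n z.
Proof.
  intros Hn. destruct (exists_primitive_root n ltac:(lia)) as [w [W1 [W2 W3]]].
  exists w. split; [assumption |]. intros z L HL H.
  assert (V := VandermondeBound.pair_prod_roots_of_unity n w ltac:(lia) W1 W2 W3).
  assert (N1 : 1 <= INR n ^ n) by (apply pow_R1_Rle, (le_INR 1); lia).
  assert (V1 : 1 <= pair_prod n (fun i => (w ^ i)%C)).
  { apply (pow_le_reg _ _ 2); [lia | apply pair_prod_nonneg |]. rewrite V. simpl. lra. }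
  destruct HL as [HL | <-].
  2: { rewrite pow_ne_zero by (assert (Q := tri_pos n Hn); lia). apply pair_prod_nonneg. }
  assert (K : pair_prod n (fun i => (w ^ i)%C) <= (/ L) ^ tri n * pair_prod n z).
  { apply pair_prod_scal_le; [left; now apply Rinv_0_lt_compat |]. intros i j Hi Hj.
    specialize (H i j Hi Hj). apply (Rmult_le_reg_l L); [assumption |].
    rewrite <- Rmult_assoc, Rinv_r, Rmult_1_l by lra. exact H. }
  assert (PL : 0 < L ^ tri n) by now apply pow_lt.
  apply (Rmult_le_compat_l (L ^ tri n)) in K; [| lra].
  rewrite <- Rmult_assoc, <- Rpow_mult_distr, Rinv_r, pow1, Rmult_1_l in K by lra. nra.
Qed.

Section CapacityRigidity.
Variables (f : C -> C) (m : nat) (a1 a : C) (r0 : R).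
Hypothesis Hf : forall z, Cmod z < 1 -> cdiff f z.
Hypothesis Hm : (1 <= m)%nat.
Hypothesis Na1 : a1 <> 0.
Hypothesis Na : a <> 0.
Hypothesis Ha1 : cderiv f 0 a1.
Hypothesis Hlead : leading_term (fun z => f z - f 0 - a1 * z)%C (S m) a.
Hypothesis Hr0 : 0 < r0 < 1.

(** Otherwise [(f z - f 0) / z] is bounded by [|a1|], the modulus of its own limit at [0], and
    Schwarz-Pick with [M] close to [|a1|] forces the next coefficient [a] to vanish. *)
Lemma exists_large_difference (s : R) : 0 < s < 1 ->
  exists x : C, 0 < Cmod x <= s /\ Cmod a1 * Cmod x < Cmod (f x - f 0).
Proof.
  intros Hs. apply NNPP. intros Hno.
  assert (A1 : 0 < Cmod a1) by now apply Cmod_gt_0.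
  assert (A : 0 < Cmod a) by now apply Cmod_gt_0.
  set (q := fun z => ((f z - f 0) / z)%C).
  assert (Hq : forall M, Cmod a1 < M -> Cmod a * s ^ m * M <= M ^ 2 - Cmod a1 ^ 2).
  { intros M HM. replace (Cmod a) with (Cmod (a1 * (a / a1))) by (f_equal; field; assumption).
    apply (schwarz_pick_coefficient q); try lra; try assumption.
    - intros z Hz Nz. apply cdiff_div; [| apply cdiff_id | assumption].
      apply cdiff_minus; [apply Hf; lra | apply cdiff_const].
    - intros z Hz. unfold q. rewrite Cmod_div by (apply Cmod_gt_0; lra).
      apply Rle_div_l; [lra |]. apply Rnot_lt_le. intros Q. apply Hno. exists z.
      split; [assumption |]. eapply Rle_lt_trans; [| exact Q]. apply Rmult_le_compat_r; lra.
    - intros eps He. destruct (Hlead eps He) as [d [Hd H1]]. exists d. split; [assumption |].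
      intros z Hz. assert (Nz : z <> 0) by (apply Cmod_gt_0; lra). specialize (H1 z Hz).
      replace (q z - a1 - a1 * (a / a1) * z ^ m)%C
        with ((f z - f 0 - a1 * z - a * z ^ S m) / z)%C
        by (unfold q; rewrite Cpow_S; field; split; assumption).
      rewrite Cmod_div by assumption. apply Rle_div_l; [lra |]. simpl in H1 |- *. lra. }
  assert (Ps : 0 < s ^ m) by (apply pow_lt; lra).
  set (k := Cmod a * s ^ m) in *. assert (Pk : 0 < k) by now apply Rmult_lt_0_compat.
  (* With [M = |a1| + e], the right-hand side [M^2 - |a1|^2] is at most
     [e (2 |a1| + 1) <= k |a1| / 2], smaller than the left-hand side [k M]. *)
  set (e := Rmin 1 (k * Cmod a1 / (2 * (2 * Cmod a1 + 1)))).
  assert (Pe : 0 < e).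
  { apply Rmin_glb_lt; [lra |]. apply Rdiv_lt_0_compat; [now apply Rmult_lt_0_compat | lra]. }
  assert (E1 : e <= 1) by apply Rmin_l.
  assert (E2 : e * (2 * Cmod a1 + 1) <= k * Cmod a1 / 2).
  { apply Rle_trans with (k * Cmod a1 / (2 * (2 * Cmod a1 + 1)) * (2 * Cmod a1 + 1)).
    - apply Rmult_le_compat_r; [lra | apply Rmin_r].
    - right. field. lra. }
  specialize (Hq (Cmod a1 + e) ltac:(lra)). nra.
Qed.

(* [n] points on a circle of radius almost [r], and [k] points near [x]. The product of their mutual
   distances is bounded below by its value when the circle shrinks to [0]. *)
Lemma ndiam_two_clusters (r lam0 lam b rho alpha : R) (x : C) (n k : nat) :
  (2 <= n)%nat -> (2 <= k)%nat -> 0 < r < 1 -> 0 < lam -> lam < lam0 -> 0 < rho -> 0 < b ->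
  (forall y, Cmod (y - x) < rho -> Cmod y < r /\ lam0 <= Cmod (f y - f 0)) ->
  (forall y y', Cmod (y - x) < rho -> Cmod (y' - x) < rho -> b * Cmod (y - y') <= Cmod (f y - f y')) ->
  0 < alpha < Cmod a1 * r ->
  alpha ^ tri n * lam ^ (n * k) * (b * (rho / 2)) ^ tri k
  <= ndiam (n + k) (image_disc f r) ^ tri (n + k).
Proof.
  intros Hn Hk Hr Hlam Hlam0 Hrho Hb Hball Hlip Halpha.
  assert (A1 : 0 < Cmod a1) by now apply Cmod_gt_0.
  set (Y := ndiam (n + k) (image_disc f r) ^ tri (n + k)).
  destruct (pair_prod_roots_ge n Hn) as [w [W1 Hw]].
  destruct (pair_prod_roots_ge k Hk) as [v [V1 Hv]].
  set (pt := fun l => (x + RtoC (rho / 2) * v ^ l)%C).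
  assert (Crho : Cmod (RtoC (rho / 2)) = rho / 2) by (rewrite Cmod_R, Rabs_right; lra).
  assert (Hpt : forall l, Cmod (pt l - x) < rho).
  { intros l. unfold pt. replace (x + RtoC (rho / 2) * v ^ l - x)%C with (RtoC (rho / 2) * v ^ l)%C by ring.
    rewrite Cmod_mult, Crho, Cmod_pow, V1, pow1. lra. }
  set (Pk := pair_prod k (fun l => f (pt l))).
  assert (HPk : (b * (rho / 2)) ^ tri k <= Pk).
  { apply Hv; [apply Rmult_le_pos; lra |]. intros i j _ _.
    eapply Rle_trans; [| apply Hlip; apply Hpt].
    unfold pt. replace (x + RtoC (rho / 2) * v ^ i - (x + RtoC (rho / 2) * v ^ j))%C
      with (RtoC (rho / 2) * (v ^ i - v ^ j))%C by ring.
    rewrite Cmod_mult, Crho. right. ring. }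
  assert (PPk : 0 < Pk).
  { eapply Rlt_le_trans; [| exact HPk]. apply pow_lt, Rmult_lt_0_compat; lra. }
  assert (PA : 0 < Cmod a1 * r) by (apply Rmult_lt_0_compat; lra).
  (* The loss from [|a1| r] to [alpha] is shared equally: [alpha = (|a1| t) (r t)], one factor [t]
     for the stretching of [f] near [0] and one for the radius of the circle. *)
  set (t := sqrt (alpha / (Cmod a1 * r))).
  assert (Q : 0 < alpha / (Cmod a1 * r) < 1).
  { split; [apply Rdiv_lt_0_compat; lra |]. apply Rlt_div_l; lra. }
  assert (Tt : t * t = alpha / (Cmod a1 * r)) by (apply sqrt_sqrt; lra).
  assert (T0 : 0 < t) by (apply sqrt_lt_R0; lra).
  assert (T1 : t < 1) by nra.
  assert (Ealpha : alpha = Cmod a1 * t * (r * t)).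
  { replace (Cmod a1 * t * (r * t)) with (Cmod a1 * r * (t * t)) by ring. rewrite Tt. field. lra. }
  (* [G] is the product of the distances between the clusters. In [T] the product within the moving
     cluster is divided by its order of vanishing, so the value near [0] is controlled by the
     maximum on the circle of radius [r t]. *)
  set (G := fun z => cprod_upto k (fun l => cprod_upto n (fun j => f (w ^ j * z) - f (pt l)))%C).
  set (T := fun z => (cpair_prod n (fun i => f (w ^ i * z)) / z ^ tri n * G z)%C).
  assert (Hwi : forall i z, Cmod (w ^ i * z) = Cmod z)
    by (intros i z; rewrite Cmod_mult, Cmod_pow, W1, pow1; ring).
  assert (HG : forall z, Cmod z < 1 -> cdiff G z).
  { intros z Hz. apply (cdiff_cprod_upto k (fun l z => cprod_upto n
      (fun j => f (w ^ j * z) - f (pt l)))%C). intros l _.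
    apply (cdiff_cprod_upto n (fun j z => f (w ^ j * z) - f (pt l))%C). intros j _.
    apply cdiff_minus; [| apply cdiff_const].
    apply (cdiff_comp f (fun z => w ^ j * z)%C); [apply cdiff_scal, cdiff_id |].
    apply Hf. now rewrite Hwi. }
  assert (EG : forall z, Cmod (G z)
      = prod_upto k (fun l => prod_upto n (fun j => Cmod (f (w ^ j * z)%C - f (pt l))))).
  { intros z. unfold G. rewrite Cmod_cprod_upto. apply prod_upto_ext. intros l _.
    apply Cmod_cprod_upto. }
  assert (Hw1 : forall i, (i < n)%nat -> Cmod (w ^ i) <= 1)
    by (intros i _; rewrite Cmod_pow, W1, pow1; lra).
  assert (Hbig : forall z, 0 < Cmod z < r ->
     pair_prod n (fun i => f (w ^ i * z)%C) * Cmod (G z) * Pk <= Y).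
  { intros z Hz. set (u := fun i => if (i <? n)%nat then f (w ^ i * z)%C else f (pt (i - n)%nat)).
    assert (U1 : forall i, (i < n)%nat -> u i = f (w ^ i * z)%C)
      by (intros i Hi; unfold u; apply Nat.ltb_lt in Hi; now rewrite Hi).
    assert (U2 : forall l, u (n + l)%nat = f (pt l)).
    { intros l. unfold u. replace (n + l <? n)%nat with false by (symmetry; apply Nat.ltb_ge; lia).
      f_equal. f_equal. lia. }
    apply Rle_trans with (pair_prod (n + k) u).
    - right. rewrite pair_prod_app, EG. f_equal; [f_equal |].
      + apply pair_prod_ext. intros i Hi. symmetry. now apply U1.
      + apply prod_upto_ext. intros l _. apply prod_upto_ext. intros j Hj. now rewrite U1, U2.
      + apply pair_prod_ext. intros l _. symmetry. apply U2.
    - apply pair_prod_le_ndiam; [lia | now apply has_diameter_image |]. intros i Hi. unfold u.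
      destruct (i <? n)%nat.
      + exists (w ^ i * z)%C. rewrite Hwi. split; [lra | reflexivity].
      + exists (pt (i - n)%nat). split; [apply Hball, Hpt | reflexivity]. }
  set (B := Y / ((r * t) ^ tri n * Pk)).
  assert (Prt : 0 < (r * t) ^ tri n) by (apply pow_lt, Rmult_lt_0_compat; lra).
  assert (Rt : 0 < r * t < r) by (split; nra).
  assert (HT : forall z, Cmod z <= r * t -> z <> 0 -> Cmod (T z) <= B).
  { assert (Hn0 : bounded_near T 0).
    { destruct (dilated_pair_prod_near_0 f Hf n (fun i => (w ^ i)%C) Hw1) as [K [d [Hd H1]]].
      destruct (cdiff_bounded_near G 0 (HG 0 ltac:(rewrite Cmod_0; lra))) as [K' [d' [Hd' H2]]].
      exists (Rabs K * Rabs K'), (Rmin d d'). split; [now apply Rmin_glb_lt |].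
      intros z Nz Hz. apply Rmin_Rgt_l in Hz. destruct Hz as [Z1 Z2].
      specialize (H2 z Nz Z2). replace (z - 0)%C with z in Z1 by ring.
      assert (Pz := proj1 (Cmod_gt_0 z) Nz). specialize (H1 z (conj Pz Z1)).
      unfold T. rewrite Cmod_mult, Cmod_div, Cmod_pow by now apply Cpow_nz.
      assert (PzN : 0 < Cmod z ^ tri n) by now apply pow_lt.
      apply Rmult_le_compat; try apply Cmod_ge_0.
      - apply Rdiv_le_0_compat; [apply Cmod_ge_0 | assumption].
      - apply (proj2 (Rle_div_l _ _ _ PzN)). eapply Rle_trans; [exact H1 |].
        apply Rmult_le_compat_r; [lra | apply Rle_abs].
      - eapply Rle_trans; [exact H2 | apply Rle_abs]. }
    intros z Hz Nz. apply (max_principle_punctured T (r * t) B 0 0); auto; try (rewrite Cmod_0; lra).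
    - apply Rdiv_le_0_compat; [| apply Rmult_lt_0_compat; assumption].
      apply pow_le, ndiam_nonneg; [lia | now apply has_diameter_image].
    - intros z' Z1 Z2 _. apply cdiff_mult; [| apply HG; lra].
      apply cdiff_div_pow; [| assumption].
      apply (cdiff_dilated_cpair_prod f Hf n (fun i => (w ^ i)%C)); [assumption | lra].
    - intros z' Hz'. assert (Nz' : z' <> 0) by (apply Cmod_gt_0; lra).
      unfold T. rewrite Cmod_mult, Cmod_div, Cmod_pow, Hz', Cmod_cpair_prod by now apply Cpow_nz.
      unfold B. apply (proj1 (Rle_div_r _ _ _ (Rmult_lt_0_compat _ _ Prt PPk))).
      specialize (Hbig z' ltac:(lra)).
      replace (pair_prod n (fun i => f (w ^ i * z')%C) / (r * t) ^ tri n * Cmod (G z')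
               * ((r * t) ^ tri n * Pk))
        with (pair_prod n (fun i => f (w ^ i * z')%C) * Cmod (G z') * Pk) by (field; lra).
      exact Hbig. }
  (* Near [0], accuracy [|a1| (1 - t)] leaves a stretching factor [|a1| t], and the gap [lam0 - lam]
     absorbs replacing [f 0] by the nearby values of [f]. *)
  destruct (strictly_differentiable_at_0 f 1 a1 Rlt_0_1 Hf Ha1 (Cmod a1 * (1 - t))) as [d1 [D1 H1]].
  { apply Rmult_lt_0_compat; lra. }
  destruct (cdiff_ccont f 0 (Hf 0 ltac:(rewrite Cmod_0; lra)) (lam0 - lam) ltac:(lra)) as [d2 [D2 H2]].
  set (z0 := Rmin (r * t) (Rmin d1 d2 / 2)).
  assert (M1 := Rmin_l d1 d2). assert (M2 := Rmin_r d1 d2).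
  assert (M0 : 0 < Rmin d1 d2) by now apply Rmin_glb_lt.
  assert (Z0 : 0 < z0) by (apply Rmin_glb_lt; lra).
  assert (Z1 : z0 <= r * t) by apply Rmin_l.
  assert (Z2 : z0 <= Rmin d1 d2 / 2) by apply Rmin_r.
  assert (Cz : Cmod z0 = z0) by (rewrite Cmod_R, Rabs_right; lra).
  assert (Nz : RtoC z0 <> 0) by (apply Cmod_gt_0; lra).
  specialize (HT z0 ltac:(lra) Nz). unfold T in HT.
  rewrite Cmod_mult, Cmod_div, Cmod_pow, Cz, Cmod_cpair_prod in HT by now apply Cpow_nz.
  assert (L1 : (Cmod a1 * t * z0) ^ tri n <= pair_prod n (fun i => f (w ^ i * z0)%C)).
  { apply Hw; [repeat apply Rmult_le_pos; lra |]. intros i j _ _.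
    specialize (H1 (w ^ i * z0)%C (w ^ j * z0)%C ltac:(rewrite Hwi; lra) ltac:(rewrite Hwi; lra)).
    replace (w ^ i * z0 - w ^ j * z0)%C with ((w ^ i - w ^ j) * z0)%C in H1 by ring.
    assert (Tr := Cmod_triangle_rev (a1 * ((w ^ i - w ^ j) * z0)) (f (w ^ i * z0)%C - f (w ^ j * z0)%C)).
    rewrite (Cmod_minus_sym (a1 * ((w ^ i - w ^ j) * z0))), (Cmod_mult a1) in Tr.
    rewrite !(Cmod_mult (w ^ i - w ^ j)), Cz in Tr. rewrite !(Cmod_mult (w ^ i - w ^ j)), Cz in H1.
    lra. }
  assert (L2 : lam ^ (n * k) <= Cmod (G z0)).
  { rewrite EG, pow_mult. apply prod_upto_ge_const; [apply pow_le; lra |]. intros l _.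
    apply prod_upto_ge_const; [lra |]. intros j _.
    specialize (H2 (w ^ j * z0)%C).
    replace (w ^ j * z0 - 0)%C with (w ^ j * z0)%C in H2 by ring. rewrite Hwi in H2.
    specialize (H2 ltac:(lra)). destruct (Hball (pt l) (Hpt l)) as [_ H3].
    assert (Tr := Cmod_triangle_rev (f (pt l) - f 0) (f (w ^ j * z0)%C - f 0)).
    replace (f (pt l) - f 0 - (f (w ^ j * z0)%C - f 0))%C with (f (pt l) - f (w ^ j * z0)%C)%C in Tr by ring.
    rewrite (Cmod_minus_sym (f (pt l)) (f (w ^ j * z0)%C)) in Tr. lra. }
  assert (PzN : 0 < z0 ^ tri n) by now apply pow_lt.
  assert (L3 : (Cmod a1 * t) ^ tri n * lam ^ (n * k) <= B).
  { eapply Rle_trans; [| exact HT]. apply Rmult_le_compat; try (apply pow_le); try lra.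
    - apply Rmult_le_pos; lra.
    - apply (proj1 (Rle_div_r _ _ _ PzN)). rewrite <- Rpow_mult_distr. exact L1. }
  unfold B in L3. apply (proj2 (Rle_div_r _ _ _ (Rmult_lt_0_compat _ _ Prt PPk))) in L3.
  eapply Rle_trans; [| exact L3].
  rewrite Ealpha, (Rpow_mult_distr (Cmod a1 * t)).
  replace ((Cmod a1 * t) ^ tri n * lam ^ (n * k) * ((r * t) ^ tri n * Pk))
    with ((Cmod a1 * t) ^ tri n * (r * t) ^ tri n * lam ^ (n * k) * Pk) by ring.
  apply Rmult_le_compat_l; [| exact HPk].
  repeat apply Rmult_le_pos; try (apply pow_le; try apply Rmult_le_pos; lra).
Qed.
(** Take [n = p k] with [p] fixed and [k] tending to infinity. In units of [k^2 / 2], the logarithm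
    of the cluster bound is [p^2 ln A + 2 p ln lam + ln bb], against [(p+1)^2 ln A] for a capacity
    at most [A = |a1| r]. The excess [2 p (ln lam - ln A) - (ln A - ln bb)] is positive for large
    [p], because [lam > A]. *)
Lemma capacity_rigidity :
  (forall r, 0 < r <= r0 -> tdiam (image_disc f r) <= Cmod a1 * r) -> False.
Proof.
  intros Hconst. assert (A1 : 0 < Cmod a1) by now apply Cmod_gt_0.
  destruct (strictly_differentiable_at_0 f 1 a1 Rlt_0_1 Hf Ha1 (Cmod a1 / 2) ltac:(lra))
    as [d [Hd Hstrict]].
  set (s := Rmin r0 d / 2).
  assert (M0 : 0 < Rmin r0 d) by (apply Rmin_glb_lt; lra).
  assert (M1 := Rmin_l r0 d). assert (M2 := Rmin_r r0 d).
  destruct (exists_large_difference s ltac:(unfold s; lra)) as [x [Hx Hdx]].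
  set (D := Cmod (f x - f 0)) in *.
  assert (Hq : Cmod x < D / Cmod a1) by (apply Rlt_div_r; lra).
  (* Halfway between [|x|] and [D / |a1|]: the disc contains [x] and yet [|a1| r < D]. The other
     bound keeps strict differentiability and the hypothesis on [tdiam] available. *)
  set (r := Rmin ((Cmod x + D / Cmod a1) / 2) (Rmin r0 d)).
  assert (R1 : r <= (Cmod x + D / Cmod a1) / 2) by apply Rmin_l.
  assert (R2 : r <= Rmin r0 d) by apply Rmin_r.
  assert (R3 : Cmod x < r) by (apply Rmin_glb_lt; unfold s in Hx; lra).
  assert (R4 : Cmod a1 * r < D).
  { apply Rle_lt_trans with (Cmod a1 * ((Cmod x + D / Cmod a1) / 2)).
    - apply Rmult_le_compat_l; lra.
    - replace (Cmod a1 * ((Cmod x + D / Cmod a1) / 2)) with ((Cmod a1 * Cmod x + D) / 2)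
        by (field; lra). lra. }
  assert (Hr : 0 < r < 1) by lra.
  set (A := Cmod a1 * r) in *. assert (PA : 0 < A) by (apply Rmult_lt_0_compat; lra).
  (* The interval from [A] to [D] is cut into thirds: one for the moving of [x], one for the moving
     of [0], one for the final gain. *)
  set (lam := (2 * A + D) / 3). set (lam0 := (A + 2 * D) / 3).
  destruct (cdiff_ccont f x (Hf x ltac:(lra)) (D - lam0) ltac:(unfold lam0; lra)) as [d3 [D3 Hcx]].
  set (rho := Rmin d3 (r - Cmod x)).
  assert (Prho : 0 < rho) by (apply Rmin_glb_lt; lra).
  assert (Q1 : rho <= d3) by apply Rmin_l. assert (Q2 : rho <= r - Cmod x) by apply Rmin_r.
  assert (Hin : forall y, Cmod (y - x) < rho -> Cmod y < r).
  { intros y Hy. assert (T := Cmod_triangle_rev y x). lra. }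
  assert (Hball : forall y, Cmod (y - x) < rho -> Cmod y < r /\ lam0 <= Cmod (f y - f 0)).
  { intros y Hy. split; [now apply Hin |]. specialize (Hcx y ltac:(lra)).
    assert (T := Cmod_triangle_rev (f x - f 0) (f y - f 0)).
    replace (f x - f 0 - (f y - f 0))%C with (- (f y - f x))%C in T by ring.
    rewrite Cmod_opp in T. fold D in T. lra. }
  assert (Hlip : forall y y', Cmod (y - x) < rho -> Cmod (y' - x) < rho ->
     Cmod a1 / 2 * Cmod (y - y') <= Cmod (f y - f y')).
  { intros y y' Hy Hy'. assert (Y1 := Hin y Hy). assert (Y2 := Hin y' Hy').
    specialize (Hstrict y y' ltac:(lra) ltac:(lra)).
    assert (T := Cmod_triangle_rev (a1 * (y - y')) (f y - f y')).
    rewrite (Cmod_minus_sym (a1 * (y - y'))), Cmod_mult in T. lra. }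
  set (bb := Cmod a1 / 2 * (rho / 2)).
  assert (Pbb : 0 < bb) by (apply Rmult_lt_0_compat; lra).
  assert (Plam : 0 < lam) by (unfold lam; lra).
  assert (Lgap : 0 < ln lam - ln A) by (apply Rlt_0_minus, ln_increasing; unfold lam; lra).
  destruct (archimed_cor1 ((ln lam - ln A) / (Rabs (ln A - ln bb) + 1))) as [p [Hp1 Hp2]].
  { apply Rdiv_lt_0_compat; [assumption |]. assert (W := Rabs_pos (ln A - ln bb)). lra. }
  set (P := INR p). assert (PP : 1 <= P) by (apply (le_INR 1); lia).
  assert (HP : ln A - ln bb + 1 < 2 * P * (ln lam - ln A)).
  { assert (W := Rabs_pos (ln A - ln bb)). assert (W2 := Rle_abs (ln A - ln bb)).
    apply (Rmult_lt_compat_r (P * (Rabs (ln A - ln bb) + 1))) in Hp1.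
    2: { apply Rmult_lt_0_compat; lra. }
    fold P in Hp1.
    replace (/ P * (P * (Rabs (ln A - ln bb) + 1))) with (Rabs (ln A - ln bb) + 1) in Hp1
      by (field; lra).
    replace ((ln lam - ln A) / (Rabs (ln A - ln bb) + 1) * (P * (Rabs (ln A - ln bb) + 1)))
      with (P * (ln lam - ln A)) in Hp1 by (field; lra).
    assert (0 < P * (ln lam - ln A)) by (apply Rmult_lt_0_compat; lra). lra. }
  set (S2 := P ^ 2 + (P + 1) ^ 2).
  assert (PS2 : 0 < S2) by (unfold S2; nra).
  (* Replacing [A] by [alpha] and [beta] costs [e (p^2 + (p+1)^2) = 1/4] of an excess that exceeds
     [1]. *)
  set (e := / (4 * S2)). assert (Pe : 0 < e) by (apply Rinv_0_lt_compat; lra).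
  assert (EeS : e * S2 = / 4) by (unfold e; field; lra).
  set (alpha := exp (ln A - e)). set (beta := exp (ln A + e)).
  assert (Halpha : 0 < alpha < A).
  { split; [apply exp_pos |]. rewrite <- (exp_ln A) by assumption. apply exp_increasing. lra. }
  assert (Hbeta : A < beta).
  { rewrite <- (exp_ln A) at 1 by assumption. apply exp_increasing. lra. }
  assert (HE := has_diameter_image f Hf r Hr).
  assert (Hlim := ndiam_tdiam _ HE). apply is_lim_seq_spec in Hlim.
  destruct (Hlim (mkposreal (beta - A) ltac:(lra))) as [N HN]. simpl in HN.
  assert (Htd := Hconst r ltac:(lra)). fold A in Htd.
  set (cst := P * (ln A - e) + ln bb - (P + 1) * (ln A + e)).
  destruct (INR_unbounded (Rabs cst * 2)) as [k0 Hk0].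
  set (k := (k0 + N + 2)%nat). set (K := INR k).
  assert (HK : Rabs cst * 2 < K).
  { unfold K, k. rewrite !plus_INR. assert (W := pos_INR N). simpl. lra. }
  assert (HK2 : 2 <= K) by (apply (le_INR 2); unfold k; lia).
  set (n := (p * k)%nat).
  assert (Hn : (2 <= n)%nat) by (unfold n, k; nia).
  assert (Hcl := ndiam_two_clusters r lam0 lam (Cmod a1 / 2) rho alpha x n k Hn
    ltac:(unfold k; lia) Hr Plam ltac:(unfold lam, lam0; lra) Prho ltac:(lra) Hball Hlip Halpha).
  fold bb in Hcl.
  assert (Hnd : ndiam (n + k) (image_disc f r) <= beta).
  { specialize (HN (n + k - 2)%nat ltac:(unfold k; lia)).
    replace (n + k - 2 + 2)%nat with (n + k)%nat in HN by lia.
    apply Rabs_def2 in HN. lra. }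
  assert (Hpow : ndiam (n + k) (image_disc f r) ^ tri (n + k) <= beta ^ tri (n + k)).
  { apply pow_incr. split; [apply ndiam_nonneg; [lia | assumption] | assumption]. }
  assert (Eexp : forall y q, 0 < y -> y ^ q = exp (INR q * ln y))
    by (intros y q Hy; rewrite <- Rpower_pow by assumption; reflexivity).
  assert (Hfin : exp (INR (tri n) * ln alpha + INR (n * k) * ln lam + INR (tri k) * ln bb)
     <= exp (INR (tri (n + k)) * ln beta)).
  { rewrite !exp_plus, <- !Eexp by (assumption || apply exp_pos). lra. }
  assert (Hlog : INR (tri n) * ln alpha + INR (n * k) * ln lam + INR (tri k) * ln bb
     <= INR (tri (n + k)) * ln beta).
  { apply Rnot_lt_le. intros W. apply exp_increasing in W. lra. }
  unfold alpha, beta in Hlog. rewrite !ln_exp, !INR_tri, plus_INR in Hlog. unfold n in Hlog.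
  rewrite !mult_INR in Hlog. fold P K in Hlog.
  (* Division by [K / 2] leaves the quadratic terms multiplied by [K]; the linear parts of the
     triangular numbers are gathered in [cst], which does not depend on [k]. *)
  assert (Hdiv : K * (2 * P * (ln lam - ln A) - (ln A - ln bb) - e * S2) <= cst).
  { apply (Rmult_le_reg_l (K / 2)); [lra |]. unfold cst, S2. lra. }
  rewrite EeS in Hdiv.
  assert (W := Rle_abs cst).
  assert (K * (3 / 4) <= K * (2 * P * (ln lam - ln A) - (ln A - ln bb) - / 4))
    by (apply Rmult_le_compat_l; lra).
  assert (W0 := Rabs_pos cst). lra.
Qed.
End CapacityRigidity.

(** * The theorem *)

(** The mean value theorem is real, so it is applied along the segment from [0] to [z] to a
    1-Lipschitz real function of [f], taken to be [Re] and then [Im]. *)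
Lemma constant_of_zero_derivative (f : C -> C) (r : R) :
  (forall z, Cmod z < r -> cderiv f z 0) -> forall z, Cmod z < r -> f z = f 0.
Proof.
  intros Hf z Hz.
  assert (Hmod : forall t, 0 <= t <= 1 -> Cmod (RtoC t * z) < r).
  { intros t Ht. rewrite Cmod_mult, Cmod_R, Rabs_right by lra.
    assert (Z := Cmod_ge_0 z). nra. }
  assert (Hder : forall t, 0 <= t <= 1 -> forall eps, 0 < eps -> exists d, 0 < d /\
     forall h, h <> 0 -> Rabs h < d ->
       Cmod (f (RtoC (t + h) * z)%C - f (RtoC t * z)%C) < eps * Rabs h).
  { intros t Ht eps He. assert (Z := Cmod_ge_0 z).
    destruct (Hf _ (Hmod t Ht) (eps / (Cmod z + 1))) as [d [Hd H1]].
    { apply Rdiv_lt_0_compat; lra. }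
    exists (d / (Cmod z + 1)). split; [apply Rdiv_lt_0_compat; lra |]. intros h Nh Hh.
    assert (E : (RtoC (t + h) * z - RtoC t * z)%C = (RtoC h * z)%C) by (rewrite RtoC_plus; ring).
    specialize (H1 (RtoC (t + h) * z)%C). rewrite E, Cmod_mult, Cmod_R in H1.
    assert (Ph : 0 < Rabs h) by now apply Rabs_pos_lt.
    assert (L : Rabs h * Cmod z < d).
    { apply (Rmult_lt_compat_r (Cmod z + 1)) in Hh; [| lra].
      replace (d / (Cmod z + 1) * (Cmod z + 1)) with d in Hh by (field; lra). nra. }
    specialize (H1 L).
    replace (f (RtoC (t + h) * z) - f (RtoC t * z) - 0 * (RtoC h * z))%C
      with (f (RtoC (t + h) * z)%C - f (RtoC t * z)%C)%C in H1 by ring.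
    eapply Rle_lt_trans; [exact H1 |].
    replace (eps * Rabs h) with (eps / (Cmod z + 1) * (Rabs h * (Cmod z + 1))) by (field; lra).
    apply Rmult_lt_compat_l; [apply Rdiv_lt_0_compat; lra | nra]. }
  assert (Hpart : forall g : C -> R, (forall u v, Rabs (g u - g v) <= Cmod (u - v)) ->
     g (f z) = g (f 0)).
  { intros g Hg. set (phi := fun t : R => g (f (RtoC t * z)%C)).
    assert (D : forall t, 0 <= t <= 1 -> derivable_pt_lim phi t 0).
    { intros t Ht eps He. destruct (Hder t Ht eps He) as [d [Hd H1]].
      exists (mkposreal d Hd). intros h Nh Hh. specialize (H1 h Nh Hh).
      unfold phi. rewrite Rminus_0_r. unfold Rdiv. rewrite Rabs_mult, Rabs_inv.
      apply (Rmult_lt_reg_r (Rabs h)); [now apply Rabs_pos_lt |].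
      rewrite Rmult_assoc, Rinv_l, Rmult_1_r by now apply Rabs_no_R0.
      eapply Rle_lt_trans; [apply Hg | exact H1]. }
    destruct (MVT_gen phi 0 1 (fun _ => 0)) as [c [_ Hc]].
    - intros t Ht. rewrite Rmin_left, Rmax_right in Ht by lra. apply is_derive_Reals, D. lra.
    - intros t Ht. rewrite Rmin_left, Rmax_right in Ht by lra.
      apply derivable_continuous_pt. exists 0. now apply D.
    - unfold phi in Hc. rewrite !Cmult_1_l, !Cmult_0_l in Hc. lra. }
  assert (E1 := Hpart Re (fun u v => re_le_Cmod (u - v))).
  assert (E2 := Hpart Im (fun u v => im_le_Cmod (u - v))).
  destruct (f z) as [p q], (f 0) as [p' q']. simpl in E1, E2. now subst.
Qed.

(** Meant for [a1 = 0]: a point with nonzero derivative close to [0] shows that small images still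
    have positive diameter. Without one, [f] would be constant near [0]. *)
Lemma nonzero_derivative_of_leading_term (f : C -> C) (m : nat) (a1 a : C) (r : R) : 0 < r -> r < 1 ->
  (forall z, Cmod z < 1 -> cdiff f z) -> a <> 0 -> (1 <= m)%nat ->
  leading_term (fun z => f z - f 0 - a1 * z)%C (S m) a ->
  exists x l : C, Cmod x < r /\ l <> 0 /\ cderiv f x l.
Proof.
  intros Hr Hr1 Hf Na Hm Hlead. apply NNPP. intros Hno.
  assert (Hz : forall z, Cmod z < r -> cderiv f z 0).
  { intros z Hz. destruct (Hf z ltac:(lra)) as [l Hl].
    destruct (Ceq_dec l 0) as [<- | Nl]; [assumption |]. exfalso. apply Hno. now exists z, l. }
  assert (Hc := constant_of_zero_derivative f r Hz).
  assert (A : 0 < Cmod a) by now apply Cmod_gt_0.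
  (* On the disc [a1 z + a z^(m+1) = o(z^(m+1))]: compare the values at [z] and at [z / 2]. *)
  set (eps := Cmod a / 8).
  destruct (Hlead eps ltac:(unfold eps; lra)) as [d [Hd H1]].
  set (t := Rmin d r / 2). assert (T0 : 0 < Rmin d r) by now apply Rmin_glb_lt.
  assert (T1 := Rmin_l d r). assert (T2 := Rmin_r d r).
  assert (Pt : 0 < t) by (unfold t; lra).
  assert (Hv : forall u, 0 < u -> u <= t ->
     Cmod (RtoC u * (a1 + a * u ^ m)) <= eps * (u * u ^ m)).
  { intros u U1 U2. assert (Cu : Cmod u = u) by (rewrite Cmod_R, Rabs_right; lra).
    specialize (H1 u ltac:(rewrite Cu; unfold t in U2; lra)). rewrite Cu in H1.
    rewrite Hc in H1 by (rewrite Cu; unfold t in U2; lra).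
    replace (RtoC u * (a1 + a * u ^ m))%C with (- (f 0 - f 0 - a1 * u - a * u ^ S m))%C
      by (rewrite Cpow_S; ring).
    rewrite Cmod_opp. exact H1. }
  assert (Hw : forall u, 0 < u -> u <= t -> Cmod (a1 + a * u ^ m) <= eps * u ^ m).
  { intros u U1 U2. specialize (Hv u U1 U2). rewrite Cmod_mult, Cmod_R, Rabs_right in Hv by lra.
    apply (Rmult_le_reg_l u); [assumption |]. lra. }
  assert (W1 := Hw t Pt (Rle_refl t)). assert (W2 := Hw (t / 2) ltac:(lra) ltac:(lra)).
  assert (T := Cmod_triangle_minus (a1 + a * t ^ m) (a1 + a * (t / 2)%R ^ m)).
  replace (a1 + a * t ^ m - (a1 + a * (t / 2)%R ^ m))%C
    with (a * RtoC (t ^ m - (t / 2) ^ m))%C in T by (rewrite RtoC_minus, !RtoC_pow; ring).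
  assert (Pm : 0 < t ^ m) by now apply pow_lt.
  assert (Hhalf : (t / 2) ^ m <= t ^ m / 2).
  { unfold Rdiv. rewrite Rpow_mult_distr. apply Rmult_le_compat_l; [lra |].
    destruct m as [| k]; [lia |]. simpl. apply Rle_trans with (/ 2 * 1); [| lra].
    apply Rmult_le_compat_l; [lra |]. rewrite <- (pow1 k). apply pow_incr. lra. }
  assert (H2 : 0 <= (t / 2) ^ m) by (apply pow_le; lra).
  rewrite Cmod_mult, Cmod_R, Rabs_right in T by lra.
  unfold eps in W1, W2. nra.
Qed.

(** The derivative bound is applied to [f] recentred at [x] and rescaled to the unit disc. [K] does
    not depend on [n], so positivity survives for the capacity. *)
Lemma ndiam_image_lower_bound (f : C -> C) (r : R) (x l : C) : 0 < r < 1 ->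
  (forall z, Cmod z < 1 -> cdiff f z) -> Cmod x < r -> l <> 0 -> cderiv f x l ->
  exists K, 0 < K /\ forall n, (2 <= n)%nat -> K * ndiam n (Defs.disc 1) <= ndiam n (image_disc f r).
Proof.
  intros Hr Hf Hx Nl Hl. set (rho := r - Cmod x).
  assert (Prho : 0 < rho) by (unfold rho; lra).
  set (g := fun z => f (x + RtoC rho * z)%C).
  assert (Crho : Cmod rho = rho) by (rewrite Cmod_R, Rabs_right; lra).
  assert (Hin : forall z, Cmod z < 1 -> Cmod (x + RtoC rho * z) < r).
  { intros z Hz. eapply Rle_lt_trans; [apply Cmod_triangle |]. rewrite Cmod_mult, Crho.
    unfold rho in *. nra. }
  assert (Hg : forall z, Cmod z < 1 -> cdiff g z).
  { intros z Hz. apply (cdiff_comp f (fun z => x + RtoC rho * z)%C).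
    - apply cdiff_plus; [apply cdiff_const | apply cdiff_scal, cdiff_id].
    - apply Hf. specialize (Hin z Hz). lra. }
  assert (Hg0 : cderiv g 0 (l * rho)).
  { intros eps He. destruct (Hl (eps / rho)) as [d [Hd H1]]; [now apply Rdiv_lt_0_compat |].
    exists (d / rho). split; [now apply Rdiv_lt_0_compat |]. intros w Hw.
    replace (w - 0)%C with w in * by ring. specialize (H1 (x + RtoC rho * w)%C).
    replace (x + RtoC rho * w - x)%C with (RtoC rho * w)%C in H1 by ring.
    rewrite Cmod_mult, Crho in H1.
    assert (Q : rho * Cmod w < d).
    { apply (Rmult_lt_compat_l rho) in Hw; [| assumption].
      replace (rho * (d / rho)) with d in Hw by (field; lra). exact Hw. }
    specialize (H1 Q). unfold g. replace (x + RtoC rho * 0)%C with x by ring.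
    replace (l * rho * w)%C with (l * (RtoC rho * w))%C by ring.
    replace (eps * Cmod w) with (eps / rho * (rho * Cmod w)) by (field; lra). exact H1. }
  exists (Cmod (l * rho) * (1 / 2)). split.
  { rewrite Cmod_mult, Crho. assert (0 < Cmod l) by now apply Cmod_gt_0.
    repeat apply Rmult_lt_0_compat; lra. }
  intros n Hn. eapply Rle_trans.
  - apply (ndiam_image_ge_derivative g Hg n (1 / 2) (l * rho) Hn); [lra | assumption].
  - apply ndiam_subset; [assumption | apply has_diameter_image; [assumption | lra] |
      now apply has_diameter_image |].
    intros p [z [Hz ->]]. exists (x + RtoC rho * z)%C. split; [apply Hin; lra | reflexivity].
Qed.

Lemma ndiam_linear_image (f : C -> C) (a b : C) (n : nat) (r : R) : (2 <= n)%nat -> 0 < r < 1 ->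
  (forall z, Cmod z < 1 -> f z = (a * z + b)%C) ->
  ndiam n (image_disc f r) = Cmod a * ndiam n (Defs.disc r).
Proof.
  intros Hn Hr Hlin.
  assert (Hf : forall z, Cmod z < 1 -> cdiff f z).
  { intros z Hz. apply (cdiff_ext_loc (fun z => a * z + b)%C f z (1 - Cmod z)); [lra | |].
    - intros w Hw. symmetry. apply Hlin. assert (T := Cmod_triangle_rev w z). lra.
    - apply cdiff_plus; [apply cdiff_scal, cdiff_id | apply cdiff_const]. }
  apply Rle_antisym.
  - apply (ndiam_lipschitz n _ _ (fun p q => Cmod q < r /\ p = f q)); auto.
    + now apply has_diameter_image.
    + now apply has_diameter_disc.
    + apply Cmod_ge_0.
    + intros p [z [Hz ->]]. now exists z.
    + intros p q p' q' [B1 ->] [B2 ->]. rewrite !Hlin by lra. rewrite <- Cmod_mult. right.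
      f_equal. ring.
  (* The derivative bound also covers [a = 0], where tuples cannot be carried back by an inverse. *)
  - rewrite ndiam_disc_scal, <- Rmult_assoc by (assumption || lra).
    apply ndiam_image_ge_derivative; [assumption | assumption | assumption |].
    intros eps He. exists 1. split; [lra |]. intros w Hw. replace (w - 0)%C with w in * by ring.
    rewrite !Hlin by (rewrite ?Cmod_0; lra).
    replace (a * w + b - (a * 0 + b) - a * w)%C with (RtoC 0) by ring. rewrite Cmod_0.
    apply Rmult_le_pos; [lra | apply Cmod_ge_0].
Qed.

(** * The two ratios *)

Section Ratios.
Variable f : C -> C.
Hypothesis Hf : forall z, Cmod z < 1 -> cdiff f z.

Lemma tdiam_image_lim (r : R) : 0 < r < 1 ->
  is_lim_seq (fun m => ndiam (m + 2) (image_disc f r) / r) (tdiam (image_disc f r) / r).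
Proof.
  intros Hr. apply (is_lim_seq_ext (fun m => / r * ndiam (m + 2) (image_disc f r))).
  { intros m. unfold Rdiv. ring. }
  replace (Finite (tdiam (image_disc f r) / r)) with (Rbar_mult (/ r) (tdiam (image_disc f r)))
    by (simpl; f_equal; unfold Rdiv; ring).
  now apply is_lim_seq_scal_l, ndiam_tdiam, has_diameter_image.
Qed.

Lemma phi_cap_eq (r : R) : 0 < r -> phi_cap f r = tdiam (image_disc f r) / r.
Proof. intros Hr. unfold phi_cap. now rewrite tdiam_disc. Qed.

Lemma exp_unit_interval (t : R) : t < 0 -> 0 < exp t < 1.
Proof. intros Ht. split; [apply exp_pos |]. rewrite <- exp_0. now apply exp_increasing. Qed.

Lemma phi_cap_increasing : increasing_01 (phi_cap f).
Proof.
  intros r1 r2 H1 H12 H2. rewrite !phi_cap_eq by lra.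
  apply (is_lim_seq_le (fun m => ndiam (m + 2) (image_disc f r1) / r1)
           (fun m => ndiam (m + 2) (image_disc f r2) / r2)
           (tdiam (image_disc f r1) / r1) (tdiam (image_disc f r2) / r2)).
  - intros m. apply ndiam_ratio_increasing; assumption || lia.
  - apply tdiam_image_lim. lra.
  - apply tdiam_image_lim. lra.
Qed.

Lemma phi_cap_log_convex : log_convex_01 (phi_cap f).
Proof.
  intros t1 t2 l H1 H2 Hl. rewrite !phi_cap_eq by apply exp_pos.
  set (t := l * t1 + (1 - l) * t2).
  assert (Ht : t < 0) by (unfold t; nra).
  apply (is_lim_seq_le (fun m => ndiam (m + 2) (image_disc f (exp t)) / exp t)
    (fun m => l * (ndiam (m + 2) (image_disc f (exp t1)) / exp t1)
              + (1 - l) * (ndiam (m + 2) (image_disc f (exp t2)) / exp t2))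
    (tdiam (image_disc f (exp t)) / exp t)
    (l * (tdiam (image_disc f (exp t1)) / exp t1) + (1 - l) * (tdiam (image_disc f (exp t2)) / exp t2))).
  - intros m. apply ndiam_ratio_convex; assumption || lia.
  - apply tdiam_image_lim, exp_unit_interval, Ht.
  - apply is_lim_seq_plus'.
    + apply (is_lim_seq_scal_l _ l (tdiam (image_disc f (exp t1)) / exp t1)).
      apply tdiam_image_lim, exp_unit_interval, H1.
    + apply (is_lim_seq_scal_l _ (1 - l) (tdiam (image_disc f (exp t2)) / exp t2)).
      apply tdiam_image_lim, exp_unit_interval, H2.
Qed.

Lemma phi_ndiam_eq (n : nat) (r : R) : (2 <= n)%nat -> 0 < r ->
  phi_ndiam f n r = / ndiam n (Defs.disc 1) * (ndiam n (image_disc f r) / r).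
Proof.
  intros Hn Hr. destruct (ndiam_unit_disc_pow n Hn) as [Pc _].
  unfold phi_ndiam. field. split; lra.
Qed.

Lemma phi_ndiam_increasing (n : nat) : (2 <= n)%nat -> increasing_01 (phi_ndiam f n).
Proof.
  intros Hn r1 r2 H1 H12 H2. destruct (ndiam_unit_disc_pow n Hn) as [Pc _].
  rewrite !phi_ndiam_eq by (assumption || lra).
  apply Rmult_le_compat_l; [left; now apply Rinv_0_lt_compat |].
  now apply ndiam_ratio_increasing.
Qed.

Lemma phi_ndiam_log_convex (n : nat) : (2 <= n)%nat -> log_convex_01 (phi_ndiam f n).
Proof.
  intros Hn t1 t2 l H1 H2 Hl. destruct (ndiam_unit_disc_pow n Hn) as [Pc _].
  rewrite !phi_ndiam_eq by (assumption || apply exp_pos).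
  assert (Pi : 0 < / ndiam n (Defs.disc 1)) by now apply Rinv_0_lt_compat.
  assert (K := ndiam_ratio_convex f Hf n t1 t2 l Hn H1 H2 Hl).
  apply (Rmult_le_compat_l (/ ndiam n (Defs.disc 1))) in K; [| lra]. lra.
Qed.

(** The hypotheses isolate what is proved separately for the two ratios: the upper bound near [0],
    positivity as soon as some derivative is nonzero (this excludes [a1 = 0]), and rigidity for [a1]
    nonzero. *)
Lemma strictly_increasing_of_rigidity (phi : R -> R) :
  increasing_01 phi -> log_convex_01 phi -> ~ is_linear_on_disc f ->
  (forall a1 eta, cderiv f 0 a1 -> 0 < eta -> exists d, 0 < d <= 1 /\
     forall r, 0 < r < d -> phi r <= Cmod a1 + eta) ->
  (forall r x l, 0 < r < 1 -> Cmod x < r -> l <> RtoC 0 -> cderiv f x l -> 0 < phi r) ->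
  (forall m a1 a r0, (1 <= m)%nat -> a1 <> RtoC 0 -> a <> RtoC 0 -> cderiv f 0 a1 ->
     leading_term (fun z => f z - f 0 - a1 * z)%C (S m) a -> 0 < r0 < 1 ->
     ~ forall r, 0 < r <= r0 -> phi r <= Cmod a1) ->
  strictly_increasing_01 phi.
Proof.
  intros Hinc Hconv Hnl Hnear Hpos Hrigid. apply NNPP. intros Hns.
  destruct (constant_of_not_strictly_increasing phi Hinc Hconv Hns) as [r0 [Hr0 Hc]].
  destruct (Hf 0 ltac:(rewrite Cmod_0; lra)) as [a1 Ha1].
  destruct (linear_or_leading_term f a1 Hf Ha1 Hnl) as [m [a [Hm [Na Hlead]]]].
  assert (Hle : phi r0 <= Cmod a1).
  { apply le_epsilon. intros eta Heta. destruct (Hnear a1 eta Ha1 Heta) as [d [Hd H1]].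
    set (r := Rmin (d / 2) r0). assert (P : 0 < r) by (apply Rmin_glb_lt; lra).
    assert (R1 : r <= d / 2) by apply Rmin_l. assert (R2 : r <= r0) by apply Rmin_r.
    rewrite <- (Hc r) by lra. apply H1. lra. }
  destruct (Ceq_dec a1 0) as [Z | Na1].
  - destruct (nonzero_derivative_of_leading_term f m a1 a r0) as [x [l [Hx [Nl Hl]]]];
      try assumption; try lra.
    assert (P := Hpos r0 x l Hr0 Hx Nl Hl). rewrite Z, Cmod_0 in Hle. lra.
  - apply (Hrigid m a1 a r0 Hm Na1 Na Ha1 Hlead Hr0). intros r Hr. rewrite Hc by assumption. exact Hle.
Qed.

Lemma phi_cap_strict : ~ is_linear_on_disc f -> strictly_increasing_01 (phi_cap f).
Proof.
  intros Hnl. apply strictly_increasing_of_rigidity; auto using phi_cap_increasing, phi_cap_log_convex.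
  - intros a1 eta Ha1 Heta. destruct (ndiam_image_near_0 f Hf a1 eta Ha1 Heta) as [d [Hd H1]].
    exists d. split; [assumption |]. intros r Hr. rewrite phi_cap_eq by lra.
    apply Rle_div_l; [lra |]. rewrite <- (tdiam_disc r) at 2 by lra.
    apply tdiam_le; [apply has_diameter_image; [assumption | lra] | apply has_diameter_disc; lra |].
    intros n Hn. now apply H1.
  - intros r x l Hr Hx Nl Hl. destruct (ndiam_image_lower_bound f r x l Hr Hf Hx Nl Hl) as [K [PK HK]].
    rewrite phi_cap_eq by lra. apply Rdiv_lt_0_compat; [| lra].
    assert (T : tdiam (Defs.disc 1) <= / K * tdiam (image_disc f r)).
    { apply tdiam_le; [apply has_diameter_disc; lra | now apply has_diameter_image |].
      intros n Hn. apply (Rmult_le_reg_l K); [assumption |].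
      rewrite <- Rmult_assoc, Rinv_r, Rmult_1_l by lra. now apply HK. }
    rewrite tdiam_unit_disc in T. apply (Rmult_le_compat_l K) in T; [| lra].
    rewrite <- Rmult_assoc, Rinv_r, Rmult_1_l in T by lra. lra.
  - intros m a1 a r0 Hm Na1 Na Ha1 Hlead Hr0 Hle.
    apply (capacity_rigidity f m a1 a r0); auto. intros r Hr.
    specialize (Hle r Hr). rewrite phi_cap_eq in Hle by lra. apply Rle_div_l in Hle; lra.
Qed.

Lemma phi_ndiam_strict (n : nat) : (2 <= n)%nat -> ~ is_linear_on_disc f ->
  strictly_increasing_01 (phi_ndiam f n).
Proof.
  intros Hn Hnl. destruct (ndiam_unit_disc_pow n Hn) as [Pc _].
  apply strictly_increasing_of_rigidity; auto using phi_ndiam_increasing, phi_ndiam_log_convex.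
  - intros a1 eta Ha1 Heta. destruct (ndiam_image_near_0 f Hf a1 eta Ha1 Heta) as [d [Hd H1]].
    exists d. split; [assumption |]. intros r Hr. unfold phi_ndiam.
    apply Rle_div_l; [apply Rmult_lt_0_compat; lra |].
    destruct (H1 n r Hn Hr) as [_ H2]. rewrite ndiam_disc_scal in H2 by (assumption || lra). lra.
  - intros r x l Hr Hx Nl Hl. destruct (ndiam_image_lower_bound f r x l Hr Hf Hx Nl Hl) as [K [PK HK]].
    unfold phi_ndiam. apply Rdiv_lt_0_compat; [| apply Rmult_lt_0_compat; lra].
    eapply Rlt_le_trans; [| now apply HK]. now apply Rmult_lt_0_compat.
  - intros m a1 a r0 Hm Na1 Na Ha1 Hlead Hr0 Hle.
    apply (ndiam_rigidity f n m a1 a r0); auto. intros r Hr.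
    specialize (Hle r Hr). unfold phi_ndiam in Hle.
    apply Rle_div_l in Hle; [lra | apply Rmult_lt_0_compat; lra].
Qed.

Lemma not_linear_of_strict (phi : R -> R) :
  (forall a b r, (forall z, Cmod z < 1 -> f z = (a * z + b)%C) -> 0 < r < 1 -> phi r = Cmod a) ->
  strictly_increasing_01 phi -> ~ is_linear_on_disc f.
Proof.
  intros H Hs [a [b Hlin]]. specialize (Hs (1 / 4) (1 / 2) ltac:(lra) ltac:(lra) ltac:(lra)).
  rewrite !(H a b) in Hs by (assumption || lra). lra.
Qed.

Lemma phi_ndiam_linear (n : nat) (a b : C) (r : R) : (2 <= n)%nat ->
  (forall z, Cmod z < 1 -> f z = (a * z + b)%C) -> 0 < r < 1 -> phi_ndiam f n r = Cmod a.
Proof.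
  intros Hn Hlin Hr. destruct (ndiam_unit_disc_pow n Hn) as [Pc _]. unfold phi_ndiam.
  rewrite (ndiam_linear_image f a b), ndiam_disc_scal by (assumption || lra). field. lra.
Qed.

Lemma phi_cap_linear (a b : C) (r : R) :
  (forall z, Cmod z < 1 -> f z = (a * z + b)%C) -> 0 < r < 1 -> phi_cap f r = Cmod a.
Proof.
  intros Hlin Hr. rewrite phi_cap_eq by lra.
  assert (L1 := ndiam_tdiam _ (has_diameter_image f Hf r Hr)).
  assert (L2 : is_lim_seq (fun m => ndiam (m + 2) (image_disc f r))
                 (Rbar_mult (Cmod a) (tdiam (Defs.disc r)))).
  { apply (is_lim_seq_ext (fun m => Cmod a * ndiam (m + 2) (Defs.disc r))).
    - intros m. symmetry. apply (ndiam_linear_image f a b); assumption || lia.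
    - apply is_lim_seq_scal_l, ndiam_tdiam, has_diameter_disc. lra. }
  apply is_lim_seq_unique in L1. apply is_lim_seq_unique in L2. rewrite L1 in L2.
  rewrite tdiam_disc in L2 by lra. simpl in L2. injection L2. intros ->. field. lra.
Qed.
End Ratios.

Theorem theorem1p6 (f : C -> C) (n : nat) :
  (2 <= n)%nat ->
  analytic_on_disc f ->
  (increasing_01 (phi_cap f) /\ log_convex_01 (phi_cap f) /\
     (strictly_increasing_01 (phi_cap f) <-> ~ is_linear_on_disc f)) /\
  (increasing_01 (phi_ndiam f n) /\ log_convex_01 (phi_ndiam f n) /\
     (strictly_increasing_01 (phi_ndiam f n) <-> ~ is_linear_on_disc f)).
Proof.
  intros Hn Han.
  assert (Hf : forall z, Cmod z < 1 -> cdiff f z)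
    by (intros z Hz; now apply ex_derive_cdiff, Han).
  split; (split; [| split; [| split]]).
  - now apply phi_cap_increasing.
  - now apply phi_cap_log_convex.
  - apply not_linear_of_strict. intros a b r. now apply phi_cap_linear.
  - now apply phi_cap_strict.
  - now apply phi_ndiam_increasing.
  - now apply phi_ndiam_log_convex.
  - apply not_linear_of_strict. intros a b r. now apply phi_ndiam_linear.
  - now apply phi_ndiam_strict.
Qed.
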